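(* Let $q$ be a prime power. For $d\in\{3,4,5\}$ write $Z_{\alpha,d}(s)$ for the height zeta function of matrix size $d$ and put $u=q^{s/d}$. Then $Z_{\alpha,d}(s)=P_d(q,u)/D_d(q,u)$, where the polynomials are as follows. For $d=3$: \begin{align*} D_3(q,u)&=(q-1)^2(q+1)(q^2+q+1)(q-u)(q^4-u^3),\\ P_3(q,u)&=q^2-qu+2(q^2+q+1)u^2-qu^3+u^4. \end{align*} For $d=4$: \begin{align*} D_4(q,u)={}&(q-1)^3(q+1)^2(q^2+1)(q^2+q+1)\\ &\cdot(q-u)(q+u)(q^3-u^2)(q^3+u^2)(q^5-u^4),\\ P_4(q,u)={}&q^7-q^5u^2+2q^4(q+1)(q^2+1)u^3\\ &+q^2(q^5+2q^4+4q^3+4q^2+4q+1)u^4\\ &-2q^2(q+1)(q^2+1)u^5\\ &+(q^5+4q^4+4q^3+4q^2+2q+1)u^6\\ &+2(q+1)(q^2+1)u^7-q^2u^8+u^{10}. \end{align*} For $d=5$: \begin{align*} D_5(q,u)={}&(q-1)^4(q+1)^2(q^2+1)(q^2+q+1)(q^4+q^3+q^2+q+1)\\ &\cdot(q-u)(q^6-u^5)(q^7-u^5)(q^8-u^5),\\ P_5(q,u)={}&q^{12}-q^{11}u+2q^8(q^4+q^3+q^2+q+1)u^4\\ &-q^5(q^6-q^4-2q^3-2q^2-2q-1)u^5\\ &+q^4(2q^8+2q^7+3q^6+2q^5+q^4-2q^3-2q^2-2q-1)u^6\\ &-2q^5(q^2+1)(q^4+q^3+q^2+q+1)u^7\\ &+2q^2(q^4+q^3+q^2+q+1)(q^4+q^3+3q^2+q+1)u^8\\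 &-2q(q^2+1)(q^4+q^3+q^2+q+1)u^9\\ &+(-q^8-2q^7-2q^6-2q^5+q^4+2q^3+3q^2+2q+2)u^{10}\\ &+q(q^6+2q^5+2q^4+2q^3+q^2-1)u^{11}\\ &+2(q^4+q^3+q^2+q+1)u^{12}-qu^{15}+u^{16}. \end{align*}
   Context: Let $q$ be a prime power, $d\ge2$ an integer, $F=\mathbb F_q(\!(t^{-1})\!)$ with valuation ring $\mathcal O=\mathbb F_q[\![t^{-1}]\!]$ and absolute value normalized by $|t|=q$. Put $G=\operatorname{PGL}_d(F)$, $K=\operatorname{PGL}_d(\mathcal O)$, $\Gamma=\operatorname{PGL}_d(\mathbb F_q[t])$. Haar measure on $G$ is normalized by $\operatorname{vol}(K)=1$. Put $Y=\Gamma\backslash G/K$ (a countable set), and let $\nu$ be the measure on $Y$ induced from the Haar measure of $G$, i.e. the push-forward to $Y$ of the quotient measure on $\Gamma\backslash G$; equivalently each point $\Gamma gK$ has mass $1/|\Gamma\cap gKg^{-1}|$. Height function $\alpha$. Let $\Lambda_0=\mathbb F_q[t]^d\subset F^d$. Use the max norm on $F^d$ and on each $\bigwedge^jF^d$ the sup norm in the standard exterior basis. For a rank-$d$ $\mathbb F_q[t]$-lattice $\Lambda=g\Lambda_0$, $g\in\operatorname{GL}_d(F)$, put $\operatorname{covol}(\Lambda)=|\det g|$. For the homothety class $[\Lambda]$ define $$\alpha([\Lambda])=\max_{1\le j\le d}\left\{\operatorname{covol}(\Lambda)^{j/d}\,\|v_1\wedge\cdots\wedge v_j\|^{-1}: v_1,\ldots,v_j\in\Lambda\text{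 are $F$-linearly independent}\right\}.$$ This is invariant under homotheties. On $Y$ define $\alpha(\Gamma gK)=\alpha([g^{-1}\Lambda_0])$, which is well-defined because $K$ acts by isometries and $\Gamma$ preserves $[\Lambda_0]$. Height zeta function: $Z_{\alpha,d}(s)=\int_Y\alpha(x)^s\,d\nu(x)$, which converges absolutely exactly for $\operatorname{Re}(s)<d$, and is extended meromorphically to $\mathbb C$. Here $u=q^{s/d}=\exp((s/d)\log q)$. *)

(* Defs.v *)
From HB Require Import structures.
From mathcomp Require Import all_boot all_order all_algebra.
From mathcomp Require Import complex.
From mathcomp Require Import all_classical all_reals all_analysis.

Set Implicit Arguments.
Unset Strict Implicit.
Unset Printing Implicit Defensive.

Import Order.TTheory GRing.Theory Num.Theory.
Import numFieldNormedType.Exports.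

Local Open Scope classical_set_scope.
Local Open Scope ring_scope.

Section PowerSeries.
Variable k : fieldType.

Record fps := FPS { fps_coef : nat -> k }.

HB.instance Definition _ := [isNew for fps_coef].
HB.instance Definition _ := [Choice of fps by <:].

Implicit Types f g h : fps.

Lemma fpsP f g : fps_coef f =1 fps_coef g -> f = g.
Proof. by case: f g => [f] [g] /= /funext ->. Qed.

Definition fps_zero := FPS (fun=> 0).
Definition fps_opp f := FPS (fun n => - fps_coef f n).
Definition fps_add f g := FPS (fun n => fps_coef f n + fps_coef g n).

Fact fps_addA : associative fps_add.
Proof. by move=> f g h; apply: fpsP => n; rewrite /= addrA. Qed.
Fact fps_addC : commutative fps_add.
Proof. by move=> f g; apply: fpsP => n; rewrite /= addrC. Qed.
Fact fps_add0 : left_id fps_zero fps_add.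
Proof. by move=> f; apply: fpsP => n; rewrite /= add0r. Qed.
Fact fps_addN : left_inverse fps_zero fps_opp fps_add.
Proof. by move=> f; apply: fpsP => n; rewrite /= addNr. Qed.

HB.instance Definition _ :=
  GRing.isZmodule.Build fps fps_addA fps_addC fps_add0 fps_addN.

Definition fpsC (c : k) := FPS (fun n => if n == 0%N then c else 0).
Definition fpsX := FPS (fun n => if n == 1%N then 1 else 0).
Definition fps_mul f g :=
  FPS (fun n => \sum_(i < n.+1) fps_coef f i * fps_coef g (n - i)).

Let trunc N f : {poly k} := \poly_(i < N) fps_coef f i.

Let coef_trunc N f n : (n < N)%N -> (trunc N f)`_n = fps_coef f n.
Proof. by move=> nN; rewrite coef_poly nN. Qed.

Let coef_mul N f g n : (n < N)%N ->
  fps_coef (fps_mul f g) n = (trunc N f * trunc N g)`_n.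
Proof.
move=> nN; rewrite coefM /=; apply: eq_bigr => i _.
rewrite !coef_trunc //; first exact: leq_ltn_trans (leq_subr _ _) nN.
by rewrite (leq_ltn_trans _ nN) // -ltnS.
Qed.

Fact fps_mulA : associative fps_mul.
Proof.
move=> f g h; apply: fpsP => n.
transitivity ((trunc n.+1 f * (trunc n.+1 g * trunc n.+1 h))`_n).
  rewrite coefM; apply: eq_bigr => i _; rewrite coef_trunc //; congr (_ * _).
  by apply: coef_mul; rewrite ltnS leq_subr.
rewrite mulrA coefM; apply: eq_bigr => i _.
rewrite (@coef_mul n.+1) // coef_trunc //.
by rewrite ltnS leq_subr.
Qed.

Fact fps_mulC : commutative fps_mul.
Proof.
by move=> f g; apply: fpsP => n; rewrite !(@coef_mul n.+1) // mulrC.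
Qed.

Fact fps_mul1 : left_id (fpsC 1) fps_mul.
Proof.
move=> f; apply: fpsP => n /=; rewrite big_ord_recl /= mul1r subn0 big1 ?addr0//.
by move=> i _; rewrite mul0r.
Qed.

Fact fps_mulDl : left_distributive fps_mul +%R.
Proof.
move=> f g h; apply: fpsP => n /=; rewrite -big_split /=.
by apply: eq_bigr => i _; rewrite mulrDl.
Qed.

Fact fps_1neq0 : fpsC 1 != 0.
Proof.
by apply/eqP => /(congr1 (fun f => fps_coef f 0)) /= /eqP; rewrite oner_eq0.
Qed.

HB.instance Definition _ := GRing.Zmodule_isComNzRing.Build fps
  fps_mulA fps_mulC fps_mul1 fps_mulDl fps_1neq0.

Definition fps_unit : pred fps := fun f => `[< exists g, g * f = 1 >].
Definition fps_inv f := if fps_unit f then xget f [set g | g * f = 1] else f.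

Fact fps_mulV : {in fps_unit, left_inverse 1 fps_inv *%R}.
Proof.
move=> f fu; have {}fu : fps_unit f by [].
rewrite /fps_inv fu; move/asboolP: fu => [g gf].
exact: (xgetPex f (ex_intro [set h | h * f = 1] g gf)).
Qed.

Fact fps_unitP f g : g * f = 1 -> f \in fps_unit.
Proof. by move=> gf; rewrite unfold_in; apply/asboolP; exists g. Qed.

Fact fps_inv_out : {in [predC fps_unit], fps_inv =1 id}.
Proof.
move=> f fu; have {}fu : ~~ fps_unit f by [].
by rewrite /fps_inv (negbTE fu).
Qed.

HB.instance Definition _ :=
  GRing.ComNzRing_hasMulInverse.Build fps fps_mulV fps_unitP fps_inv_out.

Lemma fps_neq0 f : f != 0 -> exists n, fps_coef f n != 0.
Proof.
apply: contra_neqP => /forallNP f0; apply: fpsP => n /=.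
by have /negP := f0 n; rewrite negbK => /eqP.
Qed.

(* The order of vanishing at x = 0, with value 0 for the zero series. *)
Definition fps_ord f : nat :=
  if pselect (exists n, fps_coef f n != 0) is left e then ex_minn e else 0.

Lemma fps_ordP f : f != 0 ->
  fps_coef f (fps_ord f) != 0 /\
  forall n, (n < fps_ord f)%N -> fps_coef f n = 0.
Proof.
move=> /fps_neq0 f0; rewrite /fps_ord; case: pselect => // e.
case: ex_minnP => m fm mmin; split => // n nm.
by apply/eqP; apply: contraTT nm => /mmin; rewrite -leqNgt.
Qed.

Fact fps_idomain f g : f * g = 0 -> (f == 0) || (g == 0).
Proof.
move=> fg0; apply/orP; apply: contrapT => /not_orP[/negP f0 /negP g0].
have [fm fl] := fps_ordP f0; have [gm gl] := fps_ordP g0.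
have /= := congr1 (fun h => fps_coef h (fps_ord f + fps_ord g)) fg0.
have lt : (fps_ord f < (fps_ord f + fps_ord g).+1)%N by rewrite ltnS leq_addr.
rewrite (bigD1 (Ordinal lt)) //= addKn big1 ?addr0.
  by move=> /eqP; rewrite mulf_eq0 (negbTE fm) (negbTE gm).
move=> i; rewrite -val_eqE /= neq_ltn => /orP[/fl ->|il]; first by rewrite mul0r.
rewrite (gl (_ - _)%N) ?mulr0 //; have := ltn_ord i; rewrite ltnS => ile.
by rewrite ltn_subLR // ltn_add2r.
Qed.

HB.instance Definition _ :=
  GRing.ComUnitRing_isIntegral.Build fps fps_idomain.

End PowerSeries.

(* k((1/t)) is the fraction field of k[[x]] with x = 1/t. *)
Definition laurent (k : fieldType) : fieldType := {fraction fps k}.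

Section Laurent.
Variable k : fieldType.

Definition ofps (f : fps k) : laurent k := FracField.tofrac f.

Definition tvar : laurent k := (ofps (fpsX k))^-1.

Definition opoly (p : {poly k}) : laurent k :=
  (map_poly (fun c => ofps (fpsC c)) p).[tvar].

End Laurent.

(* |f / g| = q ^ (ord g - ord f), where q = #|k|. *)
Definition absv (R : realType) (k : finFieldType) (a : laurent k) : R :=
  if a == 0 then 0
  else #|k|%:R ^
    ((fps_ord (frac (repr a)).2)%:Z - (fps_ord (frac (repr a)).1)%:Z).

Section LinearGroups.
Variables (F : fieldType) (n : nat).

Record GL := MkGL { GLmx : 'M[F]_n; _ : GLmx \in unitmx }.

HB.instance Definition _ := [isSub for GLmx].
HB.instance Definition _ := [Choice of GL by <:].

Implicit Types g h : GL.

Lemma GL_unit g : GLmx g \in unitmx. Proof. exact: valP g. Qed.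

Fact GL_one_subproof : 1%:M \in @unitmx F n. Proof. exact: unitmx1. Qed.
Fact GL_mul_subproof g h : GLmx g *m GLmx h \in unitmx.
Proof. by rewrite unitmx_mul !GL_unit. Qed.
Fact GL_inv_subproof g : invmx (GLmx g) \in unitmx.
Proof. by rewrite unitmx_inv GL_unit. Qed.

Definition GL_one := MkGL GL_one_subproof.
Definition GL_mul g h := MkGL (GL_mul_subproof g h).
Definition GL_inv g := MkGL (GL_inv_subproof g).

Fact GL_mulA : associative GL_mul.
Proof. by move=> f g h; apply: val_inj; rewrite /= mulmxA. Qed.
Fact GL_mul1g : left_id GL_one GL_mul.
Proof. by move=> g; apply: val_inj; rewrite /= mul1mx. Qed.
Fact GL_mulg1 : right_id GL_one GL_mul.
Proof. by move=> g; apply: val_inj; rewrite /= mulmx1. Qed.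
Fact GL_mulVg : left_inverse GL_one GL_inv GL_mul.
Proof. by move=> g; apply: val_inj; rewrite /= mulVmx ?GL_unit. Qed.
Fact GL_mulgV : right_inverse GL_one GL_inv GL_mul.
Proof. by move=> g; apply: val_inj; rewrite /= mulmxV ?GL_unit. Qed.

HB.instance Definition _ :=
  isGroup.Build GL GL_mulA GL_mul1g GL_mulg1 GL_mulVg GL_mulgV.

Definition homothetic g h : bool :=
  `[< exists2 c : F, c != 0 & GLmx h = c *: GLmx g >].

Fact homothetic_refl : reflexive homothetic.
Proof.
by move=> g; apply/asboolP; exists 1; rewrite ?oner_neq0 ?scale1r.
Qed.
Fact homothetic_sym : symmetric homothetic.
Proof.
suff H g h : homothetic g h -> homothetic h g by move=> g h; apply/idP/idP => /H.
move=> /asboolP[c c0 E]; apply/asboolP; exists c^-1; rewrite ?invr_eq0 //.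
by rewrite E scalerA mulVf // scale1r.
Qed.
Fact homothetic_trans : transitive homothetic.
Proof.
move=> h g i /asboolP[c c0 E] /asboolP[c' c0' E']; apply/asboolP.
by exists (c' * c); rewrite ?mulf_neq0 // E' E scalerA.
Qed.

Canonical homothetic_equiv :=
  EquivRel homothetic homothetic_refl homothetic_sym homothetic_trans.

Definition PGL := {eq_quot homothetic}%qT.
HB.instance Definition _ := EqQuotient.on PGL.
HB.instance Definition _ := Choice.on PGL.

Definition toPGL (g : GL) : PGL := (\pi_PGL g)%qT.

Lemma toPGL_eq g h : toPGL g = toPGL h <->
  exists2 c : F, c != 0 & GLmx h = c *: GLmx g.
Proof.
by split=> [/eqmodP /asboolP //|H]; apply/eqmodP/asboolP.
Qed.

Definition PGL_one := toPGL GL_one.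
Definition PGL_mul (x y : PGL) := toPGL (GL_mul (repr x) (repr y)).
Definition PGL_inv (x : PGL) := toPGL (GL_inv (repr x)).

Lemma reprPGL (x : PGL) : toPGL (repr x) = x. Proof. exact: reprK. Qed.

Lemma toPGL_M g h : PGL_mul (toPGL g) (toPGL h) = toPGL (GL_mul g h).
Proof.
have [c c0 E] := (toPGL_eq _ _).1 (reprPGL (toPGL g)).
have [c' c0' E'] := (toPGL_eq _ _).1 (reprPGL (toPGL h)).
apply/toPGL_eq; exists (c * c'); rewrite ?mulf_neq0 //=.
by rewrite E E' -scalemxAl -scalemxAr scalerA.
Qed.

Lemma toPGL_V g : PGL_inv (toPGL g) = toPGL (GL_inv g).
Proof.
have [c c0 E] := (toPGL_eq _ _).1 (reprPGL (toPGL g)).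
apply/toPGL_eq; exists c^-1; rewrite ?invr_eq0 //=.
by rewrite E invmxZ // unitmxZ ?unitfE ?GL_unit.
Qed.

Fact PGL_mulA : associative PGL_mul.
Proof.
move=> x y z; rewrite -[x]reprPGL -[y]reprPGL -[z]reprPGL !toPGL_M.
by rewrite GL_mulA.
Qed.
Fact PGL_mul1g : left_id PGL_one PGL_mul.
Proof. by move=> x; rewrite -[x]reprPGL toPGL_M GL_mul1g. Qed.
Fact PGL_mulg1 : right_id PGL_one PGL_mul.
Proof. by move=> x; rewrite -[x]reprPGL toPGL_M GL_mulg1. Qed.
Fact PGL_mulVg : left_inverse PGL_one PGL_inv PGL_mul.
Proof. by move=> x; rewrite -[x]reprPGL toPGL_V toPGL_M GL_mulVg. Qed.
Fact PGL_mulgV : right_inverse PGL_one PGL_inv PGL_mul.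
Proof. by move=> x; rewrite -[x]reprPGL toPGL_V toPGL_M GL_mulgV. Qed.

HB.instance Definition _ :=
  isGroup.Build PGL PGL_mulA PGL_mul1g PGL_mulg1 PGL_mulVg PGL_mulgV.
HB.instance Definition _ := isPointed.Build PGL PGL_one.

End LinearGroups.

Section Quotients.
Variables (G : groupType) (Gam K : set G).

Definition rcoset (g : G) : set G := [set x | exists2 a, Gam a & x = (a * g)%g].
Definition dcoset (g : G) : set G :=
  [set x | exists a b, [/\ Gam a, K b & x = (a * g * b)%g]].

(* The points of Gam \ G and Gam \ G / K are the cosets themselves, as sets. *)
Record lquot := LQuot { lq_set : set G; _ : exists g, lq_set = rcoset g }.
Record dquot := DQuot { dq_set : set G; _ : exists g, dq_set = dcoset g }.

Definition to_lquot (g : G) : lquot := LQuot (ex_intro _ g erefl).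
Definition to_dquot (g : G) : dquot := DQuot (ex_intro _ g erefl).

HB.instance Definition _ := gen_eqMixin lquot.
HB.instance Definition _ := gen_choiceMixin lquot.
HB.instance Definition _ := isPointed.Build lquot (to_lquot 1%g).
HB.instance Definition _ := gen_eqMixin dquot.
HB.instance Definition _ := gen_choiceMixin dquot.
HB.instance Definition _ := isPointed.Build dquot (to_dquot 1%g).

Definition lq_repr (x : lquot) : G := xget 1%g (lq_set x).
Definition dq_repr (y : dquot) : G := xget 1%g (dq_set y).

Definition lquot_dquot (x : lquot) : dquot := to_dquot (lq_repr x).

End Quotients.

Section Main.
Variables (R : realType) (k : finFieldType) (d : nat).

Local Notation F := (laurent k).
Local Notation G := (PGL F d).
Local Notation "`| a |_F" := (@absv R k a) (format "`| a |_F").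

Definition PGL_integers : set G := [set x | exists g : GL F d,
  x = toPGL g /\ exists2 B : 'M[fps k]_d, B \in unitmx &
                   GLmx g = map_mx (@ofps k) B].

Definition PGL_poly : set G := [set x | exists g : GL F d,
  x = toPGL g /\ exists2 B : 'M[{poly k}]_d, B \in unitmx &
                   GLmx g = map_mx (@opoly k) B].

Definition bigquot := lquot PGL_poly.
Definition Yquot := dquot PGL_poly PGL_integers.

HB.instance Definition _ := Pointed.on bigquot.
HB.instance Definition _ := Pointed.on Yquot.

Definition GL_open (U : set (GL F d)) : Prop :=
  forall g, U g -> exists2 e : R, 0 < e &
    forall h, (forall i j, `|GLmx h i j - GLmx g i j|_F < e) -> U h.

Definition PGL_open : set (set G) := [set U | GL_open (@toPGL F d @^-1` U)].

Definition bigquot_open : set (set bigquot) :=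
  [set V | PGL_open (@to_lquot _ PGL_poly @^-1` V)].

Definition borelG := g_sigma_algebraType PGL_open.
Definition borel_bigquot := g_sigma_algebraType bigquot_open.

(* All subsets of Y are measurable: the double cosets are open in G. *)
Definition discreteY := g_sigma_algebraType [set: set Yquot].

HB.instance Definition _ := Measurable.on borelG.
HB.instance Definition _ := Measurable.on borel_bigquot.
HB.instance Definition _ := Measurable.on discreteY.

(* As K is open and compact, mu K = 1 implies that mu is nonzero and finite on
   compact sets. *)
Definition normalized_haar (mu : {measure set borelG -> \bar R}) : Prop :=
  (forall (g : G) (A : set G), measurable (A : set borelG) ->
     mu [set (g * x)%g | x in A] = mu A) /\
  mu PGL_integers = 1%E.

(* lam is the quotient measure of mu on Gam \ G by the counting measure of Gam:
   int_G f dmu = int_(Gam \ G) (sum_(x in Gam g) f x) dlam for f = \1_A. *)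
Definition quotient_measure (mu : {measure set borelG -> \bar R})
    (lam : {measure set borel_bigquot -> \bar R}) : Prop :=
  forall A : set G, measurable (A : set borelG) ->
    (mu A = \int[lam]_x counting (A `&` lq_set x))%E.

Definition nuY (lam : {measure set borel_bigquot -> \bar R}) :
    set discreteY -> \bar R :=
  pushforward lam (@lquot_dquot _ PGL_poly PGL_integers
                     : borel_bigquot -> discreteY).

(* The lattice h Lambda_0, with Lambda_0 = k[t]^d. *)
Definition lattice (h : GL F d) : set 'cV[F]_d :=
  [set v | exists w : 'cV[{poly k}]_d, v = GLmx h *m map_mx (@opoly k) w].

Definition covol (h : GL F d) : R := `|\det (GLmx h)|_F.

(* The sup norm of v_1 /\ ... /\ v_j, where v_1, ..., v_j are the columns of V:
   its coordinates in the standard basis of the j-th exterior power, indexed by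
   the increasing maps 'I_j -> 'I_d, are the maximal minors of V. *)
Definition wedge_norm (j : nat) (V : 'M[F]_(d, j)) : R :=
  \big[Num.max/0]_(f : {ffun 'I_j -> 'I_d} |
      [forall a : 'I_j, forall b : 'I_j, (a < b)%N ==> (f a < f b)%N])
    `|\det (rowsub f V)|_F.

(* The supremum is attained, so it is the maximum. *)
Definition alpha_lattice (h : GL F d) : R :=
  sup [set r | exists j (V : 'M[F]_(d, j)),
    [/\ (1 <= j <= d)%N, forall c, lattice h (col c V), row_free V^T &
        r = covol h `^ (j%:R / d%:R) * (wedge_norm V)^-1]].

Definition alpha (y : Yquot) : R :=
  alpha_lattice (repr (dq_repr y : G) : GL F d)^-1%g.

End Main.

Section Complex.
Variable R : realType.
Local Notation C := R[i].

Definition cexp (z : C) : C :=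
  ((expR (complex.Re z) * cos (complex.Im z)) +i*
   (expR (complex.Re z) * sin (complex.Im z)))%C.

(* This is a ^ s for a > 0. *)
Definition cpow (a : R) (s : C) : C := cexp (s * (ln a)%:C%C).

Definition cvg_pseries (c : nat -> C) (w l : C) : Prop :=
  series (fun n => c n * w ^+ n : C^o) @ \oo --> (l : C^o).

Definition analytic_at (f : C -> C) (a : C) : Prop :=
  exists (c : nat -> C) (r : C), 0 < r /\
    forall z, `|z - a| < r -> cvg_pseries c (z - a) (f z).

(* f has a pole of exact order m > 0 at a; the value f a is irrelevant. *)
Definition pole_at (f : C -> C) (a : C) : Prop :=
  exists (m : nat) (c : nat -> C) (r : C), [/\ (0 < m)%N, c 0%N != 0, 0 < r &
    forall z, 0 < `|z - a| < r -> cvg_pseries c (z - a) ((z - a) ^+ m * f z)].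

Definition meromorphic (f : C -> C) : Prop :=
  forall a, analytic_at f a \/ pole_at f a.

Definition cintegral d (T : measurableType d) (mu : set T -> \bar R)
    (f : T -> C) : C :=
  (fine (\int[mu]_x (complex.Re (f x))%:E) +i*
   fine (\int[mu]_x (complex.Im (f x))%:E))%C.

Definition abs_integrable d (T : measurableType d) (mu : set T -> \bar R)
    (f : T -> C) : Prop :=
  mu.-integrable setT (fun x => (complex.Re (f x))%:E) /\
  mu.-integrable setT (fun x => (complex.Im (f x))%:E).

End Complex.

Definition is_height_zeta (R : realType) (k : finFieldType) (d : nat)
    (lam : {measure set borel_bigquot R k d -> \bar R}) (Z : R[i] -> R[i]) :=
  meromorphic Z /\
  forall s : R[i], complex.Re s < d%:R ->
    let f := fun y : discreteY k d => cpow (alpha R y) s in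
    abs_integrable (nuY lam) f /\ Z s = cintegral (nuY lam) f.

(* The relation Z = P(q, u) / D(q, u) with u = q ^ (s / d), as meromorphic
   functions of s: it is asserted at all s outside the discrete set of zeros of
   the denominator. The conclusion does not depend on mu and lam, which are
   unique. *)
Definition height_zeta_eq (R : realType) (k : finFieldType) (d : nat)
    (P D : R[i] -> R[i] -> R[i]) : Prop :=
  forall (mu : {measure set borelG R k d -> \bar R})
         (lam : {measure set borel_bigquot R k d -> \bar R}),
    normalized_haar mu -> quotient_measure mu lam ->
    (exists Z : R[i] -> R[i], is_height_zeta lam Z) /\
    (forall Z : R[i] -> R[i], is_height_zeta lam Z ->
     forall s : R[i], let q := #|k|%:R in let u := cpow #|k|%:R (s / d%:R) in
       D q u != 0 -> Z s = P q u / D q u).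

Section Formulas.
Variable A : comNzRingType.
Implicit Types q u : A.

Definition D3 q u : A :=
  (q - 1) ^+ 2 * (q + 1) * (q ^+ 2 + q + 1) * (q - u) * (q ^+ 4 - u ^+ 3).

Definition P3 q u : A :=
  q ^+ 2 - q * u + 2 * (q ^+ 2 + q + 1) * u ^+ 2 - q * u ^+ 3 + u ^+ 4.

Definition D4 q u : A :=
  (q - 1) ^+ 3 * (q + 1) ^+ 2 * (q ^+ 2 + 1) * (q ^+ 2 + q + 1)
  * (q - u) * (q + u) * (q ^+ 3 - u ^+ 2) * (q ^+ 3 + u ^+ 2)
  * (q ^+ 5 - u ^+ 4).

Definition P4 q u : A :=
  q ^+ 7 - q ^+ 5 * u ^+ 2 + 2 * q ^+ 4 * (q + 1) * (q ^+ 2 + 1) * u ^+ 3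
  + q ^+ 2 * (q ^+ 5 + 2 * q ^+ 4 + 4 * q ^+ 3 + 4 * q ^+ 2 + 4 * q + 1)
    * u ^+ 4
  - 2 * q ^+ 2 * (q + 1) * (q ^+ 2 + 1) * u ^+ 5
  + (q ^+ 5 + 4 * q ^+ 4 + 4 * q ^+ 3 + 4 * q ^+ 2 + 2 * q + 1) * u ^+ 6
  + 2 * (q + 1) * (q ^+ 2 + 1) * u ^+ 7 - q ^+ 2 * u ^+ 8 + u ^+ 10.

Definition D5 q u : A :=
  (q - 1) ^+ 4 * (q + 1) ^+ 2 * (q ^+ 2 + 1) * (q ^+ 2 + q + 1)
  * (q ^+ 4 + q ^+ 3 + q ^+ 2 + q + 1)
  * (q - u) * (q ^+ 6 - u ^+ 5) * (q ^+ 7 - u ^+ 5) * (q ^+ 8 - u ^+ 5).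

Definition P5 q u : A :=
  q ^+ 12 - q ^+ 11 * u
  + 2 * q ^+ 8 * (q ^+ 4 + q ^+ 3 + q ^+ 2 + q + 1) * u ^+ 4
  - q ^+ 5 * (q ^+ 6 - q ^+ 4 - 2 * q ^+ 3 - 2 * q ^+ 2 - 2 * q - 1) * u ^+ 5
  + q ^+ 4 * (2 * q ^+ 8 + 2 * q ^+ 7 + 3 * q ^+ 6 + 2 * q ^+ 5 + q ^+ 4
              - 2 * q ^+ 3 - 2 * q ^+ 2 - 2 * q - 1) * u ^+ 6
  - 2 * q ^+ 5 * (q ^+ 2 + 1) * (q ^+ 4 + q ^+ 3 + q ^+ 2 + q + 1) * u ^+ 7
  + 2 * q ^+ 2 * (q ^+ 4 + q ^+ 3 + q ^+ 2 + q + 1)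
    * (q ^+ 4 + q ^+ 3 + 3 * q ^+ 2 + q + 1) * u ^+ 8
  - 2 * q * (q ^+ 2 + 1) * (q ^+ 4 + q ^+ 3 + q ^+ 2 + q + 1) * u ^+ 9
  + (- q ^+ 8 - 2 * q ^+ 7 - 2 * q ^+ 6 - 2 * q ^+ 5 + q ^+ 4 + 2 * q ^+ 3
     + 3 * q ^+ 2 + 2 * q + 2) * u ^+ 10
  + q * (q ^+ 6 + 2 * q ^+ 5 + 2 * q ^+ 4 + 2 * q ^+ 3 + q ^+ 2 - 1) * u ^+ 11
  + 2 * (q ^+ 4 + q ^+ 3 + q ^+ 2 + q + 1) * u ^+ 12 - q * u ^+ 15 + u ^+ 16.

End Formulas.

(* Main.v *)
(* By lattice reduction over F_q[t] (Birkhoff, Grothendieck), the points of Y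
   are the weakly decreasing integer sequences s of length d whose sum r satisfies
   0 <= r < d. The mass of s is (q - 1) / |Aut s|, with Aut s the automorphism
   group of the vector bundle of splitting type s on the projective line, and its
   height is q ^ (E / d) with E = d A - r n, where n is the number of positive
   terms of s and A is their sum. For fixed r, n and A, the total mass is up to a
   power of q the product of a mass for the positive terms and one for the others.
   The mass of all sequences of m natural numbers with sum B is
   [prod_(1 <= i < m) (1 - q ^ (- B - i)) / (1 - q ^ (- i))] / |GL_m(F_q)|: this
   follows by induction on B from the recursion on the number of zero terms,
   through an identity of rational functions which is checked for m <= 4 only.
   The zeta function is thus a sum of geometric series in (u / q) ^ d, which
   converge for |u| < q and are summed explicitly for d = 3, 4, 5. The quotient
   P / D continues it, and the continuation is unique by the identity theorem. *)

From HB Require Import structures.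
From mathcomp Require Import fingroup perm finmap.
Require Import Defs.
From mathcomp Require Import all_boot all_order all_algebra.
From mathcomp Require Import complex.
From mathcomp Require Import all_classical all_reals all_analysis.
From mathcomp Require Import ring lra zify.

Set Implicit Arguments.
Unset Strict Implicit.
Unset Printing Implicit Defensive.

Import Order.TTheory GRing.Theory Num.Theory.
Import numFieldNormedType.Exports.
Import ComplexField.Normc.

Local Open Scope classical_set_scope.
Local Open Scope ring_scope.
(** * Laurent series *)

(** The quotient measure is known only through its defining relation, so masses are obtained by
    testing that relation on a single coset g K, on which the count over a Gam-orbit is a stabilizer
    order. Grouping the types by A makes every group finite, and cutting a type of rank d <= 5 at 0
    into two nonempty pieces leaves ranks at most 4, the range in which the rational identity is
    checked. Absolute convergence is obtained from the same summation, taken at the real point |u|.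
    Analytic functions are handled through formal power series: a germ is a formal series with a
    geometric bound on its coefficients. Products, inverses and orders of vanishing then come from
    the ring [fps], which already serves to build k((1/t)), and the only analytic inputs are a
    Cauchy product and bounds for coefficients. Since P and D are polynomials over an arbitrary
    ring, evaluating them in [fps] gives their Taylor expansions at every point. *)

Section FormalSeries.
Variable k : fieldType.
Implicit Types f g h : fps k.

Lemma fps_coef0E n : fps_coef (0 : fps k) n = 0. Proof. by []. Qed.
Lemma fps_coefD f g n : fps_coef (f + g) n = fps_coef f n + fps_coef g n.
Proof. by []. Qed.
Lemma fps_coefN f n : fps_coef (- f) n = - fps_coef f n.
Proof. by []. Qed.
Lemma fps_coef1 n : fps_coef (1 : fps k) n = (n == 0%N)%:R.
Proof. by rewrite /=; case: n. Qed.
Lemma fps_coefM f g n :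
  fps_coef (f * g) n = \sum_(i < n.+1) fps_coef f i * fps_coef g (n - i).
Proof. by []. Qed.
Lemma fps_coef_sum I (r : seq I) P (E : I -> fps k) n :
  fps_coef (\sum_(i <- r | P i) E i) n = \sum_(i <- r | P i) fps_coef (E i) n.
Proof. exact: (big_morph (fun f => fps_coef f n)). Qed.

Definition fps_cst f : k := fps_coef f 0.

Lemma fps_cst_is_zmod_morphism : zmod_morphism fps_cst.
Proof. by []. Qed.
HB.instance Definition _ :=
  GRing.isZmodMorphism.Build (fps k) k fps_cst fps_cst_is_zmod_morphism.
Lemma fps_cst_is_monoid_morphism : monoid_morphism fps_cst.
Proof. by split=> [//|f g]; rewrite /fps_cst /= big_ord1. Qed.
HB.instance Definition _ :=
  GRing.isMonoidMorphism.Build (fps k) k fps_cst fps_cst_is_monoid_morphism.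

Lemma fpsC_is_zmod_morphism : zmod_morphism (@fpsC k).
Proof. by move=> a b; apply: fpsP => -[|n] /=; rewrite ?subr0. Qed.
HB.instance Definition _ :=
  GRing.isZmodMorphism.Build k (fps k) (@fpsC k) fpsC_is_zmod_morphism.
Lemma fps_coefCM c f n : fps_coef (fpsC c * f) n = c * fps_coef f n.
Proof.
rewrite fps_coefM big_ord_recl /= subn0 big1 ?addr0 // => i _.
by rewrite mul0r.
Qed.
Lemma fpsC_is_monoid_morphism : monoid_morphism (@fpsC k).
Proof.
split=> [//|a b]; apply: fpsP => n; rewrite fps_coefCM /=.
by case: n => //= n; rewrite mulr0.
Qed.
HB.instance Definition _ :=
  GRing.isMonoidMorphism.Build k (fps k) (@fpsC k) fpsC_is_monoid_morphism.

Lemma fps_coefXM f n :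
  fps_coef (fpsX k * f) n = if n is m.+1 then fps_coef f m else 0.
Proof.
rewrite fps_coefM; case: n => [|n]; first by rewrite big_ord1 /= mul0r.
rewrite 2!big_ord_recl /= mul0r add0r mul1r big1 ?addr0 ?subn1 // => i _.
by rewrite mul0r.
Qed.

Lemma fps_coefXnM m f n :
  fps_coef (fpsX k ^+ m * f) n = if (n < m)%N then 0 else fps_coef f (n - m).
Proof.
elim: m n => [|m IHm] n; first by rewrite expr0 mul1r subn0.
by rewrite exprS -mulrA fps_coefXM; case: n => [|n] //; rewrite IHm ltnS subSS.
Qed.

Lemma fps_factorX f : fps_cst f = 0 -> exists g, f = fpsX k * g.
Proof.
move=> f0; exists (FPS (fun n => fps_coef f n.+1)); apply: fpsP => n.
by rewrite fps_coefXM; case: n.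
Qed.

Lemma fps_factor f n : (forall i, (i < n)%N -> fps_coef f i = 0) ->
  exists g, f = fpsX k ^+ n * g.
Proof.
move=> f0; exists (FPS (fun m => fps_coef f (m + n))); apply: fpsP => m.
by rewrite fps_coefXnM; case: ltnP => [/f0 //|nm] /=; rewrite subnK.
Qed.

Lemma fps_coef_nilp h i n : fps_cst h = 0 -> (n < i)%N -> fps_coef (h ^+ i) n = 0.
Proof.
move=> /fps_factorX[g ->] ni.
by rewrite exprMn fps_coefXnM ni.
Qed.

(** Geometric series: f = c (1 - h) with h without constant term, and 1 - h is inverted by the sum
    of the powers of h. *)
Lemma fps_unitE f : (f \is a GRing.unit) = (fps_cst f != 0).
Proof.
apply/idP/idP => [/(rmorph_unit fps_cst)|f0]; first by rewrite unitfE.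
set c := fps_cst f in f0; pose h := 1 - fpsC c^-1 * f.
have h0 : fps_cst h = 0.
  by rewrite /h rmorphB rmorph1 rmorphM /= {1}/fps_cst /= mulVf // subrr.
pose G n := \sum_(i < n.+1) h ^+ i.
(* A formal limit: the coefficient of order n is stable from [G n] on, since the later powers of h
   vanish to order greater than n. *)
pose g := FPS (fun n => fps_coef (G n) n).
have gG n m : (m <= n)%N -> fps_coef g m = fps_coef (G n) m.
  move=> mn; rewrite /g /= /G !fps_coef_sum.
  rewrite -(big_mkord xpredT (fun i => fps_coef (h ^+ i) m)).
  rewrite -(big_mkord xpredT (fun i => fps_coef (h ^+ i) m)).
  rewrite (@big_cat_nat _ _ _ m.+1 _ n.+1) //=.
  rewrite [X in _ = _ + X]big_nat_cond [X in _ = _ + X]big1 ?addr0 // => i.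
  by rewrite andbT => /andP[mi _]; apply: fps_coef_nilp.
have gh : g * (1 - h) = 1.
  apply: fpsP => n; transitivity (fps_coef (G n * (1 - h)) n).
    rewrite !fps_coefM; apply: eq_bigr => i _; congr (_ * _).
    by apply: gG; rewrite -ltnS.
  have -> : G n * (1 - h) = 1 - h ^+ n.+1.
    by rewrite mulrC /G -opprB mulNr -subrX1 opprB.
  by rewrite fps_coefD fps_coefN fps_coef_nilp // subr0.
apply/unitrP; exists (g * fpsC c^-1).
suff E : g * fpsC c^-1 * f = 1 by rewrite E mulrC.
by rewrite -mulrA -[fpsC c^-1 * f](subKr 1).
Qed.

Lemma fps_ord_eq f n : fps_coef f n != 0 ->
  (forall m, (m < n)%N -> fps_coef f m = 0) -> fps_ord f = n.
Proof.
move=> fn fm; have f0 : f != 0 by apply: contraNneq fn => ->.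
have [fo lto] := fps_ordP f0; apply/eqP; rewrite eqn_leq; apply/andP; split.
  by rewrite leqNgt; apply/negP => /lto; apply/eqP.
by rewrite leqNgt; apply/negP => /fm; apply/eqP.
Qed.

Lemma fps_ordM f g : f != 0 -> g != 0 ->
  fps_ord (f * g) = (fps_ord f + fps_ord g)%N.
Proof.
move=> f0 g0; have [fo flt] := fps_ordP f0; have [go glt] := fps_ordP g0.
have [f' ef] := fps_factor flt; have [g' eg] := fps_factor glt.
have f'0 : fps_cst f' != 0.
  by move: fo; rewrite {1}ef fps_coefXnM ltnn subnn.
have g'0 : fps_cst g' != 0.
  by move: go; rewrite {1}eg fps_coefXnM ltnn subnn.
rewrite {1}ef {1}eg mulrACA -exprD; apply: fps_ord_eq => [|m mlt].
  by rewrite fps_coefXnM ltnn subnn -/(fps_cst _) rmorphM mulf_neq0.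
by rewrite fps_coefXnM mlt.
Qed.

Lemma fps_ord_unit f : fps_cst f != 0 -> fps_ord f = 0%N.
Proof. by move=> f0; apply: fps_ord_eq. Qed.

Lemma fps_ordX : fps_ord (fpsX k) = 1%N.
Proof. by apply: fps_ord_eq => [|[]//]; rewrite /= oner_neq0. Qed.

Lemma fpsX_neq0 : fpsX k != 0.
Proof.
by apply/eqP => /(congr1 (fun f => fps_coef f 1)) /= /eqP; rewrite oner_eq0.
Qed.

End FormalSeries.

Section Degree.
Variable k : fieldType.
Local Notation F := (laurent k).
Local Notation t := (tvar k).
Implicit Types (a b : F) (f g : fps k) (p : {poly k}) (n m : int).

HB.instance Definition _ := GRing.isZmodMorphism.Build (fps k) F (@ofps k)
  (@tofrac_is_zmod_morphism (fps k)).
HB.instance Definition _ := GRing.isMonoidMorphism.Build (fps k) F (@ofps k)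
  (@tofrac_is_monoid_morphism (fps k)).

Lemma ofps_inj : injective (@ofps k).
Proof. by move=> f g /eqP; rewrite tofrac_eq => /eqP. Qed.

Lemma ofps_eq0 f : (ofps f == 0) = (f == 0).
Proof. exact: tofrac_eq0. Qed.

Lemma laurent_repr a :
  a = ofps (frac (repr a)).1 / ofps (frac (repr a)).2.
Proof.
rewrite -[LHS]reprK; case: (repr a) => -[n d] /= d0.
rewrite /ofps; unlock FracField.tofrac.
rewrite -[X in _ * X]FracField.pi_inv -[RHS]FracField.pi_mul.
rewrite /FracField.mulf /FracField.invf /= !numden_Ratio ?oner_neq0 //=.
by rewrite mul1r mulr1 /Ratio /insubd insubT.
Qed.

(* The logarithm of [|a|]; meaningful for [a != 0] only. *)
Definition fdeg a : int :=
  (fps_ord (frac (repr a)).2)%:Z - (fps_ord (frac (repr a)).1)%:Z.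

Lemma fdeg_frac f g : f != 0 -> g != 0 ->
  fdeg (ofps f / ofps g) = (fps_ord g)%:Z - (fps_ord f)%:Z.
Proof.
move=> f0 g0; set a := _ / _; rewrite /fdeg.
have a0 : a != 0 by rewrite mulf_neq0 ?invr_eq0 ?ofps_eq0.
have ar := laurent_repr a; set n := _.1 in ar *; set d := _.2 in ar *.
have d0 : d != 0 by exact: denom_ratioP.
have n0 : n != 0.
  by apply: contraNneq a0 => n0; rewrite ar n0 rmorph0 mul0r.
have : ofps (f * d) = ofps (n * g).
  apply: (@mulIf _ ((ofps g)^-1 * (ofps d)^-1)).
    by rewrite mulf_neq0 ?invr_eq0 ?ofps_eq0.
  rewrite !rmorphM /= -!mulrA [ofps d * _]mulrCA mulfV ?ofps_eq0 // mulr1 -/a.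
  by rewrite [ofps g * _]mulrA mulfV ?ofps_eq0 // mul1r.
move/ofps_inj/(congr1 (@fps_ord k)); rewrite !fps_ordM //; lia.
Qed.

Lemma fdeg_ofps f : f != 0 -> fdeg (ofps f) = - (fps_ord f)%:Z.
Proof.
move=> f0; have := fdeg_frac f0 (oner_neq0 _); rewrite rmorph1 divr1 => ->.
by rewrite (@fps_ord_unit _ 1) ?rmorph1 ?oner_neq0 // sub0r.
Qed.

Lemma laurentP a : a != 0 -> exists f g, [/\ f != 0, g != 0 & a = ofps f / ofps g].
Proof.
move=> a0; exists (frac (repr a)).1, (frac (repr a)).2; split.
- by apply: contraNneq a0 => n0; rewrite [a]laurent_repr n0 rmorph0 mul0r.
- exact: denom_ratioP.
- exact: laurent_repr.
Qed.

Lemma fdegM a b : a != 0 -> b != 0 -> fdeg (a * b) = fdeg a + fdeg b.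
Proof.
move=> /laurentP[f [g [f0 g0 ->]]] /laurentP[f' [g' [f'0 g'0 ->]]].
rewrite mulf_div -!rmorphM !fdeg_frac ?mulf_neq0 // !fps_ordM //; lia.
Qed.

Lemma fdeg1 : fdeg 1 = 0.
Proof. by rewrite -(rmorph1 (@ofps k)) fdeg_ofps ?oner_neq0 // fps_ord_unit // rmorph1 oner_neq0. Qed.

Lemma tvar_neq0 : t != 0.
Proof. by rewrite invr_eq0 ofps_eq0 fpsX_neq0. Qed.

Lemma fdegV a : a != 0 -> fdeg a^-1 = - fdeg a.
Proof.
move=> a0; have := fdeg1; rewrite -(mulfV a0) fdegM ?invr_eq0 //; lia.
Qed.

Lemma fdeg_tvar : fdeg t = 1.
Proof. by rewrite /tvar fdegV ?ofps_eq0 ?fpsX_neq0 // fdeg_ofps ?fpsX_neq0 // fps_ordX. Qed.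

Lemma fdegXn a (n : nat) : a != 0 -> fdeg (a ^+ n) = fdeg a * n%:Z.
Proof.
move=> a0; elim: n => [|n IHn]; first by rewrite expr0 fdeg1 mulr0.
by rewrite exprS fdegM ?expf_neq0 // IHn; lia.
Qed.

Lemma fdegXz n : fdeg (t ^ n) = n.
Proof.
case: n => n.
  by change (fdeg (t ^+ n) = n%:Z); rewrite fdegXn ?tvar_neq0 // fdeg_tvar mul1r.
change (fdeg (t ^+ n.+1)^-1 = Negz n).
rewrite fdegV ?expf_neq0 ?tvar_neq0 // fdegXn ?tvar_neq0 // fdeg_tvar mul1r.
by rewrite NegzE.
Qed.

Lemma tvarz_neq0 n : t ^ n != 0.
Proof. by rewrite expfz_neq0 ?tvar_neq0. Qed.

(** The fractional ideal t^n k[[1/t]], the closed ball of radius q^n. Zero is added by hand because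
    [fdeg 0] carries no meaning. *)
Definition fball n : {pred F} := [pred a | (a == 0) || (fdeg a <= n)].

Lemma fballE n a : (a \in fball n) = (a == 0) || (fdeg a <= n).
Proof. by []. Qed.
(* Prevents [done] from unfolding the choice of representatives. *)
Opaque fball fdeg.

Lemma fball_ofps f : ofps f \in fball 0.
Proof.
rewrite fballE ofps_eq0; have [//|f0] /= := eqVneq f 0.
rewrite fdeg_ofps //; lia.
Qed.

Lemma fballM n m a b : a \in fball n -> b \in fball m -> a * b \in fball (n + m).
Proof.
rewrite !fballE mulf_eq0; have [//|a0 /= na] := eqVneq a 0.
by have [//|b0 /= mb] := eqVneq b 0; rewrite fdegM //; lia.
Qed.

Lemma fball_tvarz n : t ^ n \in fball n.
Proof. by rewrite fballE fdegXz lexx orbT. Qed.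

Lemma fball0P a : reflect (exists f, a = ofps f) (a \in fball 0).
Proof.
apply: (iffP idP) => [|[f ->]]; last exact: fball_ofps.
rewrite fballE; have [->|a0 /=] := eqVneq a 0; first by exists 0; rewrite rmorph0.
have [f [g [f0 g0 ->]]] := laurentP a0.
rewrite fdeg_frac // => fg.
have {}fg : (fps_ord g <= fps_ord f)%N by lia.
have [fo flt] := fps_ordP f0; have [go glt] := fps_ordP g0.
have [f' ef] := fps_factor flt; have [g' eg] := fps_factor glt.
have g'u : g' \is a GRing.unit.
  by rewrite fps_unitE; move: go; rewrite {1}eg fps_coefXnM ltnn subnn.
exists (fpsX k ^+ (fps_ord f - fps_ord g) * f' * g'^-1).
apply: (@mulIf _ (ofps g)); rewrite ?ofps_eq0 // divfK ?ofps_eq0 //.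
rewrite -rmorphM; congr ofps; rewrite {1}ef {2}eg.
rewrite [fpsX k ^+ _ * g']mulrC mulrA divrK // mulrAC; congr (_ * _).
by rewrite -exprD subnK.
Qed.

Lemma fball_shift n m a : (t ^ m * a \in fball n) = (a \in fball (n - m)).
Proof.
apply/idP/idP => H.
  have -> : a = t ^ (- m) * (t ^ m * a) by rewrite -invr_expz mulKf ?tvarz_neq0.
  by rewrite addrC; apply: fballM => //; apply: fball_tvarz.
by rewrite -[n](subrK m) addrC; apply: fballM => //; apply: fball_tvarz.
Qed.

Lemma fballP n a : reflect (exists f, a = t ^ n * ofps f) (a \in fball n).
Proof.
rewrite -[a](mulVKf (tvarz_neq0 n)) fball_shift subrr.
apply: (iffP (fball0P _)) => -[f]; first by move=> ->; exists f.
by move/(mulfI (tvarz_neq0 n)) ->; exists f.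
Qed.

Fact fball_zmod_closed n : zmod_closed (fball n).
Proof.
split; first by rewrite fballE eqxx.
move=> a b /fballP[f ->] /fballP[g ->]; apply/fballP; exists (f - g).
by rewrite rmorphB mulrBr.
Qed.
HB.instance Definition _ n :=
  GRing.isZmodClosed.Build F (fball n) (fball_zmod_closed n).

Lemma fball_le n m a : n <= m -> a \in fball n -> a \in fball m.
Proof.
by rewrite !fballE => nm; case: eqP => //= _ /le_trans; apply.
Qed.

Lemma fball_neq0 n a : a != 0 -> (a \in fball n) = (fdeg a <= n).
Proof. by move=> a0; rewrite fballE (negbTE a0). Qed.

(** Degrees are integers, so this ball is the open unit ball, that is, the maximal ideal of
    k[[1/t]]. *)
Lemma fball_cst f : (ofps f \in fball (-1)) = (fps_cst f == 0).
Proof.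
apply/idP/eqP => [|/fps_factorX[g ->]].
  move/fballP=> [g]; rewrite exprN1 /tvar invrK -rmorphM => /ofps_inj ->.
  by rewrite /fps_cst fps_coefXM.
apply/fballP; exists g; rewrite exprN1 /tvar invrK.
by rewrite rmorphM.
Qed.

Definition ofpsC (c : k) : F := ofps (fpsC c).
HB.instance Definition _ := GRing.RMorphism.copy ofpsC (@ofps k \o @fpsC k).

Lemma opolyE p : opoly p = (map_poly ofpsC p).[t]. Proof. by []. Qed.

Lemma opoly_is_zmod_morphism : zmod_morphism (@opoly k).
Proof. by move=> p q; rewrite !opolyE rmorphB /= hornerD hornerN. Qed.
HB.instance Definition _ :=
  GRing.isZmodMorphism.Build {poly k} F (@opoly k) opoly_is_zmod_morphism.
Lemma opoly_is_monoid_morphism : monoid_morphism (@opoly k).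
Proof.
split=> [|p q]; first by rewrite opolyE rmorph1 hornerC.
by rewrite !opolyE rmorphM /= hornerM.
Qed.
HB.instance Definition _ :=
  GRing.isMonoidMorphism.Build {poly k} F (@opoly k) opoly_is_monoid_morphism.

Lemma opolyC c : opoly c%:P = ofpsC c.
Proof. by rewrite opolyE map_polyC hornerC. Qed.
Lemma opolyX : opoly 'X = t.
Proof. by rewrite opolyE map_polyX hornerX. Qed.

Lemma fdeg_ofpsC c : c != 0 -> fdeg (ofpsC c) = 0.
Proof.
move=> c0; have C0 : fps_cst (fpsC c) != 0 by [].
rewrite /ofpsC fdeg_ofps ?fps_ord_unit ?oppr0 //.
by apply: contraNneq C0 => ->.
Qed.

Lemma ofpsC_fball c : ofpsC c \in fball 0.
Proof. exact: fball_ofps. Qed.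

(** Ultrametric principle: if a + b were shorter than a, then a = (a + b) - b would lie in a ball
    too small for it. *)
Lemma fdeg_dominant a b n : fdeg a = n -> a != 0 -> b \in fball (n - 1) ->
  a + b != 0 /\ fdeg (a + b) = n.
Proof.
move=> an a0 bn.
have H m : m < n -> a + b \notin fball m.
  move=> mn; apply/negP => abm.
  have : a \in fball (n - 1).
    rewrite -[a](addrK b) rpredB //; apply: fball_le abm; lia.
  by rewrite fball_neq0 //; lia.
have ab0 : a + b != 0.
  by apply/eqP => ab0; have := H (n - 1); rewrite ab0 rpred0 => /(_ ltac:(lia)).
split=> //; have : a + b \in fball n.
  apply: rpredD; first by rewrite fball_neq0 // an lexx.
  by apply: fball_le bn; lia.
rewrite fball_neq0 //; have := H (fdeg (a + b)); rewrite fball_neq0 // lexx.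
by case: ltgtP => // + /(_ isT).
Qed.

Lemma fdeg_opoly p : p != 0 -> opoly p != 0 /\ fdeg (opoly p) = (size p).-1%:Z.
Proof.
move=> p0; set n := (size p).-1.
have -> : p = lead_coef p *: 'X^n + (p - lead_coef p *: 'X^n) by rewrite addrC subrK.
have lc0 : ofpsC (lead_coef p) != 0 by rewrite fmorph_eq0 lead_coef_eq0.
have tn0 : t ^+ n != 0 by rewrite expf_neq0 ?tvar_neq0.
have E : opoly (lead_coef p *: 'X^n) = ofpsC (lead_coef p) * t ^+ n.
  by rewrite -mul_polyC rmorphM rmorphXn /= opolyC opolyX.
rewrite rmorphD /=; apply: fdeg_dominant; rewrite ?E.
- rewrite fdegM; [|exact: lc0|exact: tn0].
  rewrite fdeg_ofpsC ?lead_coef_eq0 // fdegXn; last exact: tvar_neq0.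
  by rewrite fdeg_tvar mul1r add0r.
- by apply: mulf_neq0; [exact: lc0|exact: tn0].
- set r := _ - _.
  rewrite opolyE horner_coef; apply: rpred_sum => i _.
  rewrite coef_map /= mulrC.
  have [in_|ni] := ltnP i n.
    apply: (@fball_le (i%:Z + 0)); first by lia.
    by apply: fballM; [exact: (fball_tvarz i)|exact: ofpsC_fball].
  suff -> : r`_i = 0 by rewrite rmorph0 mulr0; apply: rpred0.
  move: {ni}(nat_of_ord i) ni => j nj; rewrite coefB coefZ coefXn.
  have [->|jn] := eqVneq j n; first by rewrite mulr1 lead_coefE subrr.
  rewrite mulr0 subr0 nth_default //.
  have : (n < j)%N by rewrite ltn_neqAle eq_sym jn.
  by rewrite /n; case: (size p).
Qed.

Lemma opoly_inj : injective (@opoly k).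
Proof.
move=> p q pq; apply/eqP; rewrite -subr_eq0; apply: contraT => /fdeg_opoly[].
by rewrite (raddfB (@opoly k)) /= pq subrr eqxx.
Qed.

Lemma opoly_fballE p n :
  (opoly p \in fball n) = (p == 0) || ((size p).-1%:Z <= n).
Proof.
have [->|p0] := eqVneq p 0; first by rewrite rmorph0 rpred0.
by have [q0 qn] := fdeg_opoly p0; rewrite fball_neq0 // qn.
Qed.

End Degree.

Section AbsoluteValue.
Variables (R : realType) (k : finFieldType).
Local Notation F := (laurent k).
Local Notation abs := (@absv R k).
Local Notation q := (#|k|%:R : R).
Implicit Types a b : F.

Lemma card_gt1 : (1 < #|k|)%N.
Proof. exact: card_finNzRing_gt1. Qed.

Lemma q_gt1 : 1 < q.
Proof. by rewrite ltr1n card_gt1. Qed.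

Lemma q_gt0 : 0 < q.
Proof. exact: lt_trans ltr01 q_gt1. Qed.

Lemma absvE a : a != 0 -> abs a = q ^ fdeg a.
Proof. by move=> a0; rewrite /absv (negbTE a0). Qed.

Lemma absv0 : abs 0 = 0.
Proof. by rewrite /absv eqxx. Qed.

Lemma absv_ge0 a : 0 <= abs a.
Proof.
have [->|a0] := eqVneq a 0; first by rewrite absv0.
by rewrite absvE // exprz_ge0 // ltW // q_gt0.
Qed.

Lemma absv_fball a (n : int) : (abs a <= q ^ n) = (a \in fball n).
Proof.
have [->|a0] := eqVneq a 0; first by rewrite absv0 rpred0 exprz_ge0 // ltW // q_gt0.
by rewrite absvE // fball_neq0 // ler_eXz2l // q_gt1.
Qed.

Lemma absvM a b : abs (a * b) = abs a * abs b.
Proof.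
have [->|a0] := eqVneq a 0; first by rewrite mul0r absv0 mul0r.
have [->|b0] := eqVneq b 0; first by rewrite mulr0 absv0 mulr0.
have ab0 : a * b != 0 by apply: mulf_neq0; [exact: a0|exact: b0].
rewrite (absvE a0) (absvE b0) (absvE ab0) (fdegM a0 b0) expfzDr //.
by rewrite gt_eqF ?q_gt0.
Qed.

Lemma absv1 : abs 1 = 1.
Proof. by rewrite (absvE (oner_neq0 _)) fdeg1. Qed.

Lemma absvN a : abs (- a) = abs a.
Proof.
have [->|a0] := eqVneq a 0; first by rewrite oppr0.
have := absvM (-1) (-1); rewrite mulrNN mulr1 absv1 => /esym/eqP.
rewrite -expr2 sqrf_eq1 => /orP[] /eqP E; first by rewrite -mulN1r absvM E mul1r.
by have := absv_ge0 (-1); rewrite E; lra.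
Qed.

Lemma absv_sum_le I (r : seq I) (P : pred I) (E : I -> F) (M : R) : 0 <= M ->
  (forall i, P i -> abs (E i) <= M) -> abs (\sum_(i <- r | P i) E i) <= M.
Proof.
move=> M0 H; elim/big_ind: _ => [|a b aM bM|//]; first by rewrite absv0.
wlog ab : a b aM bM / abs a <= abs b.
  move=> W; case: (leP (abs a) (abs b)) => [|/ltW] ab; first exact: W aM bM ab.
  by rewrite addrC; apply: W bM aM ab.
apply: le_trans bM.
have [b0|b0] := eqVneq b 0.
  have a0 : a = 0.
    apply: contraTeq ab => a0; rewrite b0 absv0 -ltNge (absvE a0).
    by rewrite exprz_gt0 // q_gt0.
  by rewrite a0 add0r.
rewrite (absvE b0) absv_fball; apply: rpredD.
  by rewrite -absv_fball -absvE.
by rewrite (fball_neq0 _ b0) lexx.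
Qed.

End AbsoluteValue.

Section ValuedModel.
Variables (R : realType) (k : finFieldType).

(* An abstract copy of [laurent k]: unfolding the concrete field of fractions
   makes unification diverge. *)
Record lfield := LField {
  lF :> fieldType;
  lof : {rmorphism fps k -> lF};
  lop : {rmorphism {poly k} -> lF};
  lt : lF;
  ldeg : lF -> int;
  lball : int -> zmodClosed lF;
  labs : lF -> R;
  lof_inj : injective lof;
  lop_inj : injective lop;
  lt_neq0 : lt != 0;
  ldegM : forall a b, a != 0 -> b != 0 -> ldeg (a * b) = ldeg a + ldeg b;
  ldeg_tz : forall n : int, ldeg (lt ^ n) = n;
  lball_deg : forall n a, a != 0 -> (a \in lball n) = (ldeg a <= n);
  lballP : forall n a, reflect (exists f, a = lt ^ n * lof f) (a \in lball n);
  lball_cst : forall f, (lof f \in lball (-1)) = (fps_cst f == 0);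
  lballM : forall n m a b, a \in lball n -> b \in lball m -> a * b \in lball (n + m);
  lop_ball : forall p n, (lop p \in lball n) = (p == 0) || ((size p).-1%:Z <= n);
  lop_X : lop 'X = lt;
  lop_C : forall c, lop c%:P = lof (fpsC c);
  labs0 : labs 0 = 0;
  labs_deg : forall a, a != 0 -> labs a = #|k|%:R ^ ldeg a;
  labs_ball : forall a n, (labs a <= #|k|%:R ^ n) = (a \in lball n);
  labsM : forall a b, labs (a * b) = labs a * labs b;
  labsN : forall a, labs (- a) = labs a;
  labs_sum_le : forall I (r : seq I) (P : pred I) (E : I -> lF) (M : R), 0 <= M ->
    (forall i, P i -> labs (E i) <= M) -> labs (\sum_(i <- r | P i) E i) <= M
}.

Definition laurent_lfield : lfield :=
  @LField (laurent k) (@ofps k) (@opoly k) (tvar k) (@fdeg k) (@fball k)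
    (@absv R k) (@ofps_inj k) (@opoly_inj k) (tvar_neq0 k) (@fdegM k)
    (@fdegXz k) (@fball_neq0 k) (@fballP k) (@fball_cst k) (@fballM k)
    (@opoly_fballE k) (@opolyX k) (@opolyC k) (@absv0 R k) (@absvE R k)
    (@absv_fball R k) (@absvM R k) (@absvN R k) (@absv_sum_le R k).

End ValuedModel.

(** * Lattice reduction *)

Section LatticeReduction.
Variables (R : realType) (k : finFieldType) (V : lfield R k).
Local Notation F := (lF V).
Local Notation t := (lt V).
Local Notation of_ := (lof V).
Local Notation op := (lop V).
Local Notation deg := (@ldeg R k V).
Local Notation ball := (lball V).
Local Notation abs := (@labs R k V).
Local Notation q := (#|k|%:R : R).

Lemma ltz_neq0 (n : int) : t ^ n != 0.
Proof. by rewrite expfz_neq0 ?lt_neq0. Qed.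

Lemma ldeg1 : deg 1 = 0.
Proof. by rewrite -(expr0z t) ldeg_tz. Qed.

Lemma ldegV a : a != 0 -> deg a^-1 = - deg a.
Proof.
move=> a0; have := ldeg1; rewrite -(mulfV a0) ldegM ?invr_eq0 //; lia.
Qed.

Lemma lball_le (n m : int) a : n <= m -> a \in ball n -> a \in ball m.
Proof.
have [->|a0] := eqVneq a 0; first by rewrite !rpred0.
by rewrite !lball_deg // => nm /le_trans; apply.
Qed.

Lemma lball_of f : of_ f \in ball 0.
Proof. by apply/lballP; exists f; rewrite expr0z mul1r. Qed.

Lemma lball_tz (n : int) : t ^ n \in ball n.
Proof. by rewrite lball_deg ?ltz_neq0 // ldeg_tz. Qed.

Lemma lball_prod I (r : seq I) (e : I -> int) (E : I -> F) :
  (forall i, E i \in ball (e i)) ->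
  \prod_(i <- r) E i \in ball (\sum_(i <- r) e i).
Proof.
move=> H; elim/big_rec2: _ => [|i a n _ IH]; last exact: lballM.
by rewrite -(rmorph1 of_) lball_of.
Qed.

Lemma lop_deg p : p != 0 -> op p != 0 /\ deg (op p) = (size p).-1%:Z.
Proof.
move=> p0; have p0' : op p != 0.
  by apply: contra_neq p0 => p0; apply: (@lop_inj _ _ V); rewrite p0 rmorph0.
split=> //; apply/eqP; rewrite eq_le -lball_deg // lop_ball lexx orbT /=.
by have := lop_ball V p (deg (op p)); rewrite lball_deg // lexx (negbTE p0).
Qed.

Lemma lof_unit_deg f : f \is a GRing.unit -> of_ f != 0 /\ deg (of_ f) = 0.
Proof.
move=> fu; have f0 : of_ f != 0 by rewrite -unitfE rmorph_unit.
split=> //; apply/eqP; rewrite eq_le -lball_deg // lball_of /=.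
rewrite leNgt; apply/negP => lt0; move: fu; rewrite fps_unitE -(lball_cst V).
by rewrite lball_deg //; lia.
Qed.

Lemma lop_unit_deg p : p \is a GRing.unit -> op p != 0 /\ deg (op p) = 0.
Proof.
move=> pu; have p0 : p != 0 by apply: contraTneq pu => ->; rewrite unitr0.
have [op0 ->] := lop_deg p0; split=> //.
by move: pu; rewrite poly_unitE => /andP[/eqP-> _].
Qed.

Definition tdiag d (a : 'I_d -> int) : 'M[F]_d := diag_mx (\row_i t ^ a i).

Lemma tdiagE d (a : 'I_d -> int) i j : tdiag a i j = t ^ a i *+ (i == j).
Proof. by rewrite !mxE. Qed.

Lemma mul_tdiag d n (a : 'I_d -> int) (M : 'M[F]_(d, n)) i j :
  (tdiag a *m M) i j = t ^ a i * M i j.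
Proof. by rewrite mul_diag_mx !mxE. Qed.

Lemma mulmx_tdiag d n (a : 'I_d -> int) (M : 'M[F]_(n, d)) i j :
  (M *m tdiag a) i j = M i j * t ^ a j.
Proof. by rewrite mul_mx_diag !mxE. Qed.

Lemma det_tdiag d (a : 'I_d -> int) : \det (tdiag a) = t ^ (\sum_i a i).
Proof.
rewrite det_diag; transitivity (\prod_i t ^ a i).
  by apply: eq_bigr => i _; rewrite mxE.
elim/big_rec2: _ => [|i x y _ ->]; first by rewrite expr0z.
by rewrite expfzDr ?lt_neq0.
Qed.

Lemma ldeg_det_tdiag d (a : 'I_d -> int) : deg (\det (tdiag a)) = \sum_i a i.
Proof. by rewrite det_tdiag ldeg_tz. Qed.

Lemma tdiag_unit d (a : 'I_d -> int) : tdiag a \in unitmx.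
Proof. by rewrite unitmxE unitfE det_tdiag ltz_neq0. Qed.

Lemma lball_det d (e : 'I_d -> int) (M : 'M[F]_d) :
  (forall i j, M i j \in ball (e i)) -> \det M \in ball (\sum_i e i).
Proof.
move=> H; rewrite rpred_sum // => s _; rewrite mulr_sign.
suff P : \prod_i M i (s i) \in ball (\sum_i e i) by case: ifP; rewrite ?rpredN.
exact: lball_prod.
Qed.

Lemma lball_bound (s : seq F) : exists n : nat, forall a, a \in s -> a \in ball n.
Proof.
elim: s => [|a s [n H]]; first by exists 0%N.
exists (maxn n `|deg a|) => b; rewrite inE => /orP[/eqP->|/H]; last first.
  by apply: lball_le; rewrite lez_nat leq_maxl.
have [->|a0] := eqVneq a 0; first by rewrite rpred0.
by rewrite lball_deg //; lia.
Qed.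

(** A row operation over k[t]: multiplication by it on the left replaces row [i0] by the combination
    of all rows with coefficients [e]. *)
Definition row_repl d (i0 : 'I_d) (e : 'I_d -> {poly k}) : 'M[{poly k}]_d :=
  \matrix_(i, j) if i == i0 then e j else (i == j)%:R.

Lemma det_row_repl d (i0 : 'I_d) e : \det (row_repl i0 e) = e i0.
Proof.
rewrite (expand_det_col _ i0) (bigD1 i0) //= mxE eqxx big1 ?addr0; last first.
  by move=> i ii0; rewrite mxE (negbTE ii0) mul0r.
rewrite /cofactor -signr_odd addnn odd_double mul1r.
suff -> : row' i0 (col' i0 (row_repl i0 e)) = 1%:M by rewrite det1 mulr1.
apply/matrixP => i j; rewrite !mxE eq_sym (negbTE (neq_lift _ _)).
by rewrite (inj_eq lift_inj).
Qed.

(* A reduced representative minimizes the sum of the logarithmic row norms; if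
   its leading coefficient matrix were singular, one more row operation would
   decrease that sum. *)
Lemma birkhoff d (g : 'M[F]_d) : g \in unitmx ->
  exists (P : 'M[{poly k}]_d) (Q : 'M[fps k]_d) (n : 'I_d -> int),
    [/\ P \in unitmx, Q \in unitmx & map_mx op P *m g = tdiag n *m map_mx of_ Q].
Proof.
move=> gu; pose good (m : nat) := `[< exists (P : 'M[{poly k}]_d) (n : 'I_d -> int),
  [/\ P \in unitmx, forall i j, (map_mx op P *m g) i j \in ball (n i) &
      \sum_i n i - deg (\det g) = m%:Z] >].
have det0 : \det g != 0 by rewrite -unitfE -unitmxE.
(* Ultrametric Hadamard inequality: a unimodular P keeps the degree of the determinant, so the
   excess of the row exponents over it is a natural number and can be minimized. *)
have bound P (n : 'I_d -> int) : P \in unitmx ->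
    (forall i j, (map_mx op P *m g) i j \in ball (n i)) ->
    0 <= \sum_i n i - deg (\det g).
  move=> Pu /lball_det; rewrite det_mulmx det_map_mx.
  move: Pu; rewrite unitmxE => /lop_unit_deg[p0 dp].
  by rewrite lball_deg ?mulf_neq0 // ldegM // dp add0r subr_ge0.
have ex : exists m, good m.
  have [N HN] := lball_bound [seq g i j | i <- enum 'I_d, j <- enum 'I_d].
  have HN' i j : (map_mx op 1%:M *m g) i j \in ball N%:Z.
    rewrite map_scalar_mx rmorph1 mul1mx; apply: HN.
    by apply/allpairsP; exists (i, j); rewrite !mem_enum.
  have := bound 1%:M (fun=> N%:Z) (unitmx1 _ _) HN'.
  case E : (_ - _) => [m|//] _; exists m; apply/asboolP.
  by exists 1%:M, (fun=> N%:Z); rewrite unitmx1.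
have [m /asboolP[P [n [Pu Pn nm]]] mmin] := ex_minnP ex.
have [B HB] : exists B : 'M[fps k]_d, map_mx op P *m g = tdiag n *m map_mx of_ B.
  have /choice[f Hf] : forall ij : 'I_d * 'I_d, exists f,
      (map_mx op P *m g) ij.1 ij.2 = t ^ n ij.1 * of_ f.
    by case=> i j; apply/lballP/Pn.
  exists (\matrix_(i, j) f (i, j)); apply/matrixP => i j.
  by rewrite mul_tdiag !mxE -(Hf (i, j)) mxE.
exists P, B, n; split=> //.
(* If B is not invertible, its matrix of constant terms, which are the leading coefficients of the
   rows, is singular and has a left kernel vector c. *)
rewrite unitmxE fps_unitE -det_map_mx -unitfE -unitmxE.
rewrite -row_free_unit -kermx_eq0; apply/negPn/negP => /rowV0Pn[c /sub_kermxP cB c0].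
have [i1 ci1] : exists i, c 0 i != 0.
  apply/existsP; apply: contraNT c0 => /existsPn H; apply/eqP/rowP => i.
  by rewrite mxE; apply/eqP; rewrite -[_ == _]negbK H.
have [i0 ci0 maxi0] : exists2 i0, c 0 i0 != 0 &
    forall j, c 0 j != 0 -> n j <= n i0.
  have := @arg_maxP _ _ _ i1 (fun i => c 0 i != 0) n ci1.
  by case=> i0 ci0 H; exists i0.
(* Powers of t lift the rows in the support of c to the largest exponent [n i0] among them; outside
   the support the coefficient is 0, whatever the absolute value gives. *)
pose e j := (c 0 j)%:P * 'X^(`|n i0 - n j|).
have Eu : row_repl i0 e *m P \in unitmx.
  rewrite unitmx_mul Pu andbT unitmxE det_row_repl /e subrr expr0 mulr1.
  by rewrite poly_unitE size_polyC ci0 coefC eqxx /= unitfE.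
(* The leading terms of row [i0] cancel because c lies in the kernel, so its exponent drops by
   one. *)
pose n' i := if i == i0 then n i0 - 1 else n i.
have En' i j : (map_mx op (row_repl i0 e *m P) *m g) i j \in ball (n' i).
  rewrite map_mxM -mulmxA mxE.
  have [->|ii0] := eqVneq i i0; last first.
    rewrite /n' (negbTE ii0) (bigD1 i) //= big1 ?addr0 => [|l li]; last first.
      by rewrite !mxE (negbTE ii0) eq_sym (negbTE li) rmorph0 mul0r.
    by rewrite mxE [row_repl _ _ _ _]mxE (negbTE ii0) eqxx rmorph1 mul1r.
  rewrite /n' eqxx HB.
  have -> : \sum_l (map_mx op (row_repl i0 e)) i0 l * (tdiag n *m map_mx of_ B) l j =
      t ^ n i0 * of_ (\sum_l fpsC (c 0 l) * B l j).
    rewrite rmorph_sum mulr_sumr; apply: eq_bigr => l _.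
    rewrite mul_tdiag !mxE eqxx /e rmorphM rmorphXn /= lop_X lop_C rmorphM.
    have [->|cl] := eqVneq (c 0 l) 0; first by rewrite !rmorph0 !mul0r mulr0.
    have E : t ^+ `|n i0 - n l| * t ^ n l = t ^ n i0.
      have := maxi0 _ cl => le.
      by rewrite exprnP gez0_abs ?subr_ge0 // -expfzDr ?lt_neq0 // subrK.
    rewrite -E [X in X * _]mulrC -!mulrA; congr (_ * _).
    by rewrite mulrCA.
  apply: lballM (lball_tz _) _; rewrite lball_cst rmorph_sum.
  move/matrixP/(_ 0 j): cB; rewrite !mxE => cB; apply/eqP; rewrite -[RHS]cB.
  by apply: eq_bigr => l _; rewrite rmorphM mxE.
have sn' : \sum_i n' i = \sum_i n i - 1.
  rewrite (bigD1 i0) //= [in RHS](bigD1 i0) //= /n' eqxx addrAC; congr (_ + _ + _).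
  by apply: eq_bigr => i /negbTE->.
have := bound _ _ Eu En'; rewrite sn'.
case E : (_ - _) => [m'|//] _.
have : good m' by apply/asboolP; exists (row_repl i0 e *m P), n'; rewrite sn'.
by move/mmin; lia.
Qed.

Lemma rmorph_unitmx (A B : comUnitRingType) (f : {rmorphism A -> B}) d (P : 'M[A]_d) :
  P \in unitmx -> map_mx f P \in unitmx.
Proof. by rewrite !unitmxE det_map_mx; apply: rmorph_unit. Qed.

Lemma map_invmxK (A B : comUnitRingType) (f : {rmorphism A -> B}) d n
    (P : 'M[A]_d) (M : 'M[B]_(d, n)) :
  P \in unitmx -> map_mx f (invmx P) *m (map_mx f P *m M) = M.
Proof. by move=> Pu; rewrite mulmxA -map_mxM mulVmx // map_mx1 mul1mx. Qed.

Lemma map_perm_mx (A B : comNzRingType) (f : {rmorphism A -> B}) d (s : 'S_d) :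
  map_mx f (perm_mx s) = perm_mx s.
Proof. by apply/matrixP => i j; rewrite !mxE rmorph_nat. Qed.

Definition sdiag d (s : seq int) : 'M[F]_d := tdiag (fun i : 'I_d => nth 0 s i).

Lemma birkhoff_sorted d (g : 'M[F]_d) : g \in unitmx ->
  exists (P : 'M[{poly k}]_d) (Q : 'M[fps k]_d) (s : seq int),
    [/\ P \in unitmx, Q \in unitmx, size s = d, sorted >=%R s &
        g = map_mx op P *m sdiag d s *m map_mx of_ Q].
Proof.
move=> /birkhoff[P [Q [n [Pu Qu E]]]].
pose s0 := [tuple n i | i < d].
have [p Ep] : exists p : 'S_d, sort >=%R s0 = [tuple tnth s0 (p i) | i < d].
  by apply/tuple_permP; rewrite perm_sort.
set s := sort _ _ in Ep *.
have sE (i : 'I_d) : nth 0 s i = n (p i).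
  by rewrite Ep (nth_map i) ?size_enum_ord // nth_ord_enum !tnth_mktuple.
exists (invmx P *m perm_mx p^-1), (perm_mx p *m Q), s; split.
- by rewrite unitmx_mul unitmx_inv Pu unitmx_perm.
- by rewrite unitmx_mul Qu unitmx_perm.
- by rewrite size_sort size_tuple.
- by apply: sort_sorted => x y; apply: le_total.
- rewrite !map_mxM !map_perm_mx.
  have -> : g = map_mx op (invmx P) *m (tdiag n *m map_mx of_ Q).
    by rewrite -E map_invmxK.
  rewrite -!mulmxA; congr (_ *m _).
  suff -> : tdiag n = perm_mx p^-1 *m sdiag d s *m perm_mx p by rewrite !mulmxA.
  apply/matrixP => i j; rewrite -row_permE -[X in _ *m perm_mx X]invgK -col_permE.
  by rewrite !mxE sE permKV (inj_eq perm_inj).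
Qed.

Lemma sorted_ge_eq (s1 s2 : seq int) :
  sorted >=%R s1 -> sorted >=%R s2 -> perm_eq s1 s2 -> s1 = s2.
Proof. by apply: sorted_eq => [x y z /[swap]|x y]; [exact: le_trans|move/le_anti]. Qed.

Lemma sorted_geP d (s : seq int) (i j : 'I_d) : size s = d -> sorted >=%R s ->
  (i <= j)%N -> nth 0 s j <= nth 0 s i.
Proof.
move=> sd ss ij.
have tr : transitive (>=%R : rel int) by move=> x y z /[swap]; exact: le_trans.
by apply: (sorted_leq_nth tr _ 0 ss) => // [x||]; rewrite ?inE ?sd //=.
Qed.

(* A nonvanishing term of the Leibniz expansion matches the exponents. *)
Lemma birkhoff_unique d (P : 'M[{poly k}]_d) (Q : 'M[fps k]_d) (c : F) (s1 s2 : seq int) :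
  P \in unitmx -> Q \in unitmx -> c != 0 ->
  size s1 = d -> size s2 = d -> sorted >=%R s1 -> sorted >=%R s2 ->
  map_mx op P *m sdiag d s1 *m map_mx of_ Q = c *: sdiag d s2 ->
  s1 = [seq x + deg c | x <- s2].
Proof.
move=> Pu Qu c0 d1 d2 ss1 ss2 E.
have E' : sdiag d s1 *m map_mx of_ Q = c *: (map_mx op (invmx P) *m sdiag d s2).
  by rewrite scalemxAr -E -!mulmxA map_invmxK.
have P'u : invmx P \in unitmx by rewrite unitmx_inv.
have [p0 dp] := lop_unit_deg (etrans (esym (unitmxE _)) P'u).
have [q0 dq] := lof_unit_deg (etrans (esym (unitmxE _)) Qu).
have dE : \sum_(i < d) nth 0 s1 i = deg c * d%:Z + \sum_(i < d) nth 0 s2 i.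
  have := congr1 (fun M => deg (\det M)) E'.
  have cd : deg (c ^+ d) = deg c * d%:Z.
    elim: (d) => [|n IH]; first by rewrite expr0 ldeg1 mulr0.
    by rewrite exprS ldegM ?expf_neq0 // IH; lia.
  rewrite detZ !det_mulmx !det_map_mx /= ldegM //; last first.
    by rewrite det_tdiag ltz_neq0.
  rewrite ldeg_det_tdiag dq addr0 => ->.
  rewrite ldegM ?expf_neq0 ?mulf_neq0 //; last by rewrite det_tdiag ltz_neq0.
  rewrite cd ldegM //; last by rewrite det_tdiag ltz_neq0.
  by rewrite dp ldeg_det_tdiag add0r.
have [p Hp] : exists p : 'S_d, forall i, invmx P i (p i) != 0.
  have : \det (invmx P) != 0 by apply: contra_neq p0 => ->; rewrite rmorph0.
  apply: contra_neqP => /forallNP H; rewrite /determinant big1 // => p _.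
  have /existsNP[i /negP] := H p; rewrite negbK => /eqP i0.
  by rewrite (bigD1 i) //= i0 mul0r mulr0.
have le i : nth 0 s2 (p i) + deg c <= nth 0 s1 i.
  have := congr1 (fun M : 'M[F]_d => M i (p i)) E'.
  rewrite mul_tdiag [RHS]mxE mulmx_tdiag !mxE => Ei.
  have [p'0 p'deg] := lop_deg (Hp i).
  have : t ^ nth 0 s1 i * of_ (Q i (p i)) \in ball (nth 0 s1 i).
    by apply/lballP; exists (Q i (p i)).
  rewrite Ei lball_deg ?mulf_neq0 ?ltz_neq0 // !ldegM ?mulf_neq0 ?ltz_neq0 //.
  by rewrite p'deg ldeg_tz; lia.
(* By [dE] both sides have the same sum, so none of the inequalities is strict; sortedness then
   removes the permutation. *)
have eqi (i : 'I_d) : nth 0 s1 i = nth 0 s2 (p i) + deg c.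
  apply/eqP; rewrite -subr_eq0; apply: contraT => ne.
  suff : \sum_(i < d) (nth 0 s2 (p i) + deg c) < \sum_(i < d) nth 0 s1 i.
    have rp : \sum_(i < d) nth 0 s2 (p i) = \sum_(i < d) nth 0 s2 i.
      by rewrite [RHS](reindex_perm p).
    rewrite big_split /= rp dE.
    by rewrite sumr_const card_ord -mulr_natr addrC natz ltxx.
  rewrite [ltLHS](bigD1 i) // [ltRHS](bigD1 i) //= ltr_leD //.
    by rewrite lt_neqAle le andbT; apply: contra ne => /eqP->; rewrite subrr.
  by apply: ler_sum.
apply: sorted_ge_eq => //.
  rewrite sorted_map; apply: sub_sorted ss2 => x y /=.
  by rewrite lerD2r.
have -> : s1 = [tuple tnth [tuple nth 0 s2 j + deg c | j < d] (p i) | i < d].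
  apply: (@eq_from_nth _ 0); rewrite ?size_tuple // => i.
  rewrite d1 => id.
  have := tnth_nth 0 [tuple tnth [tuple nth 0 s2 j + deg c | j < d] (p i) | i < d] (Ordinal id).
  by rewrite !tnth_mktuple -eqi /= => ->.
have -> : [seq x + deg c | x <- s2] = [tuple nth 0 s2 j + deg c | j < d].
  apply: (@eq_from_nth _ 0); rewrite ?size_tuple size_map d2 // => i id.
  have := tnth_nth 0 [tuple nth 0 s2 j + deg c | j < d] (Ordinal id).
  by rewrite tnth_mktuple /= => <-; rewrite (nth_map 0) ?d2.
by apply/tuple_permP; exists p.
Qed.

(** * Norms of exterior products of lattice vectors *)

Lemma labs_ge0 a : 0 <= abs a.
Proof.
have [->|a0] := eqVneq a 0; first by rewrite labs0.
by rewrite labs_deg // exprz_ge0 // ler0n.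
Qed.

Lemma labs1 : abs 1 = 1.
Proof. by rewrite labs_deg ?oner_neq0 // ldeg1 expr0z. Qed.

Lemma labs_prod I (r : seq I) (P : pred I) (E : I -> F) :
  abs (\prod_(i <- r | P i) E i) = \prod_(i <- r | P i) abs (E i).
Proof. by apply: (big_morph abs (@labsM _ _ V)); exact: labs1. Qed.

Lemma labs_tz (n : int) : abs (t ^ n) = q ^ n.
Proof. by rewrite labs_deg ?ltz_neq0 // ldeg_tz. Qed.

Lemma labs_of f : abs (of_ f) <= 1.
Proof. by rewrite -(expr0z q) labs_ball lball_of. Qed.

Lemma labs_sign (b : bool) a : abs ((-1) ^+ b * a) = abs a.
Proof. by rewrite mulr_sign; case: b; rewrite ?labsN. Qed.

Definition increasing j d (f : {ffun 'I_j -> 'I_d}) : bool :=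
  [forall a : 'I_j, forall b : 'I_j, (a < b)%N ==> (f a < f b)%N].

Lemma increasingP j d (f : {ffun 'I_j -> 'I_d}) :
  reflect (forall a b : 'I_j, (a < b)%N -> (f a < f b)%N) (increasing f).
Proof.
apply: (iffP forallP) => [H a b|H a]; first by move/forallP/(_ b)/implyP: (H a).
by apply/forallP => b; apply/implyP/H.
Qed.

Lemma increasing_ge j d (f : {ffun 'I_j -> 'I_d}) (i : 'I_j) :
  increasing f -> (i <= f i)%N.
Proof.
move=> /increasingP H; case: i => i; elim: i => [//|i IH] ij.
exact: leq_ltn_trans (IH (ltnW ij)) (H (Ordinal (ltnW ij)) (Ordinal ij) (ltnSn i)).
Qed.

Lemma injective_sort j d (phi : 'I_j -> 'I_d) : injective phi ->
  exists (f : {ffun 'I_j -> 'I_d}) (s : 'S_j), increasing f /\ forall i, phi i = f (s i).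
Proof.
move=> inj; pose u := [tuple val (phi i) | i < j].
have [p Ep] : exists p : 'S_j, sort leq u = [tuple tnth u (p i) | i < j].
  by apply/tuple_permP; rewrite perm_sort.
exists [ffun i => phi (p i)], p^-1%g; split=> [|i]; last by rewrite ffunE permKV.
have us : uniq (sort leq u).
  rewrite sort_uniq map_inj_uniq ?enum_uniq // => a b ab.
  exact/inj/val_inj.
have ss := ltn_sorted_uniq_leq (sort leq u); rewrite us sort_sorted in ss; last exact: leq_total.
apply/increasingP => a b ab; rewrite !ffunE.
have nE (i : 'I_j) : nth 0%N (sort leq u) i = phi (p i).
  by rewrite Ep (nth_map i) ?size_enum_ord // nth_ord_enum !tnth_mktuple.
rewrite -!nE; apply: (sorted_ltn_nth ltn_trans 0%N ss); rewrite ?inE ?size_sort ?size_tuple //.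
Qed.

(** The counterpart of [wedge_norm] over the abstract field; for [laurent_lfield] the two are
    convertible. *)
Definition wedge j d (M : 'M[F]_(d, j)) : R :=
  \big[Num.max/0]_(f : {ffun 'I_j -> 'I_d} | increasing f) abs (\det (rowsub f M)).

Lemma wedge_ge0 j d (M : 'M[F]_(d, j)) : 0 <= wedge M.
Proof. by rewrite /wedge; elim/big_ind: _ => // [x y x0 y0|f _]; rewrite ?le_max ?x0 ?labs_ge0. Qed.

Lemma det_row_perm_abs j (M : 'M[F]_j) (s : 'S_j) : abs (\det (row_perm s M)) = abs (\det M).
Proof. by rewrite row_permE det_mulmx det_perm labs_sign. Qed.

(** A repeated index gives two equal rows, so a nonzero minor has an injective index map; sorting
    that map changes at most the sign. *)
Lemma minor_sort j d (M : 'M[F]_(d, j)) (phi : 'I_j -> 'I_d) :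
  \det (rowsub phi M) != 0 ->
  exists2 f : {ffun 'I_j -> 'I_d}, increasing f &
    abs (\det (rowsub phi M)) = abs (\det (rowsub f M)).
Proof.
move=> d0; have inj : injective phi.
  move=> a b ab; apply: contra_neqP d0 => /eqP ne.
  by apply: (determinant_alternate ne) => l; rewrite !mxE ab.
have [f [s [fi E]]] := injective_sort inj; exists f => //.
suff -> : rowsub phi M = row_perm s (rowsub f M) by rewrite det_row_perm_abs.
by apply/matrixP => a b; rewrite !mxE E.
Qed.

Lemma minor_le_wedge j d (M : 'M[F]_(d, j)) (phi : 'I_j -> 'I_d) :
  abs (\det (rowsub phi M)) <= wedge M.
Proof.
have [->|d0] := eqVneq (\det (rowsub phi M)) 0; first by rewrite labs0 wedge_ge0.
have [f fi ->] := minor_sort d0.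
by rewrite /wedge (bigD1 f) //= le_max lexx.
Qed.

Lemma wedge_le j d (M : 'M[F]_(d, j)) (B : R) : 0 <= B ->
  (forall f : {ffun 'I_j -> 'I_d}, increasing f -> abs (\det (rowsub f M)) <= B) ->
  wedge M <= B.
Proof.
by move=> B0 H; rewrite /wedge; elim/big_ind: _ => // x y xB yB; rewrite ge_max xB.
Qed.

(** The Cauchy-Binet expansion before grouping. Keeping all maps, not only the increasing ones, is
    enough for ultrametric estimates. *)
Lemma det_mulmx_expand (A : comNzRingType) j d (B : 'M[A]_(j, d)) (M : 'M[A]_(d, j)) :
  \det (B *m M) =
  \sum_(phi : {ffun 'I_j -> 'I_d}) (\prod_i B i (phi i)) * \det (rowsub phi M).
Proof.
transitivity (\sum_(s : 'S_j) \sum_(phi : {ffun 'I_j -> 'I_d})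
    (\prod_i B i (phi i)) * ((-1) ^+ s * \prod_i M (phi i) (s i))).
  apply: eq_bigr => s _.
  rewrite (eq_bigr (fun i => \sum_l B i l * M l (s i))); last by move=> i _; rewrite mxE.
  rewrite bigA_distr_bigA mulr_sumr; apply: eq_bigr => phi _.
  by rewrite big_split mulrCA.
rewrite exchange_big; apply: eq_bigr => phi _; rewrite -mulr_sumr; congr (_ * _).
by apply: eq_bigr => s _; congr (_ * _); apply: eq_bigr => i _; rewrite mxE.
Qed.

Lemma wedge_integral_le j d (Q : 'M[fps k]_d) (M : 'M[F]_(d, j)) :
  wedge (map_mx of_ Q *m M) <= wedge M.
Proof.
apply: wedge_le (wedge_ge0 _) _ => f _.
have -> : rowsub f (map_mx of_ Q *m M) = rowsub f (map_mx of_ Q) *m M.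
  by apply/matrixP => a b; rewrite !mxE; apply: eq_bigr => l _; rewrite !mxE.
rewrite det_mulmx_expand; apply: labs_sum_le (wedge_ge0 _) _ => phi _.
rewrite labsM -[leRHS]mul1r ler_pM ?labs_ge0 ?minor_le_wedge //.
rewrite labs_prod; apply: prodr_ile1 => i _.
by rewrite labs_ge0 !mxE labs_of.
Qed.

(** Integral invertible matrices act by isometries on exterior powers: the estimate applies to Q and
    to its inverse. *)
Lemma wedge_integral j d (Q : 'M[fps k]_d) (M : 'M[F]_(d, j)) :
  Q \in unitmx -> wedge (map_mx of_ Q *m M) = wedge M.
Proof.
move=> Qu; apply/le_anti; rewrite wedge_integral_le /=.
by rewrite -{1}[M](map_invmxK of_ _ Qu) wedge_integral_le.
Qed.

Lemma wedgeZ j d c (M : 'M[F]_(d, j)) : wedge (c *: M) = abs c ^+ j * wedge M.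
Proof.
have labsX n : abs (c ^+ n) = abs c ^+ n.
  by elim: n => [|n IH]; rewrite ?expr0 ?labs1 // !exprS labsM IH.
rewrite /wedge (big_morph ( *%R (abs c ^+ j)) (id1 := 0) (op1 := Num.max)) ?mulr0 //.
  apply: eq_bigr => f _; rewrite -labsX -labsM -detZ; congr (abs (\det _)).
  by apply/matrixP => a b; rewrite !mxE.
by move=> x y; rewrite maxr_pMr // exprn_ge0 // labs_ge0.
Qed.

Lemma rowsub_tdiag j d (n : 'I_d -> int) (M : 'M[F]_(d, j)) (phi : 'I_j -> 'I_d) :
  rowsub phi (tdiag n *m M) = tdiag (n \o phi) *m rowsub phi M.
Proof. by apply/matrixP => a b; rewrite mxE !mul_tdiag mxE. Qed.

Section DiagonalLattice.
Variables (d : nat) (s : seq int) (c : F) (Q : 'M[fps k]_d) (P : 'M[{poly k}]_d).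
Hypotheses (sd : size s = d) (ss : sorted >=%R s) (c0 : c != 0).
Hypotheses (Qu : Q \in unitmx) (Pu : P \in unitmx).

Local Notation h :=
  (c *: (map_mx of_ Q *m tdiag (fun i : 'I_d => - nth 0 s i) *m map_mx op P)).

(** Up to the scalar c and the isometry Q, a minor is t to the power minus the sum of the s_(f i),
    times a nonzero polynomial, whose absolute value is at least 1. As f i >= i and s is decreasing,
    that sum is at most the sum of the first j terms. *)
Lemma wedge_lattice_ge j (W : 'M[{poly k}]_(d, j)) :
  row_free (h *m map_mx op W)^T ->
  q ^ (deg c * j%:Z - \sum_(i < j) nth 0 s i) <= wedge (h *m map_mx op W).
Proof.
set D := tdiag _; pose X := D *m map_mx op (P *m W).
have -> : h *m map_mx op W = c *: (map_mx of_ Q *m X).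
  by rewrite /X map_mxM -!scalemxAl !mulmxA.
rewrite wedgeZ wedge_integral // => rf.
have : row_full X.
  move: rf; rewrite /row_free mxrank_tr mxrank_scale_nz //.
  by rewrite (eqmxMfull _ _) // row_full_unit rmorph_unitmx.
move=> Xf; pose phi := fullrankfun Xf.
have : \det (rowsub phi X) != 0.
  by rewrite -unitfE -unitmxE -row_full_unit fullrowsub_full.
move=> /[dup] d0 /minor_sort[f fi Ef].
have f0 : \det (rowsub f X) != 0.
  apply: contra_neq d0 => f0; apply/eqP; apply: contraT => d0.
  move: Ef; rewrite f0 labs0 labs_deg // => /eqP.
  by rewrite gt_eqF // exprz_gt0 // ltr0n (leq_trans _ (card_gt1 k)).
have le : q ^ (- \sum_(i < j) nth 0 s i) <= wedge X.
  apply: le_trans (minor_le_wedge X f).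
  have Ed : \det (rowsub f X) = t ^ (\sum_i (- nth 0 s (f i))) * op (\det (rowsub f (P *m W))).
    rewrite /X rowsub_tdiag det_mulmx det_tdiag; congr (_ * _).
    by rewrite -det_map_mx map_mxsub.
  have p0 : \det (rowsub f (P *m W)) != 0.
    by apply: contra_neq f0 => p0; rewrite Ed p0 rmorph0 mulr0.
  have [op0 odeg] := lop_deg p0.
  rewrite labs_deg // Ed ldegM ?ltz_neq0 // ldeg_tz odeg.
  rewrite ler_eXz2l ?q_gt1 // sumrN.
  suff : \sum_i nth 0 s (f i) <= \sum_(i < j) nth 0 s i.
    by move=> le; rewrite -[leLHS]addr0 lerD // lerN2.
  apply: ler_sum => i _; have fge := increasing_ge i fi.
  have id : (i < d)%N by exact: leq_ltn_trans fge (ltn_ord _).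
  exact: (@sorted_geP d s (Ordinal id) (f i)).
have q0 : q != 0 by rewrite gt_eqF // q_gt0.
rewrite expfzDr //; apply: ler_pM => //.
- by rewrite exprz_ge0 // ler0n.
- by rewrite exprz_ge0 // ler0n.
- by rewrite labs_deg // exprnP exprz_exp.
Qed.

(** The bound is reached by the first j vectors of the basis that diagonalizes the lattice. *)
Lemma wedge_lattice_min j : (j <= d)%N ->
  exists W : 'M[{poly k}]_(d, j),
    row_free (h *m map_mx op W)^T /\
    wedge (h *m map_mx op W) = q ^ (deg c * j%:Z - \sum_(i < j) nth 0 s i).
Proof.
move=> jd; pose W : 'M[{poly k}]_(d, j) := invmx P *m pid_mx j.
set D := tdiag (fun i : 'I_d => _).
have E : h *m map_mx op W = c *: (map_mx of_ Q *m (D *m pid_mx j)).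
  rewrite /W map_mxM map_pid_mx -!scalemxAl -!mulmxA.
  suff -> : map_mx op P *m (map_mx op (invmx P) *m pid_mx j) =
      pid_mx j :> 'M[F]_(d, j) by [].
  by rewrite mulmxA -map_mxM mulmxV // map_mx1 mul1mx.
have rf : row_free (h *m map_mx op W)^T.
  rewrite E /row_free mxrank_tr mxrank_scale_nz //.
  rewrite (eqmxMfull _ _) ?row_full_unit ?rmorph_unitmx //.
  by rewrite (eqmxMfull _ _) ?row_full_unit ?tdiag_unit // rank_pid_mx.
exists W; split=> //; apply/le_anti; rewrite wedge_lattice_ge // andbT.
rewrite E wedgeZ wedge_integral //.
have q0 : q != 0 by rewrite gt_eqF // q_gt0.
rewrite expfzDr //; apply: ler_pM; rewrite ?exprn_ge0 ?labs_ge0 ?wedge_ge0 //.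
  by rewrite labs_deg // exprnP exprz_exp.
apply: wedge_le => [|f fi]; first by rewrite exprz_ge0 // ler0n.
have -> : rowsub f (D *m pid_mx j) =
    map_mx of_ (rowsub f (pid_mx j)) *m tdiag (fun i : 'I_j => - nth 0 s i).
  apply/matrixP => a b; rewrite mxE mul_tdiag mulmx_tdiag !mxE.
  case: eqP => [->|_] /=; last by rewrite mulr0 rmorph0 mul0r.
  by rewrite rmorph_nat mulrC.
rewrite det_mulmx labsM det_tdiag labs_tz sumrN -[leRHS]mul1r ler_wpM2r //.
  by rewrite exprz_ge0 // ler0n.
by rewrite det_map_mx labs_of.
Qed.

Lemma covol_diag : abs (\det h) = q ^ (deg c * d%:Z - \sum_(i < d) nth 0 s i).
Proof.
have [Q0 Qd] := lof_unit_deg (etrans (esym (unitmxE _)) Qu).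
have [P0 Pd] := lop_unit_deg (etrans (esym (unitmxE _)) Pu).
have cd n : deg (c ^+ n) = deg c * n%:Z.
  elim: n => [|n IH]; first by rewrite expr0 ldeg1 mulr0.
  by rewrite exprS ldegM ?expf_neq0 // IH; lia.
rewrite detZ !det_mulmx !det_map_mx det_tdiag labs_deg ?mulf_neq0 ?expf_neq0 ?ltz_neq0 //.
rewrite !ldegM ?mulf_neq0 ?expf_neq0 ?ltz_neq0 // Qd Pd cd ldeg_tz sumrN.
by rewrite add0r addr0.
Qed.

End DiagonalLattice.

End LatticeReduction.

(** * Stabilizers of the diagonal classes *)

Section AutomorphismCount.
Variable k : finFieldType.

(** The Levi factor: constant automorphisms that mix only summands of equal degree. *)
Definition levi_set n (f : nat -> int) : {set 'M[k]_n} :=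
  [set A | (A \in unitmx) &&
           [forall i, forall j, (f (nat_of_ord i) != f (nat_of_ord j)) ==> (A i j == 0)]].

(** The dimension of the unipotent radical: Hom from O(b) to O(a) has dimension a - b + 1 for b <
    a. *)
Definition unip_dim n (f : nat -> int) : nat :=
  \sum_(i < n) \sum_(j < n | (f j < f i)%R) `|(f i - f j)%R|.+1.

(* The order of the automorphism group of the vector bundle on the projective
   line with splitting type [s]. *)
Definition aut_card (s : seq int) : nat :=
  #|levi_set (size s) (nth 0 s)| * #|k| ^ unip_dim (size s) (nth 0 s).

End AutomorphismCount.

Section Stabilizer.
Variables (R : realType) (k : finFieldType) (V : lfield R k).
Local Notation F := (lF V).
Local Notation t := (lt V).
Local Notation of_ := (lof V).
Local Notation op := (lop V).
Local Notation deg := (@ldeg R k V).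
Local Notation ball := (lball V).
Local Notation q := (#|k|).

Definition poly_PGL d : set (PGL F d) := [set x | exists g : GL F d,
  x = toPGL g /\ exists2 B : 'M[{poly k}]_d, B \in unitmx & GLmx g = map_mx op B].

Definition int_PGL d : set (PGL F d) := [set x | exists g : GL F d,
  x = toPGL g /\ exists2 B : 'M[fps k]_d, B \in unitmx & GLmx g = map_mx of_ B].

Definition diag_GL d (s : seq int) : GL F d :=
  MkGL (tdiag_unit V (fun i : 'I_d => nth 0 s i)).

Definition diag_PGL d (s : seq int) : PGL F d := toPGL (diag_GL d s).

(** The intersection of Gam with g K g^-1 for the diagonal g of exponents s. *)
Definition stab_PGL d (s : seq int) : set (PGL F d) :=
  [set x | @poly_PGL d x /\
     exists2 y, @int_PGL d y & (x * diag_PGL d s = diag_PGL d s * y)%g].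

Section Fixed.
Variables (d : nat) (s : seq int).
Hypotheses (d0 : (0 < d)%N) (sd : size s = d).

Local Notation sz := (fun i : nat => nth 0 s i).
(** Entry (i, j) is a map from O(s_j) to O(s_i), a polynomial of degree at most s_i - s_j. The bound
    is meant for [size], the degree plus one. *)
Definition entry_size (i j : nat) : nat :=
  if sz j <= sz i then `|(sz i - sz j)%R|.+1 else 0%N.

Lemma entry_sizeE (p : {poly k}) i j :
  (size p <= entry_size i j)%N = (p == 0) || ((size p).-1%:Z <= sz i - sz j).
Proof.
rewrite /entry_size; have [->|p0] := eqVneq p 0; first by rewrite size_poly0.
have : (0 < size p)%N by rewrite size_poly_gt0.
by case: (leP (sz j) (sz i)) => ji; lia.
Qed.

Definition stab_mx (M : 'M[{poly k}]_d) : bool :=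
  [forall i, forall j, (size (M i j) <= entry_size i j)%N] && (M \in unitmx).

Lemma stab_mxP (M : 'M[{poly k}]_d) : reflect
  ((forall i j : 'I_d, (size (M i j) <= entry_size i j)%N) /\ M \in unitmx) (stab_mx M).
Proof.
apply: (iffP andP) => -[H Mu]; split=> //; first by move=> i j; move/forallP/(_ i)/forallP: H.
by apply/forallP => i; apply/forallP => j.
Qed.

Definition level_mx (M : 'M[{poly k}]_d) : 'M[k]_d :=
  \matrix_(i, j) if sz i == sz j then (M i j)`_0 else 0.

(** A nonzero Leibniz term needs s_(p i) <= s_i for all i. As both sides have the same sum these are
    equalities, and between equal levels the entries are constants. *)
Lemma det_level_mx (M : 'M[{poly k}]_d) :
  (forall i j : 'I_d, (size (M i j) <= entry_size i j)%N) ->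
  \det M = (\det (level_mx M))%:P.
Proof.
move=> Ms; rewrite rmorph_sum; apply: eq_bigr => p _.
rewrite rmorphM rmorph_sign rmorph_prod; congr (_ * _).
have [/forallP nz|nz] := boolP [forall i, M i (p i) != 0]; last first.
  have [i /negPn/eqP Mi] := forallPn nz.
  rewrite (bigD1 i) //= [RHS](bigD1 i) //= Mi mul0r mxE Mi coef0.
  by case: ifP; rewrite polyC0 mul0r.
have le i : sz (p i) <= sz i.
  have := Ms i (p i); rewrite /entry_size; case: leP => // _.
  by rewrite leqn0 size_poly_eq0 (negbTE (nz i)).
have eqs (i : 'I_d) : sz i = sz (p i).
  apply/eqP; rewrite -subr_eq0; apply: contraT => ne.
  have rp : \sum_(i < d) sz (p i) = \sum_(i < d) sz i.
    by rewrite [RHS](reindex_perm p).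
  suff : \sum_(i < d) sz (p i) < \sum_(i < d) sz i by rewrite rp ltxx.
  rewrite [ltLHS](bigD1 i) // [ltRHS](bigD1 i) //= ltr_leD //.
    by rewrite lt_neqAle le andbT; apply: contra ne => /eqP->; rewrite subrr.
  by apply: ler_sum.
apply: eq_bigr => i _; rewrite mxE (eqs i) eqxx; apply: size1_polyC.
by have := Ms i (p i); rewrite /entry_size (eqs i) lexx subrr.
Qed.

Lemma toPGL_eqP (g h : GL F d) :
  toPGL g = toPGL h <-> exists2 c : F, c != 0 & GLmx h = c *: GLmx g.
Proof. exact: toPGL_eq. Qed.

Lemma deg0_of_unit_det (c : F) (A B : 'M[F]_d) : c != 0 -> B = c *: A ->
  \det A != 0 -> deg (\det A) = deg (\det B) -> deg c = 0.
Proof.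
move=> c0 -> A0; rewrite detZ ldegM ?expf_neq0 //.
have -> : deg (c ^+ d) = deg c * d%:Z.
  elim: (d) => [|n IH]; first by rewrite expr0 ldeg1 mulr0.
  by rewrite exprS ldegM ?expf_neq0 // IH; lia.
move=> E; have /eqP : deg c * d%:Z = 0.
  by apply: (addIr (deg (\det A))); rewrite -E add0r.
by rewrite mulf_eq0 => /orP[/eqP//|]; case: d d0.
Qed.

(** Classes determine matrices only up to a scalar c, but comparing determinants gives c degree 0.
    Integrality of t^(-s_i) M_ij t^(s_j) is then exactly the bound on the degree of M_ij. *)
Lemma stab_PGLP (x : PGL F d) : stab_PGL s x <->
  exists2 M, stab_mx M & exists2 g : GL F d, x = toPGL g & GLmx g = map_mx op M.
Proof.
split.
  move=> [[g [-> [B Bu gB]]] [y [h [-> [C Cu hC]]]]].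
  rewrite /diag_PGL [LHS]toPGL_M [RHS]toPGL_M => /toPGL_eqP[c c0] /=.
  rewrite gB hC -/(sdiag V d s) => E.
  have detD : \det (sdiag V d s) != 0 by rewrite det_tdiag ltz_neq0.
  have [B0 Bd] := lop_unit_deg V (etrans (esym (unitmxE _)) Bu).
  have [C0 Cd] := lof_unit_deg V (etrans (esym (unitmxE _)) Cu).
  have dc : deg c = 0.
    apply: (deg0_of_unit_det c0 E); rewrite !det_mulmx !det_map_mx ?mulf_neq0 //.
    by rewrite !ldegM // Bd Cd addrC.
  exists B; last by exists g.
  apply/stab_mxP; split=> // i j; rewrite entry_sizeE -(lop_ball V).
  have := congr1 (fun M : 'M[F]_d => M i j) E.
  rewrite mul_tdiag [RHS]mxE mulmx_tdiag !mxE => Eij.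
  have -> : op (B i j) = c^-1 * (t ^ (sz i - sz j) * of_ (C i j)).
    rewrite expfzDr ?lt_neq0 // -invr_expz mulrAC Eij.
    by rewrite -mulrA mulfK ?ltz_neq0 // mulKf.
  apply: (@lball_le _ _ _ (0 + (sz i - sz j))); first by rewrite add0r.
  apply: lballM; last by apply/lballP; exists (C i j).
  by rewrite lball_deg ?invr_eq0 // ldegV // dc oppr0.
move=> [M /stab_mxP[Ms Mu] [g -> gM]]; split; first by exists g; split=> //; exists M.
have [M0 Md] := lop_unit_deg V (etrans (esym (unitmxE _)) Mu).
have /choice[f Hf] : forall ij : 'I_d * 'I_d, exists f,
    op (M ij.1 ij.2) = t ^ (sz ij.1 - sz ij.2) * of_ f.
  by case=> i j; apply/lballP; rewrite lop_ball -entry_sizeE.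
pose C := \matrix_(i, j) f (i, j).
have E : map_mx op M *m sdiag V d s = sdiag V d s *m map_mx of_ C.
  apply/matrixP => i j; rewrite mul_tdiag mulmx_tdiag !mxE (Hf (i, j)) /= mulrAC.
  by rewrite -expfzDr ?lt_neq0 // subrK.
have Cu : C \in unitmx.
  have := congr1 determinant E; rewrite !det_mulmx !det_map_mx mulrC.
  move/(mulfI _) => /(_ ltac:(by rewrite det_tdiag ltz_neq0)) dE.
  rewrite unitmxE fps_unitE -(lball_cst V) -dE lball_deg // Md.
  by [].
exists (toPGL (MkGL (rmorph_unitmx of_ Cu))).
  by eexists; split; [reflexivity|exists C].
rewrite /diag_PGL [LHS]toPGL_M [RHS]toPGL_M; congr toPGL.
by apply: val_inj; rewrite /= gM.
Qed.

(** A crude bound common to all entries, so that the stabilizing matrices are coded by coefficient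
    tables in a finite type and can be counted. *)
Definition coef_bound : nat := \sum_(i < d) \sum_(j < d) entry_size i j.

Lemma entry_size_bound (i j : 'I_d) : (entry_size i j <= coef_bound)%N.
Proof.
rewrite /coef_bound (bigD1 i) //= (bigD1 j) //= -addnA; exact: leq_addr.
Qed.

Local Notation T := {ffun ('I_d * 'I_d) * 'I_coef_bound.+1 -> k}.

Definition poly_mx_of (x : T) : 'M[{poly k}]_d :=
  \matrix_(i, j) \poly_(l < coef_bound.+1) x ((i, j), inord l).

Lemma poly_mx_ofE (x : T) i j (l : 'I_coef_bound.+1) :
  (poly_mx_of x i j)`_l = x ((i, j), l).
Proof. by rewrite mxE coef_poly ltn_ord inord_val. Qed.

Lemma poly_mx_of_inj : injective poly_mx_of.
Proof.
move=> x y E; apply/ffunP => -[[i j] l]; rewrite -!poly_mx_ofE; by rewrite E.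
Qed.

Definition level_of (x : T) : 'M[k]_d :=
  \matrix_(i, j) if sz i == sz j then x ((i, j), ord0) else 0.

Lemma level_mx_of x : level_mx (poly_mx_of x) = level_of x.
Proof. by apply/matrixP => i j; rewrite mxE (poly_mx_ofE x i j ord0) [RHS]mxE. Qed.

Definition bounded_coef (x : T) : bool :=
  [forall u : ('I_d * 'I_d) * 'I_coef_bound.+1, (entry_size u.1.1 u.1.2 <= u.2)%N ==> (x u == 0)].

Lemma bounded_coefP x : reflect
  (forall i j : 'I_d, (size (poly_mx_of x i j) <= entry_size i j)%N) (bounded_coef x).
Proof.
apply: (iffP forallP) => [H i j|H [[i j] l]].
  apply/leq_sizeP => l le; have [lb|lb] := ltnP l coef_bound.+1.
    rewrite (poly_mx_ofE x i j (Ordinal lb)).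
    by have /implyP/(_ le)/eqP := H ((i, j), Ordinal lb).
  by rewrite mxE coef_poly ltnNge lb.
by apply/implyP => /= le; rewrite -poly_mx_ofE; apply/eqP; move/leq_sizeP: (H i j); apply.
Qed.

Definition stab_set : {set T} := [set x | bounded_coef x && (level_of x \in unitmx)].

Lemma stab_setP x : (x \in stab_set) = stab_mx (poly_mx_of x).
Proof.
rewrite inE; apply/andP/stab_mxP => -[]; first move/bounded_coefP => H.
  rewrite !unitmxE unitfE => u; split=> //.
  by rewrite (det_level_mx H) level_mx_of rmorph_unit ?unitfE.
move=> H; rewrite unitmxE (det_level_mx H) level_mx_of => u.
split; first exact/bounded_coefP.
rewrite unitmxE unitfE; apply: contraTneq u => ->.
by rewrite polyC0 unitr0.
Qed.

Lemma stab_mx_ex M : stab_mx M -> exists2 x, x \in stab_set & poly_mx_of x = M.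
Proof.
move=> Ms; pose x : T := [ffun u : ('I_d * 'I_d) * 'I_coef_bound.+1 => (M u.1.1 u.1.2)`_(u.2)].
suff E : poly_mx_of x = M by exists x; rewrite ?stab_setP ?E.
apply/matrixP => i j; apply/polyP => l; rewrite mxE coef_poly.
case: ltnP => lb; first by rewrite ffunE /= inordK.
rewrite nth_default //; case/stab_mxP: Ms => /(_ i j) le _.
exact: leq_trans le (leq_trans (entry_size_bound i j) (ltnW lb)).
Qed.

(** Project to the Levi part: over each A the coefficients between equal levels are prescribed,
    those within the bounds at unequal levels are free, and all others are 0. *)
Lemma stab_set_card : #|stab_set| = aut_card k s.
Proof.
rewrite /aut_card sd.
pose G (A : 'M[k]_d) (u : ('I_d * 'I_d) * 'I_coef_bound.+1) : {pred k} :=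
  [pred y : k | if (entry_size u.1.1 u.1.2 <= u.2)%N then y == 0
          else (sz u.1.1 == sz u.1.2) ==> (y == A u.1.1 u.1.2)].
have fib A : A \in levi_set k d sz ->
    #|[set x in stab_set | level_of x == A]| = (q ^ unip_dim d sz)%N.
  rewrite inE => /andP[Au /forallP Az].
  have -> : #|[set x in stab_set | level_of x == A]| = #|family (G A)|.
    apply: eq_card => x; rewrite !inE; apply/idP/familyP.
      move=> /andP[/andP[/forallP bx _] /eqP xA] u; rewrite inE.
      have := bx u; case: leqP => //= lt _; apply/implyP => /eqP e.
      rewrite -xA mxE e eqxx; case: u lt e => -[i j] l /=.
      rewrite /entry_size => + e; rewrite e lexx subrr ltnS leqn0 => /eqP l0.
      by apply/eqP; congr (x (_, _)); apply: val_inj.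
    move=> H; have bx : bounded_coef x.
      by apply/forallP => u; apply/implyP => le; have := H u; rewrite inE le.
    have xA : level_of x = A.
      apply/matrixP => i j; rewrite mxE; case: eqP => e; last first.
        by have /forallP/(_ j)/implyP/(_ _)/eqP -> // := Az i; apply/eqP.
      have := H ((i, j), ord0); rewrite inE /= /entry_size e lexx eqxx /=.
      by move/eqP.
    by rewrite bx xA Au eqxx.
  rewrite card_family foldrE big_image /=.
  have cG u : #|G A u| = if (entry_size u.1.1 u.1.2 <= u.2)%N then 1%N
      else if sz u.1.1 == sz u.1.2 then 1%N else q.
    rewrite /G; case: ifP => _; first by rewrite (eq_card (B := pred1 0)) ?card1.
    case: ifP => _ /=; last by rewrite (eq_card (B := predT)) // cardE.
    by rewrite (eq_card (B := pred1 (A u.1.1 u.1.2))) ?card1.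
  rewrite (eq_bigr _ (fun u _ => cG u)) -(pair_big xpredT xpredT (fun (ij : 'I_d * 'I_d) (l : 'I_coef_bound.+1) =>
    if (entry_size ij.1 ij.2 <= nat_of_ord l)%N then 1%N else if sz ij.1 == sz ij.2 then 1%N else q)) /=.
  rewrite -(pair_big xpredT xpredT (fun i j : 'I_d => \prod_(l < coef_bound.+1)
    if (entry_size i j <= nat_of_ord l)%N then 1%N else if sz i == sz j then 1%N else q)) /=.
  rewrite /unip_dim expn_sum; apply: eq_bigr => i _.
  rewrite expn_sum [RHS]big_mkcond /=; apply: eq_bigr => j _.
  have [e|ne] := eqVneq (sz i) (sz j).
    by rewrite e ltxx big1 // => l _; case: ifP.
  rewrite (eq_bigr (fun l : 'I_coef_bound.+1 => if (l < entry_size i j)%N then q else 1%N)); last first.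
    by move=> l _; rewrite ltnNge; case: ifP.
  rewrite -big_mkcond /= prod_nat_const.
  have -> : #|[pred l : 'I_coef_bound.+1 | (l < entry_size i j)%N]| = entry_size i j.
    rewrite -sum1_card -(big_ord_widen _ (fun=> 1%N)) ?sum1_card ?card_ord //.
    exact: leq_trans (entry_size_bound i j) (leqnSn _).
  by rewrite /entry_size lt_neqAle eq_sym ne /=; case: leP.
rewrite -sum1_card (partition_big level_of (mem (levi_set k d sz))) /=.
  rewrite -sum_nat_const; apply: eq_bigr => A AL; rewrite -(fib A AL) -sum1_card.
  by apply: eq_bigl => x; rewrite inE.
move=> x; rewrite !inE => /andP[_ ->] /=; apply/forallP => i; apply/forallP => j.
by apply/implyP => ne; rewrite mxE (negbTE ne).
Qed.

Lemma scale_stab_mx (c : k) M : c != 0 -> stab_mx M -> stab_mx (c%:P *: M).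
Proof.
move=> c0 /stab_mxP[Ms Mu]; apply/stab_mxP; split.
  by move=> i j; rewrite mxE mul_polyC (leq_trans (size_scale_leq _ _)).
by rewrite unitmxZ // poly_unitE size_polyC c0 coefC eqxx /= unitfE.
Qed.

Lemma poly_mx_ofZ (c : k) (x : T) :
  poly_mx_of [ffun u => c * x u] = c%:P *: poly_mx_of x.
Proof.
apply/matrixP => i j; rewrite !mxE mul_polyC; apply/polyP => l.
by rewrite coefZ !coef_poly; case: ifP; rewrite ?mulr0 // ffunE.
Qed.

(* Two elements define the same projective transformation iff they differ by a
   constant, so the fibres of the projectivization have [q - 1] elements. *)
Lemma stab_PGL_card : exists l : seq (PGL F d),
  [/\ uniq l, forall x, x \in l <-> stab_PGL s x &
      (size l * q.-1)%N = aut_card k s].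
Proof.
have GLx x : x \in stab_set -> map_mx op (poly_mx_of x) \in unitmx.
  by rewrite stab_setP => /stab_mxP[_ Mu]; apply: rmorph_unitmx.
pose phi x : PGL F d := if insub (map_mx op (poly_mx_of x)) is Some g then toPGL g
  else toPGL (GL_one F d).
have phiE x : x \in stab_set -> exists2 g : GL F d, phi x = toPGL g &
    GLmx g = map_mx op (poly_mx_of x).
  move=> /GLx xu; rewrite /phi insubT; eexists; first by reflexivity.
  by rewrite SubK.
have phi_eq x y : x \in stab_set -> y \in stab_set ->
    phi x = phi y <-> exists2 c : k, c != 0 & y = [ffun u => c * x u].
  move=> xs ys; have [g -> gx] := phiE x xs; have [h -> hy] := phiE y ys.
  have [/stab_mxP[_ xu] /stab_mxP[_ yu]] : stab_mx (poly_mx_of x) /\ stab_mx (poly_mx_of y).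
    by rewrite -!stab_setP.
  rewrite toPGL_eqP gx hy; split=> [[c c0 E]|[c c0 ->]]; last first.
    exists (op c%:P).
      by rewrite lop_C; case: (lof_unit_deg V (f := fpsC c)) => //; rewrite fps_unitE.
    by rewrite poly_mx_ofZ map_mxZ.
  have [x0 xd] := lop_unit_deg V (etrans (esym (unitmxE _)) xu).
  have [y0 yd] := lop_unit_deg V (etrans (esym (unitmxE _)) yu).
  have dc : deg c = 0.
    by apply: (deg0_of_unit_det c0 E); rewrite !det_map_mx ?xd ?yd.
  (* [P] has polynomial entries and maps to c times the identity, so c is a polynomial; having
     degree 0, it is a constant of k. *)
  pose P := poly_mx_of y *m invmx (poly_mx_of x).
  have Pc : map_mx op P = c%:M.
    by rewrite map_mxM E -scalemxAl -map_mxM mulmxV // map_mx1 scalemx1.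
  pose i0 := Ordinal d0.
  have p0 : op (P i0 i0) = c.
    by have := congr1 (fun M : 'M[F]_d => M i0 i0) Pc; rewrite !mxE eqxx.
  have : (size (P i0 i0) <= 1)%N.
    have := lop_ball V (P i0 i0) 0; rewrite p0 lball_deg // dc lexx.
    by case: eqP => [->|_]; [rewrite size_poly0|case: (size _) => [|[|n]]].
  move=> /size1_polyC Ec; set c' := (P i0 i0)`_0 in Ec.
  exists c'.
    by apply: contra_neq c0 => c'0; rewrite -p0 Ec c'0 polyC0 rmorph0.
  apply: poly_mx_of_inj; rewrite poly_mx_ofZ.
  have inj : injective (map_mx (m := d) (n := d) op).
    move=> A B AB; apply/matrixP => i j; apply: (@lop_inj _ _ V).
    by have := congr1 (fun M : 'M[F]_d => M i j) AB; rewrite !mxE.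
  by apply: inj; rewrite E map_mxZ -Ec p0.
exists (undup [seq phi x | x <- enum stab_set]); split.
- exact: undup_uniq.
- move=> y; rewrite mem_undup stab_PGLP; split.
    move=> /mapP[x]; rewrite mem_enum => xs ->; exists (poly_mx_of x).
      by rewrite -stab_setP.
    exact: phiE.
  move=> [M /stab_mx_ex[x xs <-] [g -> gM]]; apply/mapP; exists x.
    by rewrite mem_enum.
  by have [h -> hM] := phiE x xs; congr toPGL; apply: val_inj; rewrite /= gM.
- set l := undup _; rewrite -stab_set_card.
  have fib y : y \in l -> \sum_(x in stab_set) (phi x == y : nat) = q.-1.
    rewrite mem_undup => /mapP[x]; rewrite mem_enum => xs ->.
    rewrite -big_mkcondr /= sum1_card.
    have inj : injective (fun c : k => [ffun u => c * x u] : T).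
      move=> c c' /ffunP E; apply: contraTeq xs => cc'.
      have x0 : x = 0.
        apply/ffunP => u; rewrite ffunE; have := E u; rewrite !ffunE => /eqP.
        rewrite -subr_eq0 -mulrBl mulf_eq0 subr_eq0 (negbTE cc') => /eqP ->.
        by [].
      rewrite stab_setP x0; apply/negP => /stab_mxP[_].
      suff -> : poly_mx_of 0 = 0.
        move=> /mulmxV; rewrite mul0mx => /matrixP/(_ (Ordinal d0) (Ordinal d0)).
        by rewrite !mxE eqxx => /eqP; rewrite eq_sym oner_eq0.
      by apply/matrixP => i j; rewrite !mxE; apply/polyP => m;
         rewrite coef_poly coef0; case: ifP => //; rewrite ffunE.
    rewrite -(cardC1 (0 : k)) -(card_imset _ inj); apply: eq_card => z.
    apply/idP/imsetP.
      by move=> /andP[zs /eqP /esym /(phi_eq _ _ xs zs)[c c0 ->]]; exists c.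
    move=> [c c0 ->]; have zs : [ffun u => c * x u] \in stab_set.
      by rewrite stab_setP poly_mx_ofZ scale_stab_mx // -stab_setP.
    by rewrite unfold_in /= zs; apply/eqP/esym/phi_eq => //; exists c.
  rewrite -sum1_card.
  rewrite (eq_bigr (fun x => \sum_(y <- l) (phi x == y : nat))); last first.
    move=> x xs; have xl : phi x \in l by rewrite mem_undup map_f // mem_enum.
    rewrite (bigD1_seq (phi x)) ?undup_uniq //= eqxx big1 // => y ne.
    by rewrite eq_sym (negbTE ne).
  rewrite exchange_big /= (eq_big_seq _ fib) big_const_seq count_predT iter_addn_0.
  by rewrite mulnC.
Qed.

End Fixed.
End Stabilizer.

(** * Masses of splitting types *)

Section AutomorphismFormulas.
Variable k : finFieldType.
Local Notation q := #|k|.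

Lemma eq_levi_set n (f g : nat -> int) :
  (forall i j, (i < n)%N -> (j < n)%N -> (f i == f j) = (g i == g j)) ->
  levi_set k n f = levi_set k n g.
Proof.
move=> fg; apply/setP => A; rewrite !inE; congr (_ && _).
by apply: eq_forallb => i; apply: eq_forallb => j; rewrite fg.
Qed.

Lemma levi_setP n (f : nat -> int) (A : 'M[k]_n) :
  reflect (A \in unitmx /\ forall i j : 'I_n, f i != f j -> A i j = 0) (A \in levi_set k n f).
Proof.
rewrite inE; apply: (iffP andP) => -[Au /= H]; split=> //.
  by move=> i j ne; have /forallP/(_ j)/implyP/(_ ne)/eqP := forallP H i.
by apply/forallP => i; apply/forallP => j; apply/implyP => ne; apply/eqP/H.
Qed.

(** Positions linking the two halves join unequal degrees, so the matrix is block diagonal. *)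
Lemma card_levi_set_add m n (f : nat -> int) :
  (forall i j, (i < m)%N -> (j < n)%N -> f i != f (m + j)%N) ->
  #|levi_set k (m + n) f| =
    (#|levi_set k m f| * #|levi_set k n (fun i => f (m + i)%N)|)%N.
Proof.
move=> ne; rewrite -cardsX; pose g (u : 'M[k]_m * 'M[k]_n) := block_mx u.1 0 0 u.2.
have inj : injective g.
  by move=> [A B] [A' B'] /eq_block_mx[/= -> _ _ ->].
rewrite -(card_imset _ inj); apply: eq_card => M; apply/idP/imsetP.
  move=> /levi_setP[Mu Mz].
  have ur : ursubmx M = 0.
    by apply/matrixP => i j; rewrite !mxE Mz //= ne.
  have dl : dlsubmx M = 0.
    by apply/matrixP => i j; rewrite !mxE Mz //= eq_sym ne.
  have EM : M = g (ulsubmx M, drsubmx M) by rewrite /g /= -{1}[M]submxK ur dl.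
  have : M \in unitmx by [].
  rewrite unitmxE unitfE EM /g /= det_ublock mulf_eq0 negb_or => /andP[u1 u2].
  exists (ulsubmx M, drsubmx M) => //; rewrite inE /=; apply/andP; split.
    by apply/levi_setP; rewrite unitmxE unitfE; split=> // i j /= fij; rewrite !mxE Mz.
  by apply/levi_setP; rewrite unitmxE unitfE; split=> // i j /= fij; rewrite !mxE Mz.
move=> [[A B]]; rewrite inE /= => /andP[/levi_setP[Au Az] /levi_setP[Bu Bz]] ->.
apply/levi_setP; split.
  by move: Au Bu; rewrite !unitmxE !unitfE /g /= det_ublock mulf_eq0 negb_or => -> ->.
move=> i j; rewrite /g /=; case: (split_ordP i) => a ->; case: (split_ordP j) => b -> /=.
- by rewrite block_mxEul; apply: Az.
- by rewrite block_mxEur mxE.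
- by rewrite block_mxEdl mxE.
- by rewrite block_mxEdr; apply: Bz.
Qed.

Definition gl_card n : nat := (q ^ 'C(n, 2) * \prod_(1 <= i < n.+1) (q ^ i - 1))%N.

Lemma card_levi_set_const n (f : nat -> int) :
  (forall i j, (i < n)%N -> (j < n)%N -> f i = f j) -> #|levi_set k n f| = gl_card n.
Proof.
move=> fc; have -> : levi_set k n f = [set A | A \in unitmx]%SET.
  apply/setP => A; rewrite [RHS]inE; apply/levi_setP/idP => [[]//|Au]; split=> // i j.
  by rewrite (fc i j) // eqxx.
case: n fc => [|n] _.
  rewrite /gl_card big_geq // (_ : [set _ | _]%SET = [set: 'M[k]_0]%SET); last first.
    by apply/setP => A; rewrite !inE unitmxE det_mx00 unitr1.
  by rewrite cardsT card_mx mul0n.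
rewrite /gl_card -card_GL // cardsT card_sub cardsE; apply: eq_card => A.
by [].
Qed.

Lemma unip_dimE (s : seq int) : unip_dim (size s) (nth 0 s) =
  \sum_(x <- s) \sum_(y <- s | (y < x)%R) `|(x - y)%R|.+1.
Proof.
rewrite (big_nth 0) big_mkord; apply: eq_bigr => i _.
by rewrite (big_nth 0) big_mkord.
Qed.

Lemma aut_card_shift (s : seq int) (c : int) :
  aut_card k [seq x + c | x <- s] = aut_card k s.
Proof.
rewrite /aut_card !unip_dimE size_map; congr (_ * q ^ _)%N.
  rewrite (@eq_levi_set _ _ (nth 0 s)) // => i j id jd.
  by rewrite !(nth_map 0) // (inj_eq (addIr _)).
rewrite big_map; apply: eq_bigr => x _; rewrite big_map; apply: eq_big => y.
  by rewrite ltrD2r.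
by move=> _; rewrite opprD addrACA subrr addr0.
Qed.

(** The power of q counts the homomorphisms from the summands of [s2] to those of [s1]; in the other
    direction there are none, the degrees in [s2] being smaller. *)
Lemma aut_card_cat (s1 s2 : seq int) :
  (forall x y, x \in s1 -> y \in s2 -> y < x) ->
  aut_card k (s1 ++ s2) = (aut_card k s1 * aut_card k s2 *
    q ^ (\sum_(x <- s1) \sum_(y <- s2) `|(x - y)%R|.+1))%N.
Proof.
move=> lt; rewrite /aut_card !unip_dimE size_cat card_levi_set_add; last first.
  move=> i j i1 j2; rewrite !nth_cat i1 ltnNge leq_addr /= addKn.
  by rewrite gt_eqF // lt // mem_nth.
rewrite (@eq_levi_set (size s1) _ (nth 0 s1)); last first.
  by move=> i j i1 j1; rewrite !nth_cat i1 j1.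
rewrite (@eq_levi_set (size s2) _ (nth 0 s2)); last first.
  by move=> i j i1 j1; rewrite !nth_cat !ltnNge !leq_addr /= !addKn.
rewrite big_cat /=.
rewrite (eq_big_seq (fun x => \sum_(y <- s1 | (y < x)%R) `|(x - y)%R|.+1 +
    \sum_(y <- s2) `|(x - y)%R|.+1)%N); last first.
  move=> x x1; rewrite big_cat /=; congr (_ + _)%N.
  rewrite big_seq_cond [RHS]big_seq_cond; apply: eq_bigl => y.
  by case: (boolP (y \in s2)) => //= y2; rewrite lt.
rewrite big_split /=.
rewrite (eq_big_seq (fun x => \sum_(y <- s2 | (y < x)%R) `|(x - y)%R|.+1)
    (r := s2)); last first.
  move=> x x2; rewrite big_cat /= big_seq_cond big1 ?add0n // => y /andP[y1].
  by rewrite ltNge ltW // lt.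
by rewrite !expnD; ring.
Qed.

(** This is the passage to the dual bundle, which negates the degrees and reverses their order. *)
Lemma aut_card_rev_opp (s : seq int) : aut_card k (rev [seq - x | x <- s]) = aut_card k s.
Proof.
rewrite /aut_card !unip_dimE size_rev size_map; congr (_ * q ^ _)%N.
  pose g (A : 'M[k]_(size s)) := row_perm (perm rev_ord_inj) (col_perm (perm rev_ord_inj) A).
  have gK : involutive g by move=> A; apply/matrixP => i j; rewrite !mxE !permE !rev_ordK.
  have gu A : (g A \in unitmx) = (A \in unitmx).
    by rewrite /g row_permE col_permE !unitmx_mul !unitmx_perm andbT.
  have nthE (i : 'I_(size s)) :
      nth 0 (rev [seq - x | x <- s]) i = - nth 0 s (rev_ord i).
    by rewrite nth_rev ?size_map // (nth_map 0) //= -subSn // subSS leq_subr.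
  rewrite -(card_imset _ (inv_inj gK)); apply: eq_card => A; apply/imsetP/idP.
    move=> [B /levi_setP[Bu Bz] ->]; apply/levi_setP; rewrite gu; split=> // i j ne.
    by rewrite !mxE !permE Bz // !nthE !rev_ordK (inj_eq oppr_inj).
  move=> /levi_setP[Bu Bz]; exists (g A); last by rewrite gK.
  apply/levi_setP; rewrite gu; split=> // i j.
  by rewrite !nthE (inj_eq oppr_inj) => ne; rewrite !mxE !permE Bz.
have pr : perm_eq (rev [seq - x | x <- s]) [seq - x | x <- s] by rewrite perm_rev.
rewrite (perm_big _ pr) /= big_map.
under eq_bigr => x _ do rewrite (perm_big _ pr) /= big_map big_mkcond /=.
rewrite exchange_big /=; apply: eq_bigr => x _.
rewrite [RHS]big_mkcond; apply: eq_bigr => y _.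
by rewrite ltrN2 opprK addrC.
Qed.

Lemma aut_card_nseq n (c : int) : aut_card k (nseq n c) = gl_card n.
Proof.
rewrite /aut_card unip_dimE size_nseq card_levi_set_const; last first.
  by move=> i j id jd; rewrite !nth_nseq id jd.
rewrite big_seq big1 ?muln1 // => x /nseqP[-> _].
by rewrite big_seq_cond big1 // => y /andP[/nseqP[-> _]]; rewrite ltxx.
Qed.

Lemma aut_card_gt0 (s : seq int) : (0 < aut_card k s)%N.
Proof.
rewrite /aut_card muln_gt0 expn_gt0 (ltnW (card_gt1 k)) andbT.
apply/card_gt0P; exists 1%:M; apply/levi_setP; split; first exact: unitmx1.
by move=> i j ne; rewrite mxE; case: (eqVneq i j) ne => [->|//]; rewrite eqxx.
Qed.

End AutomorphismFormulas.

(** * Partitions padded with zeros *)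

Section Parts.

(** The partitions of B into at most m parts, padded with zeros to length m. No entry exceeds B,
    which makes the enumeration finite. *)
Definition parts (m B : nat) : seq (seq nat) :=
  [seq s <- [seq [seq val i | i <- val t] | t <- enum {: m.-tuple 'I_B.+1}] |
    sorted geq s && (sumn s == B)].

Lemma mem_parts m B s :
  (s \in parts m B) = [&& size s == m, sorted geq s & sumn s == B].
Proof.
rewrite mem_filter andbC; case: (sorted geq s) => /=; rewrite ?andbF //.
case: (sumn s =P B) => /= [sB|]; rewrite ?andbF // !andbT.
apply/mapP/eqP => [[t _ ->]|sm]; first by rewrite size_map size_tuple.
have sE : [seq val i | i <- [seq inord i : 'I_B.+1 | i <- s]] = s.
  rewrite -map_comp -[RHS]map_id; apply/eq_in_map => x xs /=.
  by rewrite inordK // ltnS -sB sumnE (big_rem x) //= leq_addr.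
have sz : size [seq inord i : 'I_B.+1 | i <- s] == m by rewrite size_map sm.
by exists (Tuple sz); rewrite ?mem_enum //= sE.
Qed.

Lemma uniq_parts m B : uniq (parts m B).
Proof.
apply: filter_uniq; rewrite map_inj_uniq ?enum_uniq // => t u.
by move/(inj_map val_inj)/val_inj.
Qed.

Lemma parts0 B : parts 0 B = if B == 0%N then [:: [::]] else [::].
Proof.
case: B => [|B]; last first.
  apply/nilP; rewrite /nilp; case E : (parts 0 B.+1) => [|s l] //=.
  have : s \in parts 0 B.+1 by rewrite E inE eqxx.
  by rewrite mem_parts; case: s {E} => // /and3P[_ _].
apply: perm_small_eq => //; apply: uniq_perm; rewrite ?uniq_parts // => s.
by rewrite mem_parts inE; case: s.
Qed.

Lemma parts_0r m : parts m 0 = [:: nseq m 0%N].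
Proof.
apply: perm_small_eq => //; apply: uniq_perm; rewrite ?uniq_parts // => s.
rewrite mem_parts inE; apply/and3P/eqP => [[/eqP sm _ s0]|->].
  apply: (@eq_from_nth _ 0%N); rewrite ?size_nseq // => i isz.
  rewrite nth_nseq -sm isz; apply/eqP; rewrite -leqn0.
  move: s0; rewrite sumnE (big_rem (nth 0%N s i)) ?mem_nth //=.
  by rewrite addn_eq0 => /andP[/eqP ->].
rewrite size_nseq sumn_nseq eqxx; split=> //.
by elim: m => // -[|m] //= ->; rewrite andbT.
Qed.

Lemma sorted_geq_zeros (s : seq nat) : sorted geq s ->
  s = [seq x <- s | x != 0%N] ++ nseq (count_mem 0%N s) 0%N.
Proof.
elim: s => [//|x s IH] ss; have {}IH := IH (path_sorted ss).
case: x ss => [|x] ss /=; last by rewrite add0n -IH.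
have s0 : all (pred1 0%N) s.
  have gtr : transitive geq by move=> x y z /[swap]; exact: leq_trans.
  by have := order_path_min gtr ss; apply: sub_all => x /=; rewrite leqn0.
have -> : [seq x <- s | x != 0%N] = [::].
  apply/eqP; rewrite -size_eq0 size_filter -leqn0 leqNgt -has_count.
  by apply/hasPn => x /(allP s0)/eqP ->.
have /eqP cE : count_mem 0%N s == size s by rewrite -all_count.
by rewrite cE; congr cons; apply: all_pred1P.
Qed.

(** Delete the z zeros and lower the other m - z entries by one, which lowers the sum by m - z. *)
Lemma parts_zeros (m B z : nat) : (z <= m)%N ->
  perm_eq [seq s <- parts m B | count_mem 0%N s == z]
    (if (m - z <= B)%N then
       [seq map succn s ++ nseq z 0%N | s <- parts (m - z)%N (B - (m - z))%N] else [::]).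
Proof.
move=> zm; have gtr : transitive geq by move=> x y w /[swap]; exact: leq_trans.
have sum_succ (s : seq nat) : sumn (map succn s) = (sumn s + size s)%N.
  by elim: s => //= x s ->; lia.
have pos (s : seq nat) : all (fun x => x != 0%N) s -> map succn (map predn s) = s.
  by move=> /allP H; rewrite -map_comp -[RHS]map_id; apply/eq_in_map => x /H; case: x.
apply: uniq_perm.
- exact: filter_uniq (uniq_parts _ _).
- case: ifP => // _; rewrite map_inj_uniq ?uniq_parts // => s1 s2 /eqP.
  have E : forall a b : seq nat, map succn a ++ nseq z 0%N = map succn b ++ nseq z 0%N -> a = b.
    move=> a b E; apply: (inj_map succn_inj); move/(congr1 (rev)): E.
    rewrite !rev_cat => /eqP; rewrite eqseq_cat // => /andP[_ /eqP].
    exact: (can_inj revK).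
  by move/eqP/E.
- move=> s; rewrite mem_filter mem_parts; apply/idP/idP.
    move=> /andP[/eqP cz /and3P[/eqP sm ss /eqP sB]].
    have E := sorted_geq_zeros ss; rewrite cz in E.
    pose p := [seq x <- s | x != 0%N]; rewrite -/p in E.
    have pz : size p = (m - z)%N by apply: (@addIn z); rewrite subnK // -sm [in RHS]E size_cat size_nseq.
    have pp : map succn (map predn p) = p by apply: pos; apply: filter_all.
    have psum : sumn p = B by rewrite -sB [in RHS]E sumn_cat sumn_nseq mul0n addn0.
    have := sum_succ (map predn p); rewrite pp size_map pz psum => sumB.
    rewrite ifT; last by rewrite sumB leq_addl.
    rewrite E; apply/mapP; exists (map predn p); last by rewrite pp.
    rewrite mem_parts size_map pz eqxx /=; apply/andP; split.
      rewrite sorted_map; apply: (@sub_sorted _ geq); first by move=> x y /=; lia.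
      by apply: sorted_filter => //.
    by apply/eqP; lia.
  case: ifP => // le /mapP[p]; rewrite mem_parts => /and3P[/eqP ps pp /eqP psum] ->.
  rewrite size_cat size_map size_nseq ps subnK // eqxx /=.
  rewrite sumn_cat sum_succ sumn_nseq psum ps mul0n addn0 subnK // eqxx andbT.
  rewrite count_cat count_nseq /= mul1n.
  rewrite (_ : count_mem 0%N (map succn p) = 0%N) ?eqxx /=; last first.
    by rewrite count_map; apply/eqP; rewrite -leqn0 leqNgt -has_count; apply/hasPn.
  elim: p pp {ps psum} => [|x [|y p] IH] //=.
  - by case: (z) => //= w _; elim: w.
  - by case: (z) => //= w _; elim: w => //= w ->; rewrite andbT.
  - by move=> /andP[xy /IH] /= ->; rewrite andbT ltnS.
Qed.

End Parts.

Section MassPolynomials.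
Variable K : fieldType.

Definition gl_poly (q : K) n : K := q ^+ 'C(n, 2) * \prod_(1 <= i < n.+1) (q ^+ i - 1).

(* [Y] stands for [q ^ B], where [B] is the degree. *)
Definition mass_poly (q : K) m (Y : K) : K :=
  (gl_poly q m)^-1 * \prod_(1 <= i < m) ((1 - (Y * q ^+ i)^-1) / (1 - (q ^+ i)^-1)).

Lemma gl_poly_expand (q : K) :
  ((gl_poly q 0 = 1)%R * (gl_poly q 1 = q - 1)%R *
   (gl_poly q 2 = q * (q - 1) * (q ^+ 2 - 1))%R *
   (gl_poly q 3 = q ^+ 3 * (q - 1) * (q ^+ 2 - 1) * (q ^+ 3 - 1))%R *
   (gl_poly q 4 = q ^+ 6 * (q - 1) * (q ^+ 2 - 1) * (q ^+ 3 - 1) * (q ^+ 4 - 1))%R *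
   (gl_poly q 5 = q ^+ 10 * (q - 1) * (q ^+ 2 - 1) * (q ^+ 3 - 1) * (q ^+ 4 - 1)
      * (q ^+ 5 - 1))%R)%type.
Proof.
rewrite /gl_poly /index_iota unlock /=.
by rewrite (_ : 'C(0, 2) = 0)%N // (_ : 'C(1, 2) = 0)%N // (_ : 'C(2, 2) = 1)%N //
  (_ : 'C(3, 2) = 3)%N // (_ : 'C(4, 2) = 6)%N // (_ : 'C(5, 2) = 10)%N // !expr0 !expr1 !mulr1 !mul1r !mulrA.
Qed.

Lemma mass_poly_expand (q Y : K) :
  ((mass_poly q 1 Y = (gl_poly q 1)^-1)%R *
   (mass_poly q 2 Y = (gl_poly q 2)^-1 * ((1 - (Y * q)^-1) / (1 - q^-1)))%R *
   (mass_poly q 3 Y = (gl_poly q 3)^-1 * ((1 - (Y * q)^-1) / (1 - q^-1)) *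
        ((1 - (Y * q ^+ 2)^-1) / (1 - (q ^+ 2)^-1)))%R *
   (mass_poly q 4 Y = (gl_poly q 4)^-1 * ((1 - (Y * q)^-1) / (1 - q^-1)) *
        ((1 - (Y * q ^+ 2)^-1) / (1 - (q ^+ 2)^-1)) *
        ((1 - (Y * q ^+ 3)^-1) / (1 - (q ^+ 3)^-1)))%R)%type.
Proof. by rewrite /mass_poly /index_iota unlock /= !expr1 !mulr1 !mulrA. Qed.

(** The recursion on the number z of zeros, with q^B replaced by a free variable. The case z = m is
    left out because a partition of a positive number has a nonzero entry. *)
Lemma mass_poly_rec m (q Y : K) : (0 < m <= 4)%N -> Y != 0 -> q != 0 ->
  (forall n, (0 < n)%N -> q ^+ n - 1 != 0) ->
  mass_poly q m Y = \sum_(z < m)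
    mass_poly q (m - z) (Y / q ^+ (m - z)) / gl_poly q z / (Y * q ^+ (m - z)) ^+ z.
Proof.
move=> m4 Y0 q0 qn; have q1 := qn 1%N isT; have q2 := qn 2%N isT.
have q3 := qn 3%N isT; have q4 := qn 4%N isT.
rewrite expr1 in q1.
case: m m4 => [|[|[|[|[|m]]]]] // _;
  rewrite !big_ord_recl big_ord0 /= /bump /= ?add1n ?subSS ?subn0
    ?mass_poly_expand ?gl_poly_expand ?expr1 ?expr0.
- by field; rewrite q1 oner_neq0.
- by field; rewrite q1 q2 Y0 q0 oner_neq0.
- by field; rewrite q1 q2 q3 Y0 q0 oner_neq0.
- by field; rewrite q1 q2 q3 q4 Y0 q0 oner_neq0.
Qed.

End MassPolynomials.

Section WeightedParts.
Variables (k : finFieldType) (K : numFieldType).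
Local Notation q := (#|k|%:R : K).

Definition nat_weight (s : seq nat) : K := (aut_card k (map Posz s))%:R^-1.

(* Total mass of the bundles of rank [m] and degree [B] all of whose splitting
   exponents are nonnegative. *)
Definition parts_mass (m B : nat) : K := \sum_(s <- parts m B) nat_weight s.

Lemma gl_cardE n : (gl_card k n)%:R = gl_poly q n.
Proof.
rewrite /gl_card natrM natrX natr_prod; congr (_ * _).
rewrite big_nat [RHS]big_nat; apply: eq_bigr => i /andP[i1 _].
by rewrite natrB ?natrX // expn_gt0 (ltnW (card_gt1 k)).
Qed.

Lemma qK_neq0 : q != 0.
Proof. by rewrite pnatr_eq0 -lt0n (ltnW (card_gt1 k)). Qed.

Lemma qKX_neq1 n : (0 < n)%N -> q ^+ n - 1 != 0.
Proof.
move=> n0; rewrite subr_eq0 -natrX (eqr_nat _ _ 1) neq_ltn.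
by rewrite -[X in _ || (X < _)%N](expn0 #|k|) ltn_exp2l ?n0 ?orbT // card_gt1.
Qed.

(** Hom from O to O(x + 1) has dimension x + 2, for each entry x of s and each of the z zeros. *)
Lemma nat_weight_zeros (s : seq nat) z :
  nat_weight (map succn s ++ nseq z 0%N) =
  nat_weight s / gl_poly q z / q ^+ (z * (sumn s + (size s).*2)).
Proof.
have gap : forall x y : int, x \in map Posz (map succn s) ->
    y \in map Posz (nseq z 0%N) -> y < x.
  by move=> x y /mapP[n /mapP[m _ ->] ->] /mapP[l /nseqP[-> _] ->].
rewrite /nat_weight map_cat aut_card_cat // map_nseq aut_card_nseq.
have -> : map Posz (map succn s) = [seq x + 1 | x <- map Posz s].
  by rewrite -!map_comp; apply: eq_map => x /=; lia.
rewrite aut_card_shift natrM natrM natrX gl_cardE !invfM; congr (_ * _ * (q ^+ _)^-1).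
rewrite big_map big_map.
have sE (x : nat) : (\sum_(y <- nseq z (0 : int)) `|(x%:Z + 1 - y)%R|.+1 = z * x.+2)%N.
  by rewrite big_nseq iter_addn_0 mulnC; congr (_ * _)%N; lia.
under eq_bigr do rewrite sE.
elim: s {gap} => [|x s IH]; first by rewrite big_nil muln0.
by rewrite big_cons IH /=; lia.
Qed.

(** The sequences are sorted by the number z of their zeros. *)
Lemma parts_mass_rec m B : parts_mass m B =
  \sum_(z < m.+1) (if (m - z <= B)%N then parts_mass (m - z) (B - (m - z)) else 0) /
     gl_poly q z / q ^+ (z * (B + (m - z))).
Proof.
transitivity (\sum_(z < m.+1) \sum_(s <- [seq s <- parts m B | count_mem 0%N s == z])
    nat_weight s).
  rewrite /parts_mass.
  under [RHS]eq_bigr do rewrite big_filter big_mkcond.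
  rewrite exchange_big /= big_seq [RHS]big_seq; apply: eq_bigr => s.
  rewrite mem_parts => /and3P[/eqP sm _ _].
  have cm : (count_mem 0%N s < m.+1)%N by rewrite ltnS -sm count_size.
  rewrite (bigD1 (Ordinal cm)) //= eqxx big1 ?addr0 // => z ne.
  by rewrite eq_sym; case: eqP => // E; rewrite -val_eqE /= E eqxx in ne.
apply: eq_bigr => z _; have zm : (z <= m)%N by rewrite -ltnS.
rewrite (perm_big _ (parts_zeros B zm)); case: ifP => le /=; last first.
  by rewrite big_nil !mul0r.
rewrite big_map /parts_mass !mulr_suml big_seq [RHS]big_seq; apply: eq_bigr => s.
rewrite mem_parts => /and3P[/eqP sm _ /eqP sB].
by rewrite nat_weight_zeros sm sB; congr (_ / _ / q ^+ (_ * _)); lia.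
Qed.

Lemma parts_mass_0r m : parts_mass m 0 = (gl_poly q m)^-1.
Proof.
by rewrite /parts_mass parts_0r big_seq1 /nat_weight map_nseq aut_card_nseq gl_cardE.
Qed.

Lemma parts_mass_0l B : parts_mass 0 B.+1 = 0.
Proof. by rewrite /parts_mass parts0 big_nil. Qed.

(** The factor of index m - B is 0. The closed formula is thus right also where the lowered degree B
    - m is negative, and the case distinction of the recursion disappears. *)
Lemma mass_poly_vanish m B : (0 < B < m)%N -> mass_poly q m (q ^+ B / q ^+ m) = 0.
Proof.
move=> /andP[B0 Bm]; rewrite /mass_poly.
have mB : (m - B)%N \in index_iota 1 m by rewrite mem_index_iota; lia.
rewrite (bigD1_seq (m - B)%N) ?iota_uniq //=.
have -> : q ^+ B / q ^+ m * q ^+ (m - B) = 1.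
  by rewrite mulrAC -exprD subnKC ?(ltnW Bm) // mulfV // expf_neq0 // qK_neq0.
by rewrite invr1 subrr !mul0r mulr0.
Qed.

Lemma mass_poly_1 m : mass_poly q m 1 = (gl_poly q m)^-1.
Proof.
rewrite /mass_poly big_nat big1 ?mulr1 // => i /andP[i1 _].
rewrite mul1r divff // subr_eq0 -(inj_eq invr_inj) invr1 invrK eq_sym -subr_eq0.
exact: qKX_neq1.
Qed.

Lemma q_expn_neq0 n : q ^+ n != 0.
Proof. by rewrite expf_neq0 // qK_neq0. Qed.

Lemma parts_mass_shift m n B : (0 < n)%N -> (0 < B)%N ->
  (forall m B', (B' < B)%N -> (0 < m <= 4)%N -> parts_mass m B' = mass_poly q m (q ^+ B')) ->
  (n <= m <= 4)%N ->
  (if (n <= B)%N then parts_mass n (B - n) else 0) = mass_poly q n (q ^+ B / q ^+ n).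
Proof.
move=> n0 B0 IH nm; case: leqP => nB; last by rewrite mass_poly_vanish ?B0.
rewrite IH; [|by lia|by lia]; congr mass_poly.
by rewrite expfB_cond ?qK_neq0 // (negbTE qK_neq0) /= ?add0n.
Qed.

Lemma parts_massE m B : (0 < m <= 4)%N -> parts_mass m B = mass_poly q m (q ^+ B).
Proof.
elim/ltn_ind: B m => B IH m m4; have [->|B0] := posnP B.
  by rewrite parts_mass_0r mass_poly_1.
rewrite parts_mass_rec big_ord_recr /= subnn /= subn0.
case: B IH B0 => // B IH B0; rewrite parts_mass_0l !mul0r addr0.
rewrite mass_poly_rec ?q_expn_neq0 ?qK_neq0 //; last exact: qKX_neq1.
apply: eq_bigr => z _; rewrite (@parts_mass_shift m) //; first last.
- by have := ltn_ord z; lia.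
- by move=> *; apply: IH.
- by rewrite subn_gt0.
by congr (_ / _ / _); rewrite -exprD -exprM mulnC.
Qed.

Lemma parts_mass_truncated n B : (0 < n <= 4)%N -> (0 < B)%N ->
  (if (n <= B)%N then parts_mass n (B - n) else 0) = mass_poly q n (q ^+ B / q ^+ n).
Proof.
move=> /andP[n0 n4] B0; apply: (@parts_mass_shift n) => //; rewrite ?leqnn //.
by move=> m B' _; apply: parts_massE.
Qed.

End WeightedParts.

(** * Splitting types cut into positive and nonpositive terms *)

Section SplittingTypes.

(* Representatives of the splitting types modulo a common shift. *)
Definition normal_type (d : nat) (s : seq int) : bool :=
  [&& size s == d, sorted >=%R s & 0 <= \sum_(x <- s) x < d%:Z].

Definition pos_part (x : int) : nat := if 0 < x then `|x|%N else 0%N.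

Definition level (s : seq int) : nat := \sum_(x <- s) pos_part x.

Definition num_pos (s : seq int) : nat := count (fun x => 0 < x) s.

(** Entries lie between -N and N: the positive ones add up to N and, the total being nonnegative,
    the negative ones add up to at least -N. *)
Definition level_types (d N : nat) : seq (seq int) :=
  [seq s <- [seq [seq (val i)%:Z - N%:Z | i <- val t] | t <- enum {: d.-tuple 'I_(N + N).+1}] |
    normal_type d s && (level s == N)].

Lemma level_sum (s : seq int) :
  (level s)%:Z - \sum_(x <- s) x = \sum_(x <- s) (pos_part (- x))%:Z.
Proof.
rewrite /level; elim: s => [|x s IH]; first by rewrite !big_nil.
have key : (pos_part x)%:Z - x = (pos_part (- x))%:Z.
  by rewrite /pos_part; case: ifP; case: ifP; lia.
by rewrite !big_cons PoszD opprD addrACA key IH.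
Qed.

Lemma mem_level_types d N s :
  (s \in level_types d N) = normal_type d s && (level s == N).
Proof.
rewrite mem_filter andbC.
case: (boolP (normal_type d s)) => [/and3P[/eqP sd ss /andP[s0 sd']]|]; rewrite ?andbF //=.
case: (level s =P N) => [sN|]; rewrite ?andbF // andbT.
have bound x : x \in s -> - N%:Z <= x <= N%:Z.
  move=> xs.
  have px : (pos_part x <= N)%N.
    by rewrite -sN /level (big_rem x) //= leq_addr.
  have nx : (pos_part (- x))%:Z <= N%:Z.
    have := level_sum s; rewrite sN [X in _ = X](big_rem x) //= => E.
    have : 0 <= \sum_(y <- rem x s) (pos_part (- y))%:Z by apply: sumr_ge0.
    by move: s0 E; set S := \sum_(y <- s) y; set S' := \sum_(y <- rem x s) _; lia.
  by move: px nx; rewrite /pos_part; case: ifP; case: ifP; lia.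
apply/mapP.
have sE : [seq (val i)%:Z - N%:Z | i <- [seq inord `|(x + N%:Z)%R|%N : 'I_(N + N).+1 | x <- s]] = s.
  rewrite -map_comp -[RHS]map_id; apply/eq_in_map => x /bound xb /=.
  by rewrite inordK; lia.
have sz : size [seq inord `|(x + N%:Z)%R|%N : 'I_(N + N).+1 | x <- s] == d by rewrite size_map sd.
by exists (Tuple sz); rewrite ?mem_enum //= sE.
Qed.

Lemma uniq_level_types d N : uniq (level_types d N).
Proof.
apply: filter_uniq; rewrite map_inj_uniq ?enum_uniq // => t u.
move/inj_map => H; apply/val_inj/H => i j /addIr [] E.
exact: val_inj.
Qed.

(** The positive terms are recorded as [p] after lowering them by one, the nonpositive ones as [m]
    after changing signs and order, so that both become weakly decreasing sequences of natural
    numbers. *)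
Definition glue (p m : seq nat) : seq int :=
  map Posz (map succn p) ++ rev [seq - x | x <- map Posz m].

Lemma glue_inj p m p' m' : size p = size p' -> glue p m = glue p' m' -> p = p' /\ m = m'.
Proof.
move=> pp /eqP; rewrite eqseq_cat ?size_map // => /andP[/eqP E1 /eqP E2]; split.
  by apply: (inj_map succn_inj); apply: (inj_map (f := Posz)) E1 => x y [].
apply: (inj_map (f := Posz)) => [x y []//|].
apply: (inj_map (@oppr_inj int)); exact: (can_inj revK).
Qed.

Lemma sum_opp_Posz (m : seq nat) : \sum_(x <- [seq - x | x <- map Posz m]) x = - (sumn m)%:Z.
Proof.
elim: m => [|x m IH]; first by rewrite big_nil.
by rewrite big_cons IH /=; lia.
Qed.

Lemma sum_Posz (m : seq nat) : \sum_(x <- map Posz m) x = (sumn m)%:Z.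
Proof. by elim: m => [|x m IH]; rewrite ?big_nil // big_cons IH /=; lia. Qed.

Lemma sumn_succ (s : seq nat) : sumn (map succn s) = (sumn s + size s)%N.
Proof. by elim: s => //= x s ->; lia. Qed.

Lemma glue_sum p m :
  \sum_(x <- glue p m) x = (sumn p + size p)%:Z - (sumn m)%:Z.
Proof.
rewrite big_cat /= (perm_big _ (permEl (perm_rev _))) /=.
by rewrite sum_opp_Posz sum_Posz sumn_succ.
Qed.

Lemma glue_level p m : level (glue p m) = (sumn p + size p)%N.
Proof.
rewrite /level big_cat /= (perm_big _ (permEl (perm_rev _))) /=.
rewrite [X in (_ + X)%N]big1_seq ?addn0; last first.
  by move=> x /andP[_ /mapP[y /mapP[z _ ->] ->]]; rewrite /pos_part; case: ifP; lia.
by elim: p => [|x p IH]; rewrite ?big_nil //= big_cons IH /pos_part /=; lia.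
Qed.

Lemma glue_num_pos p m : num_pos (glue p m) = size p.
Proof.
rewrite /num_pos count_cat count_rev.
rewrite (_ : count _ (map Posz _) = size p); last first.
  by rewrite -map_comp count_map (eq_count (a2 := predT)) ?count_predT.
rewrite (_ : count _ _ = 0%N) ?addn0 //; apply/eqP; rewrite -leqn0 leqNgt -has_count.
by apply/hasPn => x /mapP[y /mapP[z _ ->] ->]; rewrite -leNgt; lia.
Qed.

Lemma glue_sorted p m : sorted geq p -> sorted geq m -> sorted >=%R (glue p m).
Proof.
move=> ps ms; rewrite /glue.
have s2 : sorted >=%R (rev [seq - x | x <- map Posz m]).
  rewrite rev_sorted !sorted_map; apply: sub_sorted ms => x y /=; lia.
have : sorted >=%R (map Posz (map succn p)).
  by rewrite !sorted_map; apply: sub_sorted ps => x y /=; lia.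
have np x : x \in rev [seq - x | x <- map Posz m] -> x <= 0.
  by rewrite mem_rev => /mapP[y /mapP[z _ ->] ->]; lia.
elim: p {ps} => [//|x [|y p] IH] /=.
  by move=> _; case: (rev _) s2 np => //= y r -> H; rewrite andbT;
    apply: (le_trans (H y _)); rewrite ?inE ?eqxx.
by move=> /andP[-> /IH].
Qed.

Lemma unglue d s : normal_type d s -> exists p m,
  [/\ s = glue p m, sorted geq p & sorted geq m].
Proof.
move=> /and3P[_ ss _].
have tr : transitive (>=%R : rel int) by move=> x y z /[swap]; exact: le_trans.
have E : s = [seq x <- s | 0 < x] ++ [seq x <- s | ~~ (0 < x)].
  elim: s ss => [//|x s IH] ss; have {}IH := IH (path_sorted ss).
  rewrite /=; case: ifP => x0 /=; first by rewrite -IH.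
  have all0 : all (fun y => ~~ (0 < y)) s.
    have := order_path_min tr ss; apply: sub_all => y /=.
    by move=> yx; rewrite -leNgt (le_trans yx) // leNgt x0.
  rewrite (_ : [seq x <- s | 0 < x] = [::]) /=; last first.
    by apply/eqP; rewrite -size_eq0 size_filter -leqn0 leqNgt -has_count -all_predC.
  by congr cons; apply/esym/all_filterP.
exists [seq `|x|.-1%N | x <- s & 0 < x], [seq `|x|%N | x <- rev [seq x <- s | ~~ (0 < x)]].
split.
- rewrite /glue {1}E; congr (_ ++ _).
    rewrite -!map_comp -[LHS]map_id; apply/eq_in_map => x.
    by rewrite mem_filter => /andP[x0 _] /=; lia.
  rewrite -!map_comp map_rev revK -[LHS]map_id; apply/eq_in_map => x.
  by rewrite mem_filter => /andP[x0 _] /=; lia.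
- rewrite sorted_map.
  have := sorted_filter tr (fun x => 0 < x) ss.
  apply: (@sub_in_sorted _ [pred x : int | 0 < x]); last exact: filter_all.
  by move=> x y /=; rewrite !inE; lia.
- rewrite sorted_map rev_sorted.
  have := sorted_filter tr (fun x => ~~ (0 < x)) ss.
  apply: (@sub_in_sorted _ [pred x : int | ~~ (0 < x)]); last exact: filter_all.
  by move=> x y /=; rewrite !inE; lia.
Qed.

(** The n positive terms add up to N, so p sums to N - n; the other terms add up to r - N, so m sums
    to N - r. If n > N or r > N, nothing is left. *)
Lemma level_types_split (d N r n : nat) : (r < d)%N -> (n <= d)%N ->
  perm_eq [seq s <- level_types d N | (\sum_(x <- s) x == r%:Z) && (num_pos s == n)]
    (if (n <= N)%N && (r <= N)%N then
       [seq glue p m | p <- parts n (N - n)%N, m <- parts (d - n)%N (N - r)%N] else [::]).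
Proof.
move=> rd nd; apply: uniq_perm.
- exact: filter_uniq (uniq_level_types _ _).
- case: ifP => // _; apply: allpairs_uniq; rewrite ?uniq_parts //.
  move=> [p m] [p' m'] /allpairsP[[a b] [/= ap _ [-> ->]]].
  move=> /allpairsP[[a' b'] [/= ap' _ [-> ->]]] /glue_inj[|-> -> //].
  by move: ap ap'; rewrite !mem_parts => /and3P[/eqP-> _ _] /and3P[/eqP-> _ _].
- move=> s; rewrite mem_filter mem_level_types; apply/idP/idP.
    move=> /andP[/andP[/eqP sr /eqP sn] /andP[sN /eqP sl]].
    have [p [m [E ps ms]]] := unglue sN.
    move: sN sr sn sl; rewrite E glue_sum glue_num_pos glue_level => sN sr sn sl.
    have sz : (size p + size m = d)%N.
      by case/and3P: sN => /eqP <- _ _; rewrite size_cat size_rev !size_map.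
    rewrite ifT; last by apply/andP; lia.
    have [h1 h2 h3 h4] : [/\ size p = n, sumn p = (N - n)%N, size m = (d - n)%N &
        sumn m = (N - r)%N] by split; lia.
    by apply: allpairs_f; rewrite mem_parts ?h1 ?h2 ?h3 ?h4 ?ps ?ms !eqxx.
  case: ifP => // /andP[nN rN] /allpairsP[[p m] [/=]].
  rewrite !mem_parts => /and3P[/eqP pz ps /eqP psum] /and3P[/eqP mz ms /eqP msum] ->.
  rewrite glue_num_pos glue_level glue_sum /normal_type glue_sorted // glue_sum.
  rewrite size_cat size_rev !size_map pz mz psum msum.
  by do ?[apply/andP; split]; rewrite ?andbT; lia.
Qed.

Lemma glue_gap p m (x y : int) :
  x \in map Posz (map succn p) -> y \in rev [seq - x | x <- map Posz m] -> y < x.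
Proof.
by move=> /mapP[a /mapP[b _ ->] ->]; rewrite mem_rev => /mapP[c /mapP[e _ ->] ->]; lia.
Qed.

Section Weights.
Variables (k : finFieldType) (K : numFieldType).
Local Notation q := (#|k|%:R : K).

Definition type_weight (s : seq int) : K := (aut_card k s)%:R^-1.

Lemma glue_weight p m : type_weight (glue p m) =
  nat_weight k K p * nat_weight k K m /
  q ^+ (size m * (sumn p + size p) + size p * sumn m + size p * size m).
Proof.
rewrite /type_weight /glue aut_card_cat; last exact: glue_gap.
rewrite aut_card_rev_opp.
have -> : map Posz (map succn p) = [seq x + 1 | x <- map Posz p].
  by rewrite -!map_comp; apply: eq_map => x /=; lia.
rewrite aut_card_shift natrM natrM natrX !invfM; congr (_ * _ * (q ^+ _)^-1).
rewrite !big_map.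
have sE (x : nat) :
    (\sum_(y <- rev [seq - x | x <- map Posz m]) `|(x%:Z + 1 - y)%R|.+1 =
     size m * x.+2 + sumn m)%N.
  rewrite (perm_big _ (permEl (perm_rev _))) /= !big_map.
  by elim: m => [|y m IH]; rewrite ?big_nil // big_cons IH /=; lia.
under eq_bigr do rewrite sE.
by elim: p => [|x p IH]; rewrite ?big_nil ?big_cons ?IH /=; lia.
Qed.

(** The exponent of q is the sum of x - y + 1 over the n positive terms x and the d - n others y:
    the x add up to N and the -y to N - r. *)
Definition level_mass (d N r n : nat) : K :=
  (if (n <= N)%N then parts_mass k K n (N - n) else 0) *
  (if (r <= N)%N then parts_mass k K (d - n) (N - r) else 0) /
  q ^+ ((d - n) * N + n * (N - r) + n * (d - n)).

(* A splitting type is cut into its [n] positive parts and its [d - n] others;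
   the factor [q ^ ...] counts the homomorphisms between the two halves. *)
Lemma sum_level_types (d N : nat) (g : nat -> nat -> K) : (0 < d)%N ->
  \sum_(s <- level_types d N)
     type_weight s * g `|(\sum_(x <- s) x)%R|%N (num_pos s) =
  \sum_(r < d) \sum_(n < d.+1) level_mass d N r n * g r n.
Proof.
move=> d0.
transitivity (\sum_(r < d) \sum_(n < d.+1)
    \sum_(s <- [seq s <- level_types d N | (\sum_(x <- s) x == r%:Z) && (num_pos s == n)])
       type_weight s * g r n).
  under [RHS]eq_bigr do under eq_bigr do rewrite big_filter big_mkcond.
  under [RHS]eq_bigr do rewrite exchange_big.
  rewrite exchange_big big_seq [RHS]big_seq; apply: eq_bigr => s.
  rewrite mem_level_types => /andP[/and3P[/eqP sd _ /andP[s0 s1]] _] /=.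
  have [r0 rE rd] : exists2 r0 : nat, \sum_(x <- s) x = r0%:Z & (r0 < d)%N.
    move: s0 s1; case: (\sum_(x <- s) x) => // r0 _ r0d.
    by exists r0; move: r0d; rewrite ?ltz_nat.
  have nd : (num_pos s < d.+1)%N by rewrite ltnS -sd; apply: count_size.
  rewrite rE (bigD1 (Ordinal rd)) //= (bigD1 (Ordinal nd)) //= !eqxx /=.
  rewrite big1 ?addr0 => [|n ne]; last first.
    case: eqP => // E.
    by move: ne; rewrite -val_eqE /= E eqxx.
  rewrite big1 ?addr0 // => r ne; rewrite big1 // => n _.
  case: eqP => // -[E]; move: ne; rewrite -val_eqE /= E eqxx //.
apply: eq_bigr => r _; apply: eq_bigr => n _.
have nd : (n <= d)%N by rewrite -ltnS.
rewrite (perm_big _ (level_types_split N (ltn_ord r) nd)) /=.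
rewrite /level_mass; case: (leqP n N) => nN /=; last by rewrite big_nil !mul0r.
case: (leqP r N) => rN /=; last by rewrite big_nil mulr0 !mul0r.
rewrite big_allpairs_dep /= /parts_mass mulr_suml mulr_suml mulr_suml.
rewrite big_seq [RHS]big_seq; apply: eq_bigr => p; rewrite mem_parts => /and3P[/eqP pz _ /eqP ps].
rewrite mulr_sumr mulr_suml mulr_suml.
rewrite big_seq [RHS]big_seq; apply: eq_bigr => m; rewrite mem_parts => /and3P[/eqP mz _ /eqP ms].
by rewrite glue_weight pz ps mz ms subnK.
Qed.

End Weights.

End SplittingTypes.

(** * Power series and meromorphic continuation *)

Section ComplexSeries.
Variable R : realType.
Local Notation C := R[i].
Local Notation nrm := (@normc R).
Implicit Types (a b : nat -> C) (l w z : C).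

Lemma normE z : `|z| = (nrm z)%:C%C.
Proof. by []. Qed.

Lemma nrm0 : nrm 0 = 0.
Proof. exact: normc0. Qed.

Lemma nrm1 : nrm 1 = 1.
Proof. exact: normc1. Qed.

Lemma nrm_ge0 z : 0 <= nrm z.
Proof. by rewrite -ler0c -normE. Qed.

Lemma nrm_eq0 z : (nrm z == 0) = (z == 0).
Proof. by apply/eqP/eqP => [/eq0_normc//|->]; apply: nrm0. Qed.

Lemma nrm_gt0 z : (0 < nrm z) = (z != 0).
Proof. by rewrite lt_neqAle nrm_ge0 andbT eq_sym nrm_eq0. Qed.

Lemma nrmX z n : nrm (z ^+ n) = nrm z ^+ n.
Proof. by elim: n => [|n IH]; rewrite ?nrm1 // !exprS normcM IH. Qed.

Lemma nrm_sum I (r : seq I) (P : pred I) (E : I -> C) :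
  nrm (\sum_(i <- r | P i) E i) <= \sum_(i <- r | P i) nrm (E i).
Proof.
elim/big_rec2: _ => [|i x y _ IH]; first by rewrite nrm0.
by apply: le_trans (le_normcD _ _) _; rewrite lerD2l.
Qed.

Lemma nrm_real (x : R) : nrm x%:C%C = `|x|.
Proof. by rewrite /= expr0n /= addr0 sqrtr_sqr. Qed.

Lemma nrm_Re z : `|complex.Re z| <= nrm z.
Proof.
case: z => x y /=; rewrite -sqrtr_sqr ler_wsqrtr // lerDl; exact: sqr_ge0.
Qed.

Lemma nrm_Im z : `|complex.Im z| <= nrm z.
Proof.
case: z => x y /=; rewrite -sqrtr_sqr ler_wsqrtr // lerDr; exact: sqr_ge0.
Qed.

Lemma nrm_le z : nrm z <= `|complex.Re z| + `|complex.Im z|.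
Proof.
have ni : nrm 'i%C = 1 by rewrite /= expr0n /= add0r expr1n sqrtr1.
rewrite {1}[z]complexE; apply: le_trans (le_normcD _ _) _.
by rewrite nrm_real normcM ni mul1r nrm_real.
Qed.

Definition csum a l : Prop := (fun n => \sum_(i < n) a i : C^o) @ \oo --> (l : C^o).

Lemma cvg_cplxP (f : nat -> C) l : (f : nat -> C^o) @ \oo --> (l : C^o) <->
  forall e : R, 0 < e -> exists N, forall n, (N <= n)%N -> nrm (l - f n) < e.
Proof.
split=> [/cvgrPdist_lt H e e0|H].
  have [|N _ HN] := H e%:C%C; first by rewrite ltcR.
  exists N => n Nn; have := HN n Nn => /=.
  by rewrite normE ltcR.
apply/cvgrPdist_lt => e; rewrite ltcE /= => /andP[/eqP e1 e0].
have [N HN] := H _ e0; exists N => // n /= Nn.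
by have := HN n Nn; rewrite normE ltcE /= e1 eqxx.
Qed.

Lemma cvg_cplx0 (f : nat -> C) (g : nat -> R) : g @ \oo --> (0 : R) ->
  (forall n, nrm (f n) <= g n) -> (f : nat -> C^o) @ \oo --> (0 : C^o).
Proof.
move=> /cvgrPdist_lt g0 fg; apply/cvg_cplxP => e e0.
have [N _ HN] := g0 e e0; exists N => n Nn.
rewrite sub0r normcN; apply: le_lt_trans (fg n) _.
by have := HN n Nn => /=; rewrite sub0r normrN; apply: le_lt_trans (ler_norm _).
Qed.

Lemma cvg_pseriesP (c : nat -> C) w l :
  cvg_pseries c w l <-> csum (fun n => c n * w ^+ n) l.
Proof.
rewrite /cvg_pseries /csum; suff -> : series (fun n => c n * w ^+ n : C^o) =
  (fun n => \sum_(i < n) c i * w ^+ i) by [].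
by apply/funext => n; rewrite /series /= big_mkord.
Qed.

Lemma csum_unique a l l' : csum a l -> csum a l' -> l = l'.
Proof. by move=> H H'; exact: (cvg_unique (@norm_hausdorff _ C^o) H H'). Qed.

Lemma csumD a b l l' : csum a l -> csum b l' -> csum (fun n => a n + b n) (l + l').
Proof.
move=> H H'; rewrite /csum; under eq_fun do rewrite big_split.
exact: (cvgD H H').
Qed.

Lemma csumM a l z : csum a l -> csum (fun n => z * a n) (z * l).
Proof.
move=> H; rewrite /csum; under eq_fun do rewrite -mulr_sumr.
by apply: cvgM H; apply: cvg_cst.
Qed.

Lemma eq_csum a b l : (forall n, a n = b n) -> csum a l -> csum b l.
Proof. by move=> /funext ->. Qed.

Lemma csum_shift a l m : csum a l ->
  csum (fun n => if (n < m)%N then 0 else a (n - m)%N) l.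
Proof.
move=> H; rewrite /csum -(cvg_shiftn m).
suff -> : [sequence \sum_(i < n + m) (if (i < m)%N then 0 else a (i - m)%N)]_n =
   (fun n => \sum_(i < n) a i) by [].
apply/funext => n /=; rewrite addnC big_split_ord /=.
rewrite big1 ?add0r => [|i _]; last by rewrite ltn_ord.
by apply: eq_bigr => i _; rewrite ltnNge leq_addr /= addKn.
Qed.

Lemma csum_delta z : csum (fun n => if n == 0%N then z else 0) z.
Proof.
rewrite /csum -(cvg_shiftn 1).
suff -> : [sequence \sum_(i < n + 1) (if (i : nat) == 0%N then z else 0)]_n = (fun _ => z).
  exact: cvg_cst.
by apply/funext => n /=; rewrite addn1 big_ord_recl /= big1 ?addr0.
Qed.

Lemma csum_ReIm a (x y : R) :
  series (fun n => complex.Re (a n)) @ \oo --> x ->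
  series (fun n => complex.Im (a n)) @ \oo --> y -> csum a (x +i* y)%C.
Proof.
move=> /cvgrPdist_lt Hx /cvgrPdist_lt Hy; apply/cvg_cplxP => e e0.
have e2 : 0 < e / 2 by rewrite divr_gt0.
have [N _ HN] := Hx _ e2; have [N' _ HN'] := Hy _ e2.
exists (maxn N N') => n; rewrite geq_max => /andP[/HN Nn /HN' Nn'].
apply: le_lt_trans (nrm_le _) _; rewrite [ltRHS]splitr.
move: Nn Nn'; rewrite /series /= !big_mkord => Nn Nn'.
have ReE : complex.Re (\sum_(i < n) a i) = \sum_(i < n) complex.Re (a i).
  by apply: (big_morph (@complex.Re R)) => // -[? ?] [? ?].
have ImE : complex.Im (\sum_(i < n) a i) = \sum_(i < n) complex.Im (a i).
  by apply: (big_morph (@complex.Im R)) => // -[? ?] [? ?].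
rewrite -ReE in Nn; rewrite -ImE in Nn'.
by apply: ltrD; [move: Nn|move: Nn']; case: (\sum_(i < n) a i).
Qed.

Lemma real_dominated_cvg (u : nat -> R) (A r : R) : 0 <= r < 1 ->
  (forall n, `|u n| <= A * r ^+ n) -> cvgn (series u).
Proof.
move=> /andP[r0 r1] H; apply: normed_cvg.
apply: (@series_le_cvg _ _ (geometric A r)) => //.
- by move=> n /=; apply: normr_ge0.
- by move=> n /=; apply: le_trans (H n).
- by apply: is_cvg_geometric_series; rewrite ger0_norm.
Qed.

Lemma csum_dominated a (A r : R) : 0 <= r < 1 ->
  (forall n, nrm (a n) <= A * r ^+ n) -> exists l, csum a l.
Proof.
move=> r01 H.
have /cvg_ex[x Hx] := real_dominated_cvg r01 (fun n => le_trans (nrm_Re (a n)) (H n)).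
have /cvg_ex[y Hy] := real_dominated_cvg r01 (fun n => le_trans (nrm_Im (a n)) (H n)).
by exists (x +i* y)%C; apply: csum_ReIm.
Qed.

Lemma triangle_sum a b n :
  \sum_(m < n) \sum_(i < m.+1) a i * b (m - i)%N =
  \sum_(i < n) a i * \sum_(j < n - i) b j.
Proof.
elim: n => [|n IH]; first by rewrite !big_ord0.
rewrite big_ord_recr /= IH [RHS]big_ord_recr /= [X in _ + X = _]big_ord_recr /=.
rewrite addrA -big_split /= subSnn big_ord1 subnn; congr (_ + _).
apply: eq_bigr => i _; rewrite subSn ?(ltnW (ltn_ord _)) // big_ord_recr /= mulrDr.
by [].
Qed.

(** The partial sum of the product differs from the product of the partial sums by the pairs with i
    + j >= n. For each i they contribute at most A B i r^n, and there are n values of i; bounding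
    each of these two factors by 2^n gives A B (4 r)^n. *)
Lemma cauchy_product a b l l' (A B r : R) : 0 <= r -> 4 * r < 1 ->
  (forall n, nrm (a n) <= A * r ^+ n) -> (forall n, nrm (b n) <= B * r ^+ n) ->
  csum a l -> csum b l' ->
  csum (fun n => \sum_(i < n.+1) a i * b (n - i)%N) (l * l').
Proof.
move=> r0 r4 aA bB al bl; rewrite /csum.
have A0 : 0 <= A by have := aA 0%N; rewrite expr0 mulr1; apply: le_trans (nrm_ge0 _).
have B0 : 0 <= B by have := bB 0%N; rewrite expr0 mulr1; apply: le_trans (nrm_ge0 _).
have -> : (fun n => \sum_(m < n) \sum_(i < m.+1) a i * b (m - i)%N) =
   (fun n => (\sum_(i < n) a i) * (\sum_(i < n) b i) -
     \sum_(i < n) a i * \sum_(n - i <= j < n) b j).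
  apply/funext => n; rewrite triangle_sum mulr_suml -sumrB; apply: eq_bigr => i _.
  rewrite -mulrBr; congr (_ * _); rewrite -(big_mkord xpredT) -(big_mkord xpredT).
  by rewrite [X in _ = X - _](@big_cat_nat _ _ _ (n - i)%N) ?leq_subr //= addrK.
rewrite -[l * l']subr0; apply: cvgB; first exact: (cvgM al bl).
apply: (@cvg_cplx0 _ (fun n => A * B * (4 * r) ^+ n)).
  rewrite -[0](mulr0 (A * B)); apply: cvgM; first exact: cvg_cst.
  by apply: cvg_expr; rewrite ger0_norm // mulr_ge0.
move=> n; apply: le_trans (nrm_sum _ _ _) _.
have r1 : r <= 1 by lra.
have step (i : 'I_n) : nrm (a i * \sum_(n - i <= j < n) b j) <= A * B * (2 * r) ^+ n.
  rewrite normcM; apply: le_trans (ler_pM (nrm_ge0 _) (nrm_ge0 _) (aA i) (nrm_sum _ _ _)) _.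
  have : \sum_(n - i <= j < n) nrm (b j) <= \sum_(n - i <= j < n) B * r ^+ (n - i).
    rewrite big_nat [leRHS]big_nat; apply: ler_sum => j /andP[ij _].
    by apply: le_trans (bB j) _; rewrite ler_wpM2l // ler_wiXn2l.
  rewrite sumr_const_nat subKn ?(ltnW (ltn_ord i)) // => H.
  apply: le_trans (ler_wpM2l _ H) _; first by rewrite mulr_ge0 ?exprn_ge0.
  have -> : A * r ^+ i * (B * r ^+ (n - i) *+ i) = A * B * (i%:R * r ^+ n).
    have -> : r ^+ n = r ^+ i * r ^+ (n - i) by rewrite -exprD subnKC ?(ltnW (ltn_ord i)).
    by rewrite -mulr_natr; ring.
  rewrite ler_wpM2l ?mulr_ge0 // exprMn ler_wpM2r ?exprn_ge0 // -natrX ler_nat.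
  by apply: leq_trans (ltnW (ltn_ord i)) _; apply: ltnW; apply: ltn_expl.
apply: le_trans (ler_sum _ (fun i _ => step i)) _.
rewrite sumr_const card_ord (_ : 4 * r = 2 * r * 2); last by ring.
apply: (@le_trans _ _ (A * B * (2 * r) ^+ n * n%:R)); first by rewrite mulr_natr.
rewrite [(2 * r * 2) ^+ n]exprMn mulrA ler_wpM2l //.
  by rewrite !mulr_ge0 ?exprn_ge0 ?mulr_ge0.
by rewrite -natrX ler_nat; apply: ltnW; apply: ltn_expl.
Qed.

End ComplexSeries.

Arguments csumM {R a l} z _ _ _.
Arguments csum_delta {R} z _ _.
Arguments csum_shift {R a l} m _ _ _.

Section Germs.
Variable R : realType.
Local Notation C := R[i].
Local Notation nrm := (@normc R).
Local Notation coef := (@fps_coef C).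
Implicit Types (f g : C -> C) (phi psi : fps C) (w z : C) (M : R).

(** With exponent n + 1 and M >= 1, a single constant bounds all coefficients, the constant term
    included. On the disc of radius 1 / (8 M) the ratio M |w| is below 1/8, which fits the
    hypothesis 4 r < 1 of [cauchy_product]. *)
Definition geo_bound phi M : Prop := 1 <= M /\ forall n, nrm (coef phi n) <= M ^+ n.+1.

(* Away from [0], [g] is the sum of the power series [phi] on the disc of
   radius [1 / (8 M)]; the value [g 0] is irrelevant. *)
Definition germ_on phi g M : Prop := geo_bound phi M /\
  forall w, w != 0 -> nrm w < (8 * M)^-1 -> csum (fun n => coef phi n * w ^+ n) (g w).

Definition germ phi g : Prop := exists M, germ_on phi g M.

(** Neighbourhoods are punctured because the value at a singular point is arbitrary. *)
Definition near0 (P : C -> Prop) : Prop :=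
  exists2 r : R, 0 < r & forall w, w != 0 -> nrm w < r -> P w.

Lemma near0_and (P Q : C -> Prop) : near0 P -> near0 Q -> near0 (fun w => P w /\ Q w).
Proof.
move=> [r r0 H] [s s0 H']; exists (Num.min r s); first by rewrite lt_min r0.
by move=> w w0; rewrite lt_min => /andP[wr ws]; split; [exact: H|exact: H'].
Qed.

Lemma near0_imp (P Q : C -> Prop) : (forall w, w != 0 -> P w -> Q w) -> near0 P -> near0 Q.
Proof. by move=> PQ [r r0 H]; exists r => // w w0 wr; apply: PQ (H w w0 wr). Qed.

Lemma near0_ex (P : C -> Prop) (r : R) : 0 < r -> near0 P -> exists w, [/\ w != 0, nrm w < r & P w].
Proof.
move=> r0 [s s0 H]; pose m := Num.min r s / 2.
have m0 : 0 < m by rewrite divr_gt0 // lt_min r0.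
have ms : m < Num.min r s by rewrite ltr_pdivrMr // ltr_pMr ?ltr1n // lt_min r0.
exists m%:C%C; have nm : nrm m%:C%C = m by rewrite nrm_real gtr0_norm.
have w0 : m%:C%C != 0 :> C by rewrite -nrm_gt0 nm.
by split=> //; [|apply: H => //]; rewrite nm; apply: lt_le_trans ms _;
  rewrite ge_min lexx ?orbT.
Qed.

Lemma geo_bound_le phi M M' : M <= M' -> geo_bound phi M -> geo_bound phi M'.
Proof.
move=> MM [M1 H]; split; first exact: le_trans M1 MM.
by move=> n; apply: le_trans (H n) _; rewrite lerXn2r // nnegrE; lra.
Qed.

Lemma radius_gt0 M : 1 <= M -> 0 < (8 * M)^-1.
Proof. by move=> M1; rewrite invr_gt0 mulr_gt0 //; lra. Qed.

Lemma germ_on_le phi g M M' : M <= M' -> germ_on phi g M -> germ_on phi g M'.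
Proof.
move=> MM [b H]; split; first exact: geo_bound_le b.
have [M1 _] := b; move=> w w0 wr; apply: H => //; apply: lt_le_trans wr _.
by rewrite lef_pV2 ?posrE ?mulr_gt0 ?ler_pM2l //; lra.
Qed.

(** Enlarging M shrinks the disc, here into the one where f and g agree. *)
Lemma germ_near phi f g : near0 (fun w => f w = g w) -> germ phi f -> germ phi g.
Proof.
move=> [r r0 fg] [M [b H]]; have [M1 _] := b.
pose M' := Num.max M r^-1.
have [b' H'] : germ_on phi f M' by apply: (germ_on_le _ (conj b H)); rewrite le_max lexx.
exists M'; split=> // w w0 wr; rewrite -fg //; first exact: H'.
have MM : M <= M' by rewrite le_max lexx.
have rM : r^-1 <= M' by rewrite le_max lexx orbT.
by apply: lt_le_trans wr _; rewrite -[leRHS]invrK lef_pV2 ?posrE ?invr_gt0 ?mulr_gt0 //; lra.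
Qed.

Lemma geo_term phi M w : geo_bound phi M -> forall n,
  nrm (coef phi n * w ^+ n) <= M * (M * nrm w) ^+ n.
Proof.
move=> [M1 H] n; rewrite normcM nrmX exprMn mulrA -exprS ler_wpM2r // exprn_ge0 //.
exact: nrm_ge0.
Qed.

Lemma radius_ratio M w : 1 <= M -> nrm w < (8 * M)^-1 -> 0 <= M * nrm w /\ 8 * (M * nrm w) < 1.
Proof.
move=> M1 wr; split; first by rewrite mulr_ge0 ?nrm_ge0 //; lra.
by rewrite mulrA mulrC -ltr_pdivlMr ?div1r // mulr_gt0 //; lra.
Qed.

Lemma germ_const z : germ (fpsC z) (fun=> z).
Proof.
exists (Num.max 1 (nrm z)); split; first split; first by rewrite le_max lexx.
  move=> [|n]; first by rewrite expr1 le_max lexx orbT.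
  by rewrite -/(nrm 0) nrm0 exprn_ge0 // le_max ler01.
move=> w w0 _ /=; apply: eq_csum (csum_delta z) => -[|n] /=; rewrite ?expr0 ?mulr1 //.
by rewrite mul0r.
Qed.

Lemma germ_common phi psi f g : germ phi f -> germ psi g ->
  exists M, germ_on phi f M /\ germ_on psi g M.
Proof.
move=> [M H] [M' H']; exists (Num.max M M'); split.
  by apply: germ_on_le H; rewrite le_max lexx.
by apply: germ_on_le H'; rewrite le_max lexx orbT.
Qed.

Lemma germD phi psi f g : germ phi f -> germ psi g -> germ (phi + psi) (fun w => f w + g w).
Proof.
move=> H H'; have [M [[[M1 b] Hf] [[_ b'] Hg]]] := germ_common H H'.
have M2 : M <= 2 * M by lra.
exists (2 * M); split; first split; first by lra.
  move=> n; rewrite fps_coefD; apply: le_trans (le_normcD _ _) _.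
  apply: le_trans (lerD (b n) (b' n)) _; rewrite -mulr2n -[leLHS]mulr_natl exprMn ler_wpM2r //.
    by rewrite exprn_ge0 //; lra.
  by rewrite exprS ler_pMr // -natrX ler1n expn_gt0.
move=> w w0 wr.
have wr' : nrm w < (8 * M)^-1.
  by apply: lt_le_trans wr _; rewrite lef_pV2 ?posrE ?mulr_gt0 ?ler_pM2l //; lra.
apply: eq_csum (csumD (Hf w w0 wr') (Hg w w0 wr')) => n.
by rewrite fps_coefD mulrDl.
Qed.

Lemma succ_le_expr2 n : n.+1%:R <= (2 : R) ^+ n.
Proof. by rewrite -natrX ler_nat ltn_expl. Qed.

Lemma exprn_split w i n : (i <= n)%N -> w ^+ n = w ^+ i * w ^+ (n - i).
Proof. by move=> iN; rewrite -exprD subnKC. Qed.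

(** A coefficient of the product is a sum of n + 1 terms; the factor n + 1 <= 2^n is absorbed by
    passing from M to 2 M^2. *)
Lemma germM phi psi f g : germ phi f -> germ psi g -> germ (phi * psi) (fun w => f w * g w).
Proof.
move=> H H'; have [M [[b Hf] [b' Hg]]] := germ_common H H'; have [M1 _] := b.
have M2 : M <= 2 * M ^+ 2 by rewrite expr2 mulrA ler_pMl; lra.
have M0 : 0 <= M by lra.
exists (2 * M ^+ 2); split; first split; first by lra.
  move=> n; rewrite fps_coefM; apply: le_trans (nrm_sum _ _ _) _.
  have : \sum_(i < n.+1) nrm (coef phi i * coef psi (n - i)) <= \sum_(i < n.+1) M ^+ n.+2.
    apply: ler_sum => i _; rewrite normcM.
    apply: le_trans (ler_pM (nrm_ge0 _) (nrm_ge0 _) (b.2 i) (b'.2 _)) _.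
    have iN : (i <= n)%N by rewrite -ltnS.
    by rewrite -exprD addSn addnS subnKC.
  move=> /le_trans; apply; rewrite sumr_const card_ord -[leLHS]mulr_natl exprMn -exprM.
  apply: ler_pM; rewrite ?ler0n ?exprn_ge0 //.
    by apply: le_trans (succ_le_expr2 n) _; rewrite exprS ler_pMl ?ler1n // exprn_gt0.
  by rewrite ler_weXn2l //; lia.
move=> w w0 wr.
have wr' : nrm w < (8 * M)^-1.
  by apply: lt_le_trans wr _; rewrite lef_pV2 ?posrE ?mulr_gt0 ?ler_pM2l //; lra.
have [r0 r8] := radius_ratio M1 wr'.
have := cauchy_product r0 _ (geo_term w b) (geo_term w b') (Hf w w0 wr') (Hg w w0 wr').
move=> /(_ ltac:(lra)); apply: eq_csum => n.
rewrite fps_coefM mulr_suml; apply: eq_bigr => i _.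
have iN : (i <= n)%N by rewrite -ltnS.
by rewrite (exprn_split w iN) mulrACA.
Qed.

Lemma germX phi f n : germ phi f -> germ (phi ^+ n) (fun w => f w ^+ n).
Proof.
move=> H; elim: n => [|n IH].
  by under eq_fun do rewrite expr0; exact: germ_const.
by under eq_fun do rewrite exprS; rewrite exprS; exact: germM.
Qed.

Lemma germ_id : germ (fpsX C) id.
Proof.
exists 1; split; first split=> //.
  by move=> n; rewrite expr1n /=; case: eqP => _; rewrite ?nrm1 ?nrm0.
move=> w w0 _ /=; apply: eq_csum (csum_shift 1 (csum_delta w)) => -[|[|n]] /=; rewrite ?mul0r ?mul1r ?expr1 //.
Qed.

Lemma germN phi f : germ phi f -> germ (- phi) (fun w => - f w).
Proof.
move=> H; have := germM (germ_const (-1)) H.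
have -> : fpsC (-1) * phi = - phi by rewrite rmorphN rmorph1 mulN1r.
by under eq_fun do rewrite mulN1r.
Qed.

Lemma germB phi psi f g : germ phi f -> germ psi g -> germ (phi - psi) (fun w => f w - g w).
Proof. by move=> H H'; apply: germD H (germN H'). Qed.

(** Induction on the recursion for the coefficients of an inverse, where c bounds the inverse of the
    constant term. Since c M^2 <= L - M for L = 2 c M^2, the sum of the L^(n - i) M^i telescopes and
    the bound reproduces itself. *)
Lemma fps_inv_bound phi psi M c : geo_bound phi M -> phi * psi = 1 ->
  1 <= c -> (nrm (fps_cst phi))^-1 <= c ->
  forall n, nrm (coef psi n) <= c * (2 * c * M ^+ 2) ^+ n.
Proof.
move=> [M1 b] pp c1 cc; set L := 2 * c * M ^+ 2.
have phi0 : fps_cst phi != 0.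
  by rewrite -fps_unitE; apply/unitrP; exists psi; rewrite mulrC pp.
have M0 : 0 <= M by lra.
have LM : c * M ^+ 2 <= L - M.
  have : M <= c * M ^+ 2 by rewrite expr2 mulrA ler_pMl ?(lt_le_trans _ M1) // mulr_ege1.
  by rewrite /L -mulrA; lra.
elim/ltn_ind => n IH.
have E : coef psi n * fps_cst phi = (n == 0%N)%:R - \sum_(i < n) coef phi i.+1 * coef psi (n - i.+1).
  have := congr1 (fun h => coef h n) pp; rewrite fps_coefM fps_coef1 big_ord_recl subn0 => <-.
  rewrite mulrC addrK //.
have bnd : nrm (coef psi n) <= c * nrm (coef psi n * fps_cst phi).
  rewrite normcM mulrCA -{1}[nrm (coef psi n)]mulr1 ler_wpM2l ?nrm_ge0 //.
  by rewrite -ler_pdivrMr ?nrm_gt0 // div1r.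
apply: le_trans bnd _; apply: ler_wpM2l; [by lra|rewrite E].
case: n IH {E} => [|n] IH; first by rewrite big_ord0 subr0 nrm1 expr0.
rewrite sub0r normcN; apply: le_trans (nrm_sum _ _ _) _.
have : \sum_(i < n.+1) nrm (coef phi i.+1 * coef psi (n.+1 - i.+1)) <=
    \sum_(i < n.+1) c * M ^+ 2 * (L ^+ (n.+1.-1 - i) * M ^+ i).
  apply: ler_sum => i _; rewrite normcM subSS /=.
  apply: le_trans (ler_pM (nrm_ge0 _) (nrm_ge0 _) (b _) (IH _ _)) _.
    by rewrite ltnS leq_subr.
  by rewrite exprS exprS le_eqVlt; apply/orP; left; apply/eqP; ring.
move=> /le_trans; apply; rewrite -mulr_sumr.
have S0 : 0 <= \sum_(i < n.+1) L ^+ (n.+1.-1 - i) * M ^+ i.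
  apply: sumr_ge0 => i _; rewrite mulr_ge0 ?exprn_ge0 //.
  by rewrite /L !mulr_ge0 ?exprn_ge0 //; lra.
apply: le_trans (ler_wpM2r S0 LM) _; rewrite -subrXX.
by rewrite gerBl exprn_ge0.
Qed.

(** The bound makes the formal inverse converge, to l say; the Cauchy product gives f w * l = 1, so
    f w is nonzero and l is its inverse. *)
Lemma germV phi f : germ phi f -> fps_cst phi != 0 ->
  germ phi^-1 (fun w => (f w)^-1) /\ near0 (fun w => f w != 0).
Proof.
move=> [M [b Hf]] phi0; have [M1 _] := b.
have pu : phi \is a GRing.unit by rewrite fps_unitE.
have pp := divrr pu; pose c := Num.max 1 (nrm (fps_cst phi))^-1.
have c1 : 1 <= c by rewrite le_max lexx.
have := fps_inv_bound b pp c1 _; rewrite le_max lexx orbT => /(_ isT).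
set L := 2 * c * M ^+ 2 => bL.
have MM : M <= M ^+ 2 by rewrite expr2 ler_pMl //; lra.
have cM : c <= c * M ^+ 2 by rewrite ler_pMr ?exprn_ege1 //; lra.
have cL : c <= L by rewrite /L -mulrA; lra.
have Mc : M ^+ 2 <= c * M ^+ 2 by rewrite ler_pMl // exprn_gt0; lra.
have ML : M <= L by rewrite /L -mulrA; lra.
have gb : geo_bound phi^-1 L.
  split; first by lra.
  by move=> n; apply: le_trans (bL n) _; rewrite exprS ler_wpM2r // exprn_ge0 //; lra.
have key w : w != 0 -> nrm w < (8 * L)^-1 ->
    f w != 0 /\ csum (fun n => coef phi^-1 n * w ^+ n) (f w)^-1.
  move=> w0 wr; have [L1 _] := gb; have [r0 r8] := radius_ratio L1 wr.
  have r01 : 0 <= L * nrm w < 1 by rewrite r0; lra.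
  have [l Hl] := csum_dominated r01 (geo_term w gb).
  have wr' : nrm w < (8 * M)^-1.
    by apply: lt_le_trans wr _; rewrite lef_pV2 ?posrE ?mulr_gt0 ?ler_pM2l //; lra.
  have b' := geo_bound_le ML b.
  have := cauchy_product r0 _ (geo_term w b') (geo_term w gb) (Hf w w0 wr') Hl.
  move=> /(_ ltac:(lra)) H.
  have Hfl : csum (fun n => if n == 0%N then 1 else 0) (f w * l).
    apply: eq_csum H => n.
    transitivity (coef (phi / phi) n * w ^+ n).
      rewrite fps_coefM mulr_suml; apply: eq_bigr => i _.
      have iN : (i <= n)%N by rewrite -ltnS.
      by rewrite (exprn_split w iN) mulrACA.
    by rewrite pp fps_coef1; case: n => [|n]; rewrite ?mul1r ?mul0r.
  have fl := csum_unique Hfl (csum_delta 1).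
  have f0 : f w != 0 by apply: contra_eq_neq fl => ->; rewrite mul0r eq_sym oner_neq0.
  split; first exact: f0.
  have -> : (f w)^-1 = l by rewrite -[LHS]mulr1 -fl mulKf.
  exact: Hl.
split; last first.
  exists (8 * L)^-1; first by apply: radius_gt0; case: gb.
  by move=> w w0 /(key w w0)[].
exists L; split; first exact: gb.
by move=> w w0 /(key w w0)[].
Qed.

End Germs.

Section GermTheory.
Variable R : realType.
Local Notation C := R[i].
Local Notation nrm := (@normc R).
Local Notation coef := (@fps_coef C).
Implicit Types (f g : C -> C) (phi psi : fps C) (w z : C) (M : R).

Lemma germ_ext phi f g : (forall w, w != 0 -> f w = g w) -> germ phi f -> germ phi g.
Proof. by move=> fg; apply: germ_near; exists 1 => // w w0 _; apply: fg. Qed.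

Lemma germ_zero g : germ 0 g -> near0 (fun w => g w = 0).
Proof.
move=> [M [[M1 _] H]]; exists (8 * M)^-1; first exact: radius_gt0.
move=> w w0 /(H w w0) Hw; apply: csum_unique Hw _.
by apply: eq_csum (csum_delta 0) => n; rewrite fps_coef0E mul0r; case: ifP.
Qed.

(** Coefficients move by m places, and M^(n + m + 1) <= (M^(m + 1))^(n + 1) gives the new
    constant. *)
Lemma germ_divX m psi g : germ (fpsX C ^+ m * psi) g -> germ psi (fun w => g w / w ^+ m).
Proof.
move=> [M [[M1 b] H]].
have cE n : coef psi n = coef (fpsX C ^+ m * psi) (n + m).
  by rewrite fps_coefXnM ltnNge leq_addl addnK.
have MM : M <= M ^+ m.+1 by rewrite exprS ler_pMr ?exprn_ege1 //; lra.
have gb : geo_bound psi (M ^+ m.+1).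
  split; first by lra.
  move=> n; rewrite cE; apply: le_trans (b _) _.
  by rewrite -exprM ler_weXn2l //; lia.
exists (M ^+ m.+1); split; first exact: gb.
move=> w w0 wr.
have wr' : nrm w < (8 * M)^-1.
  by apply: lt_le_trans wr _; rewrite lef_pV2 ?posrE ?mulr_gt0 ?ler_pM2l //; lra.
have [r0 r8] := radius_ratio gb.1 wr.
have r01 : 0 <= M ^+ m.+1 * nrm w < 1 by rewrite r0; lra.
have [l Hl] := csum_dominated r01 (geo_term w gb).
suff -> : g w / w ^+ m = l by exact: Hl.
have E : g w = w ^+ m * l.
  apply: csum_unique (H w w0 wr') _.
  apply: eq_csum (csum_shift m (csumM (w ^+ m) Hl)) => n.
  rewrite fps_coefXnM; case: ltnP => mn; first by rewrite mul0r.
  by rewrite mulrCA -exprD subnKC.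
by rewrite E mulrAC mulfV ?mul1r // expf_neq0.
Qed.

(** Zeros are isolated: after division by the power of w given by the order of the series, the
    constant term is nonzero and the quotient is invertible nearby. *)
Lemma germ_nonzero phi g : germ phi g -> phi != 0 -> near0 (fun w => g w != 0).
Proof.
move=> H phi0; have [c0 clt] := fps_ordP phi0.
have [psi E] := fps_factor clt; set m := fps_ord phi in c0 clt E.
have psi0 : fps_cst psi != 0.
  by move: c0; rewrite {1}E fps_coefXnM ltnn subnn.
rewrite E in H; have [_ near] := germV (germ_divX H) psi0.
by apply: near0_imp near => w w0; apply: contra_neq => ->; rewrite mul0r.
Qed.

Lemma germ_unique phi psi g : germ phi g -> germ psi g -> phi = psi.
Proof.
move=> H H'; apply/eqP; rewrite -subr_eq0; apply: contraT => ne.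
have [w [_ _]] := near0_ex ltr01 (germ_nonzero (germB H H') ne).
by rewrite subrr eqxx.
Qed.

(** Abel's lemma: convergence at the single point p = r / 2 bounds the terms c_n p^n, hence the c_n
    geometrically with ratio 1 / p. *)
Lemma pseries_germ (c : nat -> C) g (r : R) : 0 < r ->
  (forall w, w != 0 -> nrm w < r -> csum (fun n => c n * w ^+ n) (g w)) -> germ (FPS c) g.
Proof.
move=> r0 H; pose p := r / 2; have p0 : 0 < p by rewrite divr_gt0.
have pr : p < r by rewrite ltr_pdivrMr // ltr_pMr // ltr1n.
have np : nrm p%:C%C = p by rewrite nrm_real gtr0_norm.
have pC0 : p%:C%C != 0 :> C by rewrite -nrm_gt0 np.
have Hp : csum (fun n => c n * p%:C%C ^+ n) (g p%:C%C) by apply: H; rewrite ?np.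
have [N HN] := (cvg_cplxP _ _).1 Hp 1 ltr01.
pose B := 2 + \sum_(i < N) nrm (c i * p%:C%C ^+ i).
have S0 : 0 <= \sum_(i < N) nrm (c i * p%:C%C ^+ i).
  by apply: sumr_ge0 => i _; apply: nrm_ge0.
have bnd n : nrm (c n * p%:C%C ^+ n) <= B.
  have [nN|Nn] := ltnP n N.
    rewrite /B (bigD1 (Ordinal nN)) //= addrCA lerDl addr_ge0 //.
    by apply: sumr_ge0 => i _; apply: nrm_ge0.
  have -> : c n * p%:C%C ^+ n = (g p%:C%C - \sum_(i < n) c i * p%:C%C ^+ i) -
       (g p%:C%C - \sum_(i < n.+1) c i * p%:C%C ^+ i).
    by rewrite big_ord_recr /=; move: (g _) (\sum_(i < n) _) (c n * _) => G S u; ring.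
  apply: le_trans (le_normcD _ _) _; rewrite normcN.
  have := HN n Nn; have := HN n.+1 (leqW Nn); rewrite /B; lra.
pose M := Num.max 1 (Num.max B p^-1).
have [M1 MB Mp] : [/\ 1 <= M, B <= M & p^-1 <= M].
  by split; rewrite !le_max lexx ?orbT.
exists M; split.
  split=> // n; have := bnd n; rewrite normcM nrmX np => Hn.
  have -> : nrm (coef (FPS c) n) = nrm (c n) * p ^+ n * p^-1 ^+ n.
    by rewrite -mulrA -exprMn mulfV ?expr1n ?mulr1 // gt_eqF.
  rewrite exprS; apply: ler_pM.
  - by rewrite mulr_ge0 ?nrm_ge0 // exprn_ge0 // ltW.
  - by rewrite exprn_ge0 // invr_ge0 ltW.
  - exact: le_trans Hn MB.
  - by rewrite lerXn2r // nnegrE ?invr_ge0 ?ltW //; lra.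
move=> w w0 wr; apply: H => //; apply: lt_trans wr _.
apply: le_lt_trans pr; rewrite -[leRHS]invrK lef_pV2 ?posrE ?invr_gt0 ?mulr_gt0 //; lra.
Qed.

(** A germ ignores the value at the centre; here it has to be the constant term, which is what
    analyticity requires. *)
Definition expansion phi f z : Prop := germ phi (fun w => f (z + w)) /\ fps_cst phi = f z.

Definition laurent_at f z : Prop :=
  exists m phi, germ phi (fun w => w ^+ m * f (z + w)).

Lemma csum_at0 (c : nat -> C) : csum (fun n => c n * 0 ^+ n) (c 0%N).
Proof.
by apply: eq_csum (csum_delta (c 0%N)) => -[|n] /=; rewrite ?expr0 ?mulr1 // expr0n mulr0.
Qed.

Lemma expansion_csum phi f z : expansion phi f z -> exists2 r : R, 0 < r &
  forall w, nrm w < r -> csum (fun n => coef phi n * w ^+ n) (f (z + w)).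
Proof.
move=> [[M [[M1 b] H]] E]; exists (8 * M)^-1; first exact: radius_gt0.
move=> w wr; have [->|w0] := eqVneq w 0; last exact: H w w0 wr.
by rewrite addr0 -E; apply: csum_at0.
Qed.

Lemma analytic_atP f z : analytic_at f z <-> exists phi, expansion phi f z.
Proof.
split=> [[c [r [r0 H]]]|[phi /expansion_csum[r r0 H]]].
  have [s [s0 rs]] : exists s : R, 0 < s /\ r = s%:C%C.
    exists (complex.Re r); move: r0; rewrite ltcE /= => /andP[/eqP i0 r0].
    by split=> //; move: i0; case: (r) => x y /= ->.
  have Hc w : nrm w < s -> csum (fun n => c n * w ^+ n) (f (z + w)).
    move=> ws; have := H (z + w); rewrite addrC addKr => Hw.
    by apply/cvg_pseriesP/Hw; rewrite rs normE ltcR.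
  exists (FPS c); split; first by apply: (pseries_germ s0) => w _; apply: Hc.
  have H0 := Hc 0; rewrite nrm0 addr0 in H0.
  exact: csum_unique (@csum_at0 c) (H0 s0).
exists (coef phi), r%:C%C; split; first by rewrite ltcR.
move=> w; rewrite normE ltcR => wr; apply/cvg_pseriesP.
by have := H (w - z) wr; rewrite [z + _]addrC subrK.
Qed.

Lemma pole_atP f z : pole_at f z <-> exists m phi, [/\ (0 < m)%N, fps_cst phi != 0 &
  germ phi (fun w => w ^+ m * f (z + w))].
Proof.
split=> [[m [c [r [m0 c0 r0 H]]]]|[m [phi [m0 p0 [M [[M1 b] H]]]]]].
  have [s [s0 rs]] : exists s : R, 0 < s /\ r = s%:C%C.
    exists (complex.Re r); move: r0; rewrite ltcE /= => /andP[/eqP i0 r0].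
    by split=> //; move: i0; case: (r) => x y /= ->.
  exists m, (FPS c); split=> //; apply: (pseries_germ s0) => w w0 ws.
  have := H (z + w); rewrite addrC addKr normr_gt0 w0 rs normE ltcR ws => /(_ isT).
  by move/cvg_pseriesP.
exists m, (coef phi), ((8 * M)^-1)%:C%C; split=> //.
  by rewrite ltcR; apply: radius_gt0.
move=> w; rewrite normr_gt0 normE ltcR => /andP[w0 wr]; apply/cvg_pseriesP.
by have := H (w - z) w0 wr; rewrite [z + _]addrC subrK.
Qed.

Lemma meromorphic_laurent f : meromorphic f -> forall z, laurent_at f z.
Proof.
move=> H z; have [/analytic_atP[phi [H' _]]|/pole_atP[m [phi [_ _ H']]]] := H z.
  by exists 0%N, phi; apply: germ_ext H' => w _; rewrite expr0 mul1r.
by exists m, phi.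
Qed.

Lemma laurent_atB f g z : laurent_at f z -> laurent_at g z ->
  laurent_at (fun w => f w - g w) z.
Proof.
move=> [m [phi H]] [n [psi H']].
exists (m + n)%N, (fpsX C ^+ n * phi - fpsX C ^+ m * psi).
have := germB (germM (germX n (germ_id R)) H) (germM (germX m (germ_id R)) H').
by apply: germ_ext => w _; rewrite mulrBr exprD -!mulrA mulrCA.
Qed.

Lemma laurent_at_dichotomy f z : laurent_at f z ->
  near0 (fun w => f (z + w) = 0) \/ near0 (fun w => f (z + w) != 0).
Proof.
move=> [m [phi H]]; have [p0|p0] := eqVneq phi 0.
  left; rewrite p0 in H; apply: near0_imp (germ_zero H) => w w0 /eqP.
  by rewrite mulf_eq0 expf_eq0 (negbTE w0) andbF => /eqP.
right; apply: near0_imp (germ_nonzero H p0) => w w0.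
by rewrite mulf_eq0 negb_or => /andP[].
Qed.

(** Connectedness of [0, 1], through the supremum of the x such that G holds on [0, x]. *)
Lemma interval_induction (G : R -> Prop) : G 0 ->
  (forall x, 0 <= x <= 1 -> exists2 e : R, 0 < e &
     (forall y, `|y - x| < e -> G y) \/ (forall y, `|y - x| < e -> ~ G y)) -> G 1.
Proof.
move=> G0 H; pose T : set R := [set x | 0 <= x <= 1 /\ forall y, 0 <= y <= x -> G y].
have T0 : T 0.
  split; first by rewrite lexx ler01.
  by move=> y y0; have -> : y = 0 by apply/le_anti; rewrite andbC.
have supT : has_sup T.
  by split; [exists 0|exists 1 => x [/andP[]]].
pose x := sup T.
have x0 : 0 <= x by apply: sup_upper_bound.
have x1 : x <= 1 by apply: ge_sup => [|y [/andP[]]]; [exists 0|].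
have He := H x; rewrite x0 x1 in He; have {He} [e e0 He] := He isT.
have [y Ty yx] := sup_adherent e0 supT.
have yle : y <= x by apply: sup_upper_bound.
have Gy : G y by case: Ty => /andP[y0 _]; apply; rewrite lexx y0.
have near_y : `|y - x| < e by rewrite ltr_norml; apply/andP; split; rewrite -/x in yx; lra.
have Hg : forall y, `|y - x| < e -> G y.
  by case: He => // /(_ y near_y).
have [xe|xlt] := eqVneq x 1; first by apply: Hg; rewrite xe subrr normr0.
pose z := Num.min 1 (x + e / 2).
have xz : x < z by rewrite lt_min lt_neqAle xlt x1 /=; lra.
suff Tz : T z.
  have zx : z <= x by exact: sup_upper_bound supT _ Tz.
  by rewrite leNgt xz in zx.
split; first by rewrite ge_min lexx (le_trans x0 (ltW xz)).
move=> w /andP[w0 wz]; have [wy|yw] := leP w y; first by case: Ty => _; apply; rewrite w0.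
apply: Hg; have : z <= x + e / 2 by rewrite ge_min lexx orbT.
by rewrite -/x in yx; rewrite ltr_norml; lra.
Qed.

(* Vanishing near a point is an open and closed condition; it is propagated
   along the segment from [a] to [b]. *)
Lemma identity_theorem f : (forall z, laurent_at f z) -> forall a b,
  near0 (fun w => f (a + w) = 0) -> near0 (fun w => f (b + w) = 0).
Proof.
move=> H a b Ha; pose p (x : R) : C := a + x%:C%C * (b - a).
pose good z := near0 (fun w => f (z + w) = 0).
suff : good (p 1) by rewrite /p rmorph1 mul1r addrC subrK.
apply: (@interval_induction (fun x => good (p x))).
  by rewrite /p rmorph0 mul0r addr0.
move=> x _.
have [r r0 Hr] : exists2 r : R, 0 < r & (forall w, w != 0 -> nrm w < r -> f (p x + w) = 0) \/
    (forall w, w != 0 -> nrm w < r -> f (p x + w) != 0).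
  by case: (laurent_at_dichotomy (H (p x))) => -[r r0 Hr]; exists r => //; [left|right].
(* Parameters within e of x give points of the segment within r of [p x]; the summand 1 covers the
   case a = b. *)
pose e := r / (1 + nrm (b - a)).
have ba0 := nrm_ge0 (b - a).
have e0 : 0 < e by rewrite divr_gt0 //; lra.
have pxy y : `|y - x| < e -> nrm (p y - p x) < r.
  move=> yx; rewrite /p opprD addrACA subrr add0r -mulrBl -rmorphB normcM nrm_real.
  apply: (@le_lt_trans _ _ (`|y - x| * (1 + nrm (b - a)))).
    by rewrite ler_wpM2l // lerDr.
  by rewrite -ltr_pdivlMr //; lra.
exists e => //; case: Hr => Hr; [left|right] => y /pxy yr.
  have [->|ne] := eqVneq (p y) (p x); first by exists r.
  have d0 : 0 < nrm (p y - p x) by rewrite nrm_gt0 subr_eq0.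
  exists (Num.min (nrm (p y - p x)) (r - nrm (p y - p x))); first by rewrite lt_min d0 subr_gt0.
  move=> w w0; rewrite lt_min => /andP[w1 w2].
  have -> : p y + w = p x + (p y - p x + w) by rewrite addrA [p x + _]addrC subrK.
  apply: Hr; last by apply: le_lt_trans (le_normcD _ _) _; lra.
  apply: contraTneq w1 => E; rewrite -leNgt.
  have -> : p y - p x = - w by apply/eqP; rewrite -addr_eq0 E.
  by rewrite normcN.
(* If f also vanished near [p y], a point other than [p x] common to both neighbourhoods would
   contradict the nonvanishing near [p x]. *)
move=> Hs; have d0 : near0 (fun w => p y - p x + w != 0).
  have [->|ne] := eqVneq (p y - p x) 0; first by exists 1 => // w w0 _; rewrite add0r.
  exists (nrm (p y - p x)); first by rewrite nrm_gt0.
  by move=> w w0; apply: contraTneq => /eqP; rewrite addrC addr_eq0 => /eqP ->;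
    rewrite normcN ltxx.
have rd : 0 < r - nrm (p y - p x) by rewrite subr_gt0.
have [w [_ wr [fw dw]]] := near0_ex rd (near0_and Hs d0).
have : f (p x + (p y - p x + w)) != 0.
  by apply: Hr => //; apply: le_lt_trans (le_normcD _ _) _; lra.
by rewrite addrA [p x + _]addrC subrK fw eqxx.
Qed.

Lemma expansionD phi psi f g z : expansion phi f z -> expansion psi g z ->
  expansion (phi + psi) (fun w => f w + g w) z.
Proof. by move=> [H E] [H' E']; split; [exact: germD|rewrite rmorphD /= E E']. Qed.

Lemma expansionM phi psi f g z : expansion phi f z -> expansion psi g z ->
  expansion (phi * psi) (fun w => f w * g w) z.
Proof. by move=> [H E] [H' E']; split; [exact: germM|rewrite rmorphM /= E E']. Qed.

Lemma expansionN phi f z : expansion phi f z -> expansion (- phi) (fun w => - f w) z.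
Proof. by move=> [H E]; split; [exact: germN|rewrite rmorphN /= E]. Qed.

Lemma expansion_const z0 z : expansion (fpsC z0) (fun=> z0) z.
Proof. by split=> //; apply: germ_const. Qed.

Lemma expansionX phi f z n : expansion phi f z -> expansion (phi ^+ n) (fun w => f w ^+ n) z.
Proof. by move=> [H E]; split; [exact: germX|rewrite rmorphXn /= E]. Qed.

Section Quotient.
Variables N D : C -> C.
Hypothesis anaN : forall z, exists phi, expansion phi N z.
Hypothesis anaD : forall z, exists2 phi, expansion phi D z & phi != 0.

Local Notation q := (fun w => N w / D w).

Lemma quotient_laurent z : laurent_at q z.
Proof.
have [phi [HN _]] := anaN z; have [psi [HD _] psi0] := anaD z.
have [c0 clt] := fps_ordP psi0; have [psi' E] := fps_factor clt.
set m := fps_ord psi in c0 clt E.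
have p0 : fps_cst psi' != 0 by move: c0; rewrite {1}E fps_coefXnM ltnn subnn.
rewrite E in HD; have [HV _] := germV (germ_divX HD) p0.
exists m, (phi * psi'^-1); apply: germ_ext (germM HN HV) => w w0.
by rewrite invf_div mulrCA.
Qed.

Lemma quotient_expansion z : D z != 0 -> exists phi, expansion phi q z.
Proof.
have [phi [HN EN]] := anaN z; have [psi [HD ED] _] := anaD z.
move=> Dz; have p0 : fps_cst psi != 0 by rewrite ED.
have [HV _] := germV HD p0; exists (phi * psi^-1); split; first exact: germM HN HV.
by rewrite rmorphM rmorphV ?fps_unitE //= EN ED.
Qed.

Lemma quotient_continuation : exists2 Z : C -> C, meromorphic Z &
  forall z, D z != 0 -> Z z = q z.
Proof.
pose S z : set C := [set v | exists phi, germ phi (fun w => q (z + w)) /\ fps_cst phi = v].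
(* At a zero of D where the singularity is removable, [xget] selects the constant term of the germ
   of the quotient; at a pole it returns the default 0. *)
pose Z z := if D z != 0 then q z else xget 0 (S z).
have ZE z : D z != 0 -> Z z = q z by rewrite /Z => ->.
exists Z; last exact: ZE.
move=> z; have [psi [HD _] psi0] := anaD z.
have nearZ : near0 (fun w => q (z + w) = Z (z + w)).
  by apply: near0_imp (germ_nonzero HD psi0) => w _ /ZE.
have [Dz|Dz] := boolP (D z != 0).
  left; apply/analytic_atP; have [phi [H E]] := quotient_expansion Dz; exists phi.
  by split; [exact: germ_near nearZ H|rewrite E ZE].
have [[phi H]|noS] := pselect (exists phi, germ phi (fun w => q (z + w))).
  left; apply/analytic_atP.
  have [phi' [H' E']] : S z (Z z).
    by rewrite /Z (negbTE Dz); apply: xgetPex; exists (fps_cst phi), phi.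
  by exists phi'; split; [exact: germ_near nearZ H'|exact: E'].
right; apply/pole_atP; have [m [nu H]] := quotient_laurent z.
have nu0 : nu != 0.
  apply/eqP => nu0; apply: noS; exists 0; rewrite nu0 in H.
  have := germ_const (0 : C); rewrite rmorph0; apply: germ_near.
  apply: near0_imp (germ_zero H) => w w0 /eqP.
  by rewrite mulf_eq0 expf_eq0 (negbTE w0) andbF => /eqP ->.
have [c0 clt] := fps_ordP nu0; have [nu' E] := fps_factor clt.
set p := fps_ord nu in c0 clt E.
have p0 : fps_cst nu' != 0 by move: c0; rewrite {1}E fps_coefXnM ltnn subnn.
rewrite E in H; have := germ_divX H => H'.
(* For m <= p the quotient is a power of w times a germ, so the singularity would be removable;
   otherwise a pole of order m - p remains. *)
have [mp|pm] := leqP m p.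
  exfalso; apply: noS; exists (fpsX C ^+ (p - m) * nu').
  have := germM (germX (p - m) (germ_id R)) H'; apply: germ_ext => w w0.
  have -> : w ^+ p = w ^+ (p - m) * w ^+ m by rewrite -exprD subnK.
  have x0 : w ^+ (p - m) != 0 by rewrite expf_neq0.
  have y0 : w ^+ m != 0 by rewrite expf_neq0.
  move: (w ^+ (p - m)) (w ^+ m) (N _ / D _) x0 y0 => x y Q x0 y0.
  by field; rewrite x0 y0.
exists (m - p)%N, nu'; split; [by rewrite subn_gt0|exact: p0|].
apply: germ_near (germ_ext _ H') ; last first.
  move=> w w0; rewrite -[in LHS](subnK (ltnW pm)) exprD mulrAC mulfK ?expf_neq0 //.
by apply: near0_imp nearZ => w _ ->.
Qed.

(** The identity theorem gives equality near z but not at z, where a meromorphic function may have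
    an arbitrary value at a pole. A pole of Z at z is excluded: its germ would be w^m times an
    analytic one, with constant term 0 since m > 0. *)
Lemma quotient_unique (Z : C -> C) (a : C) : meromorphic Z ->
  near0 (fun w => Z (a + w) = q (a + w)) -> forall z, D z != 0 -> Z z = q z.
Proof.
move=> HZ Ha z Dz; have LZ := meromorphic_laurent HZ.
have Lq := quotient_laurent.
have nearz : near0 (fun w => Z (z + w) = q (z + w)).
  have Ha' : near0 (fun w => Z (a + w) - q (a + w) = 0).
    by apply: near0_imp Ha => w _ ->; rewrite subrr.
  have := identity_theorem (fun z => laurent_atB (LZ z) (Lq z)) z Ha'.
  by apply: near0_imp => w _ /eqP; rewrite subr_eq0 => /eqP.
have [phi [H E]] := quotient_expansion Dz.
have [/analytic_atP[psi [H' E']]|/pole_atP[m [psi [m0 p0 H']]]] := HZ z.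
  by rewrite -E -E' (germ_unique (germ_near nearz H') H).
have H2 : germ psi (fun w => w ^+ m * q (z + w)).
  by apply: germ_near H'; apply: near0_imp nearz => w _ ->.
have := germ_unique H2 (germM (germX m (germ_id R)) H) => E2.
move: p0; rewrite E2 rmorphM rmorphXn /= {1}/fps_cst /= expr0n.
by case: (m) m0 => // m' _; rewrite mul0r eqxx.
Qed.

End Quotient.

(** * The complex exponential *)

Lemma cexpD z w : cexp (z + w) = cexp z * cexp w.
Proof.
case: z w => [a b] [c e]; rewrite /cexp /= expRD cosD sinD.
by congr (_ +i* _)%C; ring.
Qed.

Lemma cexp0 : cexp (0 : C) = 1.
Proof. by rewrite /cexp /= expR0 cos0 sin0 mulr1 mulr0. Qed.

Lemma cexp_mulrn z n : cexp (z *+ n) = cexp z ^+ n.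
Proof. by elim: n => [|n IH]; rewrite ?mulr0n ?cexp0 // mulrS exprS cexpD IH. Qed.

Lemma nrm_cexp z : nrm (cexp z) = expR (complex.Re z).
Proof.
rewrite /cexp /= !exprMn -mulrDr cos2Dsin2 mulr1 sqrtr_sqr.
by rewrite ger0_norm // expR_ge0.
Qed.

Definition exp_term z (n : nat) : C := z ^+ n / n`!%:R.

Lemma csum_exp_real (x : R) : csum (exp_term x%:C%C) (expR x)%:C%C.
Proof.
have E n : exp_term x%:C%C n = (x ^+ n / n`!%:R)%:C%C.
  by rewrite /exp_term rmorphM rmorphXn fmorphV rmorph_nat.
apply: csum_ReIm; under eq_fun do rewrite E /=.
  exact: is_cvg_series_exp_coeff.
rewrite (_ : series _ = fun _ => 0); first exact: cvg_cst.
by apply/funext => n; rewrite /series /= big1.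
Qed.

Lemma exp_term_imag (y : R) n :
  exp_term (0 +i* y)%C n = (cos_coeff y n +i* sin_coeff y n)%C.
Proof.
have iX m : ('i%C : C) ^+ m =
    (((~~ odd m)%:R * (-1) ^+ m./2) +i* ((odd m)%:R * (-1) ^+ m.-1./2))%C.
  have -> : ('i%C : C) ^+ m = 'i%C ^+ odd m * ((-1) ^+ m./2)%:C%C.
    by rewrite -[in LHS](odd_double_half m) exprD -mul2n exprM sqr_i rmorphXn rmorphN1.
  case: (boolP (odd m)) => om /=.
    have -> : (m.-1./2 = m./2)%N by case: m om => [//|m'] /= om; rewrite uphalf_half (negbTE om).
    by rewrite expr1 /=; congr (_ +i* _)%C; ring.
  by rewrite expr0 mul1r mul0r mul1r.
rewrite /exp_term; have -> : (0 +i* y)%C = 'i%C * y%:C%C :> C.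
  by rewrite /=; congr (_ +i* _)%C; ring.
rewrite exprMn iX -rmorphXn -(rmorph_nat (real_complex R)) -fmorphV /= -mulrA -rmorphM.
rewrite /cos_coeff /sin_coeff /=; congr (_ +i* _)%C; rewrite ?exprnP; ring.
Qed.

Lemma csum_exp_imag (y : R) : csum (exp_term (0 +i* y)%C) (cos y +i* sin y)%C.
Proof.
apply: csum_ReIm; under eq_fun do rewrite exp_term_imag /=.
  by rewrite unlock; exact: is_cvg_series_cos_coeff.
by rewrite unlock; exact: is_cvg_series_sin_coeff.
Qed.

Lemma nrm_exp_term z n : nrm (exp_term z n) <= 1 * nrm z ^+ n.
Proof.
have -> : exp_term z n = z ^+ n * ((n`!%:R)^-1)%:C%C.
  by rewrite /exp_term fmorphV rmorph_nat.
rewrite normcM nrmX nrm_real mulrC ler_wpM2r ?exprn_ge0 ?nrm_ge0 //.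
rewrite ger0_norm ?invr_ge0 ?ler0n // invf_le1 ?ltr0n ?fact_gt0 //.
by rewrite ler1n fact_gt0.
Qed.

(** The Cauchy product of the series of exp x and of cos y + i sin y; the smallness of z is the
    hypothesis of [cauchy_product]. *)
Lemma csum_exp z : 4 * nrm z < 1 -> csum (exp_term z) (cexp z).
Proof.
move=> z4; set x := complex.Re z; set y := complex.Im z.
have dom w n : nrm w <= nrm z -> nrm (exp_term w n) <= 1 * nrm z ^+ n.
  by move=> wz; apply: le_trans (nrm_exp_term w n) _; rewrite !mul1r lerXn2r // nnegrE nrm_ge0.
have nx : nrm x%:C%C <= nrm z by rewrite nrm_real nrm_Re.
have ny : nrm (0 +i* y)%C <= nrm z.
  apply: le_trans (nrm_le _) _; rewrite /= normr0 add0r; exact: nrm_Im.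
have := cauchy_product (nrm_ge0 z) z4 (dom _ ^~ nx) (dom _ ^~ ny)
  (@csum_exp_real x) (@csum_exp_imag y).
have -> : (expR x)%:C%C * (cos y +i* sin y)%C = cexp z.
  by rewrite /cexp /= -/x -/y; congr (_ +i* _)%C; ring.
apply: eq_csum => n.
have -> : z = (0 +i* y)%C + x%:C%C.
  by rewrite /x /y; case: (z) => a b /=; congr (_ +i* _)%C; rewrite ?add0r ?addr0.
rewrite [RHS]/exp_term exprDn mulr_suml; apply: eq_bigr => i _.
have iN : (i <= n)%N by rewrite -ltnS.
rewrite /exp_term -[_ *+ 'C(n, i)]mulr_natr -(bin_fact iN) !natrM.
have f0 m : (m`!%:R : C) != 0 by rewrite pnatr_eq0 -lt0n fact_gt0.
have b0 : ('C(n, i)%:R : C) != 0 by rewrite pnatr_eq0 -lt0n bin_gt0.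
move: ('C(n, i)%:R) (i`!%:R) ((n - i)`!%:R) b0 (f0 i) (f0 (n - i)%N) => B I J B0 I0 J0.
move: (x%:C%C ^+ i) ((0 +i* y)%C ^+ (n - i)) => X Y.
by field; rewrite B0 I0 J0.
Qed.

(** The addition formula moves the centre to 0, so the series on a small disc gives the expansion at
    every point. *)
Lemma expansion_cexp (lam : R) z :
  expansion (FPS (fun n => cexp (z * lam%:C%C) * (lam%:C%C ^+ n / n`!%:R)))
    (fun w => cexp (w * lam%:C%C)) z.
Proof.
split; last by rewrite /fps_cst /= expr0 divr1 mulr1.
have M0 : 0 < 4 * (1 + `|lam|) by rewrite mulr_gt0 // ltr_wpDr.
apply: (@pseries_germ _ _ (4 * (1 + `|lam|))^-1); first by rewrite invr_gt0.
move=> w w0 wr; rewrite mulrDl cexpD.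
have small : 4 * nrm (w * lam%:C%C) < 1.
  rewrite normcM nrm_real; have : nrm w * (4 * (1 + `|lam|)) < 1.
    by rewrite -ltr_pdivlMr // div1r.
  by have := nrm_ge0 w; have := normr_ge0 lam; nra.
apply: eq_csum (csumM _ (csum_exp small)) => n.
by rewrite /exp_term exprMn -!mulrA; congr (_ * _); rewrite mulrC -mulrA.
Qed.

End GermTheory.

(** * The measure on the double coset space *)

Section CountableIntegral.
Context d (T : measurableType d) (R : realType) (mu : {measure set T -> \bar R}).
Variables (I : choiceType) (L : nat -> seq I) (p : I -> T) (m : I -> R).
Hypothesis measT : forall A : set T, measurable A.
Hypothesis Luniq : forall n, uniq (L n).
Hypothesis p_inj : forall n n' i j, i \in L n -> j \in L n' -> p i = p j -> n = n' /\ i = j.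
Hypothesis p_surj : forall x, exists n i, i \in L n /\ x = p i.
Hypothesis m_ge0 : forall i, 0 <= m i.
Hypothesis mu_point : forall n i, i \in L n -> mu [set p i] = (m i)%:E.

Let G n : set T := \big[setU/set0]_(i <- L n) [set p i].

Let GP n x : G n x <-> exists2 i, i \in L n & x = p i.
Proof.
rewrite /G -bigcup_seq; split=> [[i /= iL ->]|[i iL ->]]; first by exists i.
by exists i.
Qed.

Let G_cover : \bigcup_n G n = setT.
Proof.
apply/seteqP; split=> // x _; have [n [i [iL ->]]] := p_surj x.
by exists n => //; apply/GP; exists i.
Qed.

Let G_triv : trivIset setT G.
Proof.
move=> n n' _ _ [x [/GP[i iL ->] /GP[j jL]]] E.
by have [] := p_inj iL jL E.
Qed.

Let triv_point n : trivIset [set` L n] (fun i => [set p i]).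
Proof.
by move=> i j /= iL jL [x [/= -> E]]; have [] := p_inj iL jL E.
Qed.

Let integral_point (f : T -> R) n i : i \in L n ->
  (\int[mu]_(x in [set p i]) (f x)%:E = (f (p i) * m i)%:E)%E.
Proof.
move=> iL; rewrite EFinM -(mu_point iL) -integral_cst //.
by apply: eq_integral => x; rewrite inE /= => ->.
Qed.

Let integral_level (f : T -> R) n :
  (\int[mu]_(x in G n) (f x)%:E = (\sum_(i <- L n) f (p i) * m i)%:E)%E.
Proof.
rewrite /G integral_bigsetU_EFin //.
rewrite -sumEFin big_seq [RHS]big_seq; apply: eq_bigr => i iL.
exact: integral_point iL.
Qed.

Let nneseries_EFin (a : nat -> R) (l : R) : series a @ \oo --> l ->
  (\sum_(n <oo) (a n)%:E = l%:E)%E.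
Proof.
move=> al; have -> : (fun n => \sum_(0 <= i < n) (a i)%:E)%E = EFin \o series a.
  by apply/funext => n; rewrite /= sumEFin.
by rewrite EFin_lim; [rewrite (cvg_lim _ al)|apply/cvg_ex; exists l].
Qed.

(** The space is the disjoint union of countably many finite levels made of points of known mass.
    Absolute convergence of the level sums gives integrability, and the integral is then summed
    level by level. *)
Lemma countable_integral (g : T -> R) :
  cvgn (series (fun n => \sum_(i <- L n) `|g (p i)| * m i)) ->
  mu.-integrable setT (EFin \o g) /\
  series (fun n => \sum_(i <- L n) g (p i) * m i) @ \oo --> fine (\int[mu]_x (g x)%:E)%E.
Proof.
move=> /cvg_ex[l al].
have gi : mu.-integrable setT (EFin \o g).
  apply/integrableP; split; first by move=> _ A _; apply: measT.
  rewrite -G_cover ge0_integral_bigcup //.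
  rewrite (eq_eseriesr (g := fun n => (\sum_(i <- L n) `|g (p i)| * m i)%:E)).
    by rewrite (nneseries_EFin al) ltry.
  by move=> n _; rewrite -(integral_level (fun x => `|g x|)).
split=> //.
have bl : cvgn (series (fun n => \sum_(i <- L n) g (p i) * m i)).
  apply: normed_cvg; apply: (@series_le_cvg _ _ (fun n => \sum_(i <- L n) `|g (p i)| * m i)).
  - by move=> n /=.
  - by move=> n; apply: sumr_ge0 => i _; rewrite mulr_ge0.
  - move=> n /=; apply: le_trans (ler_norm_sum _ _ _) _; apply: ler_sum => i _.
    by rewrite normrM (ger0_norm (m_ge0 i)).
  - by apply/cvg_ex; exists l.
have /cvg_ex[l' bl'] := bl.
suff -> : (\int[mu]_x (g x)%:E = l'%:E)%E by [].
rewrite -G_cover integral_bigcup //; last by rewrite G_cover.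
rewrite -(nneseries_EFin bl'); apply: eq_eseriesr => n _.
exact: integral_level.
Qed.

End CountableIntegral.

Section DoubleCosets.
Variables (G : groupType) (Gam K : set G).
Hypotheses (Gam1 : Gam 1%g) (GamM : forall x y, Gam x -> Gam y -> Gam (x * y)%g)
  (GamV : forall x, Gam x -> Gam x^-1%g).
Hypotheses (K1 : K 1%g) (KM : forall x y, K x -> K y -> K (x * y)%g)
  (KV : forall x, K x -> K x^-1%g).

Lemma rcoset_eq x y : Defs.rcoset Gam x y -> Defs.rcoset Gam y = Defs.rcoset Gam x.
Proof.
move=> [a Ga ->]; apply/seteqP; split=> z [b Gb ->].
  by exists (b * a)%g; [exact: GamM|rewrite mulgA].
by exists (b * a^-1)%g; [apply: GamM => //; exact: GamV|rewrite mulgA mulgVK].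
Qed.

Lemma lq_set_repr (z : lquot Gam) : lq_set z = Defs.rcoset Gam (lq_repr z).
Proof.
have [x E] : exists x, lq_set z = Defs.rcoset Gam x by case: z.
have : Defs.rcoset Gam x (lq_repr z).
  by rewrite -E; apply: xgetPex; exists x; rewrite E; exists 1%g; rewrite ?mul1g.
by move=> /rcoset_eq ->.
Qed.

Lemma dq_repr_mem (y : dquot Gam K) : dq_set y (dq_repr y).
Proof.
have [x E] : exists x, dq_set y = dcoset Gam K x by case: y.
by apply: xgetPex; exists x; rewrite E; exists 1%g, 1%g; rewrite mulg1 mul1g.
Qed.

Lemma dquot_eq (y z : dquot Gam K) : dq_set y = dq_set z -> y = z.
Proof.
by case: y z => [A HA] [B HB] /= E; subst B; congr DQuot; apply: Prop_irrelevance.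
Qed.

Lemma to_dquot_eq x y : to_dquot Gam K x = to_dquot Gam K y <-> dcoset Gam K y x.
Proof.
split=> [/(congr1 (@dq_set _ _ _)) /= <-|[a [b [Ga Kb ->]]]].
  by exists 1%g, 1%g; rewrite mulg1 mul1g.
apply: dquot_eq => /=; apply/seteqP; split=> z [c [e [Gc Ke ->]]].
  exists (c * a)%g, (b * e)%g; split; [exact: GamM|exact: KM|].
  by rewrite !mulgA.
exists (c * a^-1)%g, (b^-1 * e)%g; split; [|exact: KM (KV Kb) Ke|].
  by apply: GamM => //; exact: GamV.
by rewrite !mulgA mulgVK mulgK.
Qed.

Lemma to_dquot_repr (y : dquot Gam K) : to_dquot Gam K (dq_repr y) = y.
Proof.
have [x E] : exists x, dq_set y = dcoset Gam K x by case: y.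
have := dq_repr_mem y; rewrite E => /to_dquot_eq ->.
exact: dquot_eq.
Qed.

Lemma lquot_dquot_to x : lquot_dquot K (to_lquot Gam x) = to_dquot Gam K x.
Proof.
apply/to_dquot_eq; have := lq_set_repr (to_lquot Gam x); rewrite /= => E.
have : Defs.rcoset Gam x (lq_repr (to_lquot Gam x)).
  by rewrite E; exists 1%g; rewrite ?mul1g.
by move=> [a Ga ->]; exists a, 1%g; rewrite mulg1.
Qed.

Definition stab (g : G) : set G := [set x | Gam x /\ exists2 y, K y & (x * g = g * y)%g].

Definition left_translate (g : G) : set G := [set (g * x)%g | x in K].

(** If z lies over the class of g, its representative is x = a g b, and the points of g K on the
    orbit Gam x are the y g b with y in the stabilizer. *)
Lemma counting_coset (R : realType) (g : G) (l : seq G) (z : lquot Gam) :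
  uniq l -> (forall x, x \in l <-> stab g x) ->
  counting (left_translate g `&` lq_set z) =
  (if `[< lquot_dquot K z = to_dquot Gam K g >] then (size l)%:R%:E else 0%E) :> \bar R.
Proof.
move=> lu lP; rewrite lq_set_repr /lquot_dquot; set x := lq_repr z.
case: asboolP => [/to_dquot_eq[a [b [Ga Kb xE]]]|ne]; last first.
  suff -> : left_translate g `&` Defs.rcoset Gam x = set0.
    by rewrite /counting asboolT // fset_set0 cardfs0.
  apply/seteqP; split=> // y [[u Ku <-] [c Gc E]]; apply: ne; apply/to_dquot_eq.
  exists c^-1%g, u; split=> //; first exact: GamV.
  by rewrite -mulgA E mulKg.
have -> : left_translate g `&` Defs.rcoset Gam x = [set` [seq (y * (g * b))%g | y <- l]].
  apply/seteqP; split=> [y [[u Ku <-] [c Gc E]]|y /= /mapP[v /lP[Gv [w Kw vg]] ->]].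
    apply/mapP; exists (c * a)%g; last by rewrite E xE !mulgA.
    apply/lP; split; first exact: GamM.
    exists (u * b^-1)%g; first by apply: KM => //; exact: KV.
    by rewrite !mulgA E xE !mulgA mulgK.
  split.
    exists (w * b)%g; first exact: KM.
    by rewrite !mulgA -vg.
  exists (v * a^-1)%g; first by apply: GamM => //; exact: GamV.
  by rewrite xE !mulgA mulgVK.
rewrite /counting asboolT; last exact: finite_seq.
congr (_%:R%:E).
have um : uniq [seq (y * (g * b))%g | y <- l] by rewrite map_inj_uniq //; exact: mulIg.
have -> : fset_set [set` [seq (y * (g * b))%g | y <- l]] =
    [fset x in [seq (y * (g * b))%g | y <- l]]%fset.
  apply/fsetP => y; rewrite in_fset_set; last exact: finite_seq.
  apply/idP/idP => [/set_mem /= yl|yl]; first by rewrite in_fset.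
  by apply/mem_set; rewrite /= -[_ \in _](in_fset imfset_key).
by have := card_fseq [seq (y * (g * b))%g | y <- l]; rewrite undup_id // size_map => ->.
Qed.

End DoubleCosets.

Section ProjectiveSubgroups.
Variables (A : comUnitRingType) (F : fieldType) (f : {rmorphism A -> F}) (d : nat).

(** Both Gam and K have this form, with A = k[t] and A = k[[1/t]], so the subgroup laws are proved
    once. *)
Definition PGL_image : set (PGL F d) := [set x | exists g : GL F d,
  x = toPGL g /\ exists2 B : 'M[A]_d, B \in unitmx & GLmx g = map_mx f B].

Lemma PGL_image1 : PGL_image 1%g.
Proof. by exists (GL_one F d); split=> //; exists 1%:M; rewrite ?unitmx1 //= map_mx1. Qed.

Lemma PGL_imageM x y : PGL_image x -> PGL_image y -> PGL_image (x * y)%g.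
Proof.
move=> [g [-> [B Bu gB]]] [h [-> [C Cu hC]]]; exists (GL_mul g h); split.
  exact: toPGL_M.
by exists (B *m C); rewrite ?unitmx_mul ?Bu //= gB hC map_mxM.
Qed.

Lemma PGL_imageV x : PGL_image x -> PGL_image x^-1%g.
Proof.
move=> [g [-> [B Bu gB]]]; exists (GL_inv g); split; first exact: toPGL_V.
exists (invmx B); rewrite ?unitmx_inv //= gB.
by rewrite -[LHS](map_invmxK f _ Bu) mulmxV ?mulmx1 // rmorph_unitmx.
Qed.

End ProjectiveSubgroups.

Section IntegralNeighbourhoods.
Variables (R : realType) (k : finFieldType) (V : lfield R k) (d : nat).
Local Notation F := (lF V).
Local Notation of_ := (lof V).
Local Notation ball := (lball V).

(** Write h = g (1 + E) with E = g^-1 (h - g). For h close to g, measured against the entries of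
    g^-1, E vanishes modulo the maximal ideal and 1 + E is invertible over k[[1/t]]. *)
Lemma near_right_coset (g : 'M[F]_d) : g \in unitmx -> exists n : int,
  forall h : 'M[F]_d, (forall i j, h i j - g i j \in ball n) ->
  exists2 C : 'M[fps k]_d, C \in unitmx & h = g *m map_mx of_ C.
Proof.
move=> gu.
have [N HN] := lball_bound [seq invmx g i j | i <- enum 'I_d, j <- enum 'I_d].
exists (-1 - N%:Z) => h Hh.
have HN' i j : invmx g i j \in ball N.
  by apply: HN; apply/allpairsP; exists (i, j); rewrite !mem_enum.
have Eb i j : (invmx g *m (h - g)) i j \in ball (-1).
  rewrite mxE; apply: rpred_sum => l _.
  apply: (@lball_le _ _ _ (N%:Z + (-1 - N%:Z))); first by lia.
  by apply: lballM; [exact: HN'|rewrite !mxE; exact: Hh].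
have /choice[f Hf] : forall ij : 'I_d * 'I_d, exists f,
    (invmx g *m (h - g)) ij.1 ij.2 = of_ f.
  move=> [i j]; have : (invmx g *m (h - g)) i j \in ball 0 by apply: lball_le (Eb i j).
  by move/lballP => [f ->]; exists f; rewrite expr0z mul1r.
pose E := \matrix_(i, j) f (i, j).
have EE : invmx g *m (h - g) = map_mx of_ E.
  by apply/matrixP => i j; rewrite (Hf (i, j)) !mxE.
exists (1%:M + E).
  rewrite unitmxE fps_unitE -det_map_mx.
  suff -> : map_mx (@fps_cst k) (1%:M + E) = 1%:M by rewrite det1 oner_neq0.
  rewrite map_mxD map_mx1; apply/matrixP => i j; rewrite !mxE.
  have f0 : fps_cst (f (i, j)) = 0.
    by apply/eqP; rewrite -(lball_cst V) -(Hf (i, j)).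
  by rewrite -[RHS]addr0; congr (_ + _).
by rewrite map_mxD map_mx1 mulmxDr mulmx1 -EE mulKVmx // addrC subrK.
Qed.

End IntegralNeighbourhoods.

Section SplittingMasses.
Variables (R : realType) (k : finFieldType) (d : nat).
Hypothesis d0 : (0 < d)%N.
Local Notation V := (laurent_lfield R k).
Local Notation G := (PGL (laurent k) d).
Local Notation Gam := (@PGL_poly k d).
Local Notation K := (@PGL_integers k d).

(** Each coset g K is a neighbourhood of g. This openness is the source of measurability on G and on
    Gam \ G. *)
Lemma PGL_open_invariant (U : set G) :
  (forall x y, U x -> K y -> U (x * y)%g) -> PGL_open R U.
Proof.
move=> H g Ug.
have [n Hn] := @near_right_coset R k V d (GLmx g) (Defs.GL_unit g).
exists (#|k|%:R ^ n); first by rewrite exprz_gt0 // q_gt0.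
move=> h Hh; have [C Cu hC] : exists2 C : 'M[fps k]_d, C \in unitmx &
    GLmx h = GLmx g *m map_mx (@ofps k) C.
  apply: Hn => i j; have := ltW (Hh i j).
  by rewrite -[(_ \in _)]/(_ \in fball n) -(absv_fball R).
have cu : map_mx (@ofps k) C \in unitmx := rmorph_unitmx (lof V) Cu.
rewrite /preimage /=; suff -> : toPGL h = (toPGL g * toPGL (MkGL cu))%g.
  by apply: H => //; exists (MkGL cu); split=> //; exists C.
rewrite [RHS]toPGL_M; congr toPGL; apply: val_inj; exact: hC.
Qed.

Lemma measurable_invariant (U : set G) :
  (forall x y, U x -> K y -> U (x * y)%g) -> measurable (U : set (borelG R k d)).
Proof. by move=> /PGL_open_invariant H; apply: sub_sigma_algebra. Qed.

Lemma measurable_lquot (W : set (bigquot k d)) :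
  (forall x y, W (to_lquot Gam x) -> K y -> W (to_lquot Gam (x * y)%g)) ->
  measurable (W : set (borel_bigquot R k d)).
Proof.
move=> H; apply: sub_sigma_algebra; apply: PGL_open_invariant => x y.
exact: H.
Qed.

Lemma measurable_discreteY (A : set (discreteY k d)) : measurable A.
Proof. exact: sub_sigma_algebra. Qed.

Local Notation cl := (@lquot_dquot _ Gam K : borel_bigquot R k d -> discreteY k d).

Let g1 : Gam 1%g := @PGL_image1 _ _ (lop V) d.
Let gM : forall x y, Gam x -> Gam y -> Gam (x * y)%g := @PGL_imageM _ _ (lop V) d.
Let gV : forall x, Gam x -> Gam x^-1%g := @PGL_imageV _ _ (lop V) d.
Let i1 : K 1%g := @PGL_image1 _ _ (lof V) d.
Let iM : forall x y, K x -> K y -> K (x * y)%g := @PGL_imageM _ _ (lof V) d.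
Let iV : forall x, K x -> K x^-1%g := @PGL_imageV _ _ (lof V) d.

Lemma measurable_class (A : set (Yquot k d)) :
  measurable ((fun z => A (lquot_dquot K z)) : set (borel_bigquot R k d)).
Proof.
apply: measurable_lquot => x y; rewrite !(lquot_dquot_to g1 gM gV i1 iM iV) => H Ky.
suff -> : to_dquot Gam K (x * y)%g = to_dquot Gam K x by [].
by apply/(to_dquot_eq g1 gM gV i1 iM iV); exists 1%g, y; rewrite mul1g.
Qed.

Lemma measurable_fun_class : measurable_fun setT cl.
Proof. by move=> _ A _; rewrite setTI; exact: measurable_class. Qed.

Definition diag_class (s : seq int) : Yquot k d := to_dquot Gam K (@diag_PGL R k V d s).

(** For A = g K the Haar measure is 1 by invariance, and the integrand is the order of the
    stabilizer on the fibre [W] and 0 elsewhere, so [lam W] is the inverse of that order. As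
    [aut_card] counts matrices and not classes modulo scalars, q - 1 appears. *)
Lemma diag_class_mass (mu : {measure set borelG R k d -> \bar R})
    (lam : {measure set borel_bigquot R k d -> \bar R}) (s : seq int) :
  normalized_haar mu -> quotient_measure mu lam -> size s = d ->
  nuY lam [set diag_class s] = ((#|k|.-1)%:R / (aut_card k s)%:R)%:E.
Proof.
move=> [mu_inv muK] qm sd; pose g : G := @diag_PGL R k V d s.
have Kinv x y : K x -> K y -> K (x * y)%g by exact: iM.
have mK := measurable_invariant Kinv.
pose A : set G := left_translate K g.
have mgK : measurable (A : set (borelG R k d)).
  apply: measurable_invariant => x y [u Ku <-] Ky.
  by exists (u * y)%g; [exact: iM|rewrite mulgA].
have muA : mu A = 1%E by rewrite -muK; apply: mu_inv.
have [l [lu lP lsize]] := @stab_PGL_card R k V d s d0 sd.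
have := qm _ mgK; rewrite muA.
pose W : set (borel_bigquot R k d) := fun z => lquot_dquot K z = diag_class s.
have mW : measurable W by apply: (measurable_class [set diag_class s]).
have -> : (fun z : borel_bigquot R k d => counting (A `&` lq_set z)) =
    ((cst (size l)%:R%:E) \_ W : _ -> \bar R).
  apply/funext => z; rewrite (counting_coset g1 gM gV i1 iM iV R z lu lP).
  rewrite patchE; have [zW|zW] := pselect (W z).
    by rewrite asboolT // mem_set.
  by rewrite asboolF // memNset.
rewrite -integral_mkcond integral_cst // => E.
have q1 : (0 < #|k|.-1)%N by rewrite -subn1 subn_gt0 card_gt1.
have a0 := aut_card_gt0 k s.
have l0 : (size l)%:R != 0 :> R.
  by rewrite pnatr_eq0 -lt0n; move: a0; rewrite -lsize muln_gt0 => /andP[].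
have -> : nuY lam [set diag_class s] = lam W by [].
have : lam W = ((size l)%:R^-1)%:E.
  by rewrite -[RHS]mule1 E muleA -EFinM mulVf // mul1e.
move=> ->; congr (_%:E); rewrite -lsize natrM invfM mulrCA mulfV ?mulr1 //.
by rewrite pnatr_eq0 -lt0n.
Qed.

End SplittingMasses.

(** * The height of a splitting type *)

Section HeightExponent.

Definition height_exponent (d : nat) (s : seq int) : int :=
  d%:Z * (level s)%:Z - (\sum_(x <- s) x) * (num_pos s)%:Z.

Lemma sorted_take_pos (s : seq int) : sorted >=%R s ->
  take (num_pos s) s = [seq x <- s | 0 < x].
Proof.
elim: s => [//|x s IH] /=; rewrite path_sortedE; last first.
  by move=> y z w /[swap]; exact: le_trans.
move=> /andP[/allP xs ss]; rewrite /num_pos /=; case: ltP => [x0|x0] /=.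
  by rewrite -/(num_pos s) IH.
have s0 : [seq y <- s | 0 < y] = [::].
  apply/eqP; rewrite -[_ == _]negbK -has_filter; apply/hasPn => y /xs yx.
  by rewrite -leNgt (le_trans yx).
by rewrite s0 add0n -size_filter s0.
Qed.

Lemma sum_affine d (s : seq int) (r : int) :
  \sum_(x <- s) (d%:Z * x - r) = d%:Z * \sum_(x <- s) x - r * (size s)%:Z.
Proof.
elim: s => [|x s IH]; first by rewrite !big_nil /=; lia.
by rewrite !big_cons IH /=; move: (\sum_(y <- s) y) => S; lia.
Qed.

Lemma height_exponentE d s :
  height_exponent d s =
  \sum_(x <- s | 0 < x) (d%:Z * x - \sum_(y <- s) y).
Proof.
rewrite /height_exponent /level; move: (\sum_(y <- s) y) => r.
have aux (D T C x w : int) : D * (x + T) - w * (1 + C) = D * x - w + (D * T - w * C) by ring.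
rewrite /num_pos; elim: s => [|x s IH]; first by rewrite !big_nil /=; lia.
rewrite !big_cons /=; move: IH; move: (\sum_(y <- s) pos_part y)%N => S.
move: (\sum_(y <- s | _) _) => S' <-; rewrite /pos_part; case: ltP => [x0|_].
  have -> : (`|x|%N + S)%N%:Z = x + S%:Z by rewrite PoszD gez0_abs // ltW.
  exact: (aux d%:Z S%:Z (count (fun y => 0 < y) s)%:Z x r).
by [].
Qed.

Lemma height_exponent_take d s : sorted >=%R s -> height_exponent d s =
  \sum_(x <- take (num_pos s) s) (d%:Z * x - \sum_(y <- s) y).
Proof. by move=> ss; rewrite height_exponentE (sorted_take_pos ss) big_filter. Qed.

Variables (d : nat) (s : seq int).
Hypotheses (d0 : (0 < d)%N) (ns : normal_type d s).

Let sd : size s = d. Proof. by case/and3P: ns => /eqP. Qed.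
Let ss : sorted >=%R s. Proof. by case/and3P: ns. Qed.

(** With r the sum of s and 0 <= r < d, the number d x - r is at least 0 for x > 0 and at most 0 for
    x <= 0, so no initial segment does better than the positive terms. *)
Lemma height_exponent_ge j : (j <= d)%N ->
  d%:Z * (\sum_(i < j) nth 0 s i) - j%:Z * (\sum_(x <- s) x) <= height_exponent d s.
Proof.
move=> jd; have [r0 rd] : 0 <= \sum_(x <- s) x /\ \sum_(x <- s) x < d%:Z.
  by case/and3P: ns => _ _ /andP.
rewrite height_exponentE; move: r0 rd; move: (\sum_(x <- s) x) => r r0 rd.
have sz : size (take j s) = j by rewrite size_takel // sd.
have -> : \sum_(i < j) nth 0 s i = \sum_(x <- take j s) x.
  rewrite (big_nth 0) sz big_mkord; apply: eq_bigr => i _.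
  by rewrite nth_take.
have -> : d%:Z * (\sum_(x <- take j s) x) - j%:Z * r = \sum_(x <- take j s) (d%:Z * x - r).
  by rewrite sum_affine sz [r * _]mulrC.
have pos x : 0 < x -> 0 <= d%:Z * x - r by move: rd; clear; nia.
have neg x : x <= 0 -> d%:Z * x - r <= 0 by move: r0 d0; clear; nia.
rewrite -{2}[s](cat_take_drop j) big_cat /= -[leLHS]addr0; apply: lerD.
  rewrite [leRHS]big_mkcond; apply: ler_sum => x _.
  by case: ltP => // /neg.
by apply: sumr_ge0 => x /pos.
Qed.

Lemma height_exponent_max : exists2 j, (0 < j <= d)%N &
  d%:Z * (\sum_(i < j) nth 0 s i) - j%:Z * (\sum_(x <- s) x) = height_exponent d s.
Proof.
have [n0|n0] := posnP (num_pos s).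
  (* The value j = 0 is excluded from the maximum; j = d gives 0 as well. *)
  exists d; first by rewrite d0 leqnn.
  have -> : \sum_(i < d) nth 0 s i = \sum_(x <- s) x.
    by rewrite (big_nth 0) sd big_mkord.
  by rewrite (height_exponent_take _ ss) n0 take0 big_nil subrr.
exists (num_pos s); first by rewrite n0 -sd count_size.
rewrite (height_exponent_take _ ss)
  sum_affine size_takel ?count_size // [_ * (num_pos s)%:Z]mulrC.
congr (_ * _ - _); rewrite [RHS](big_nth 0) size_takel ?count_size // big_mkord.
by apply: eq_bigr => i _; rewrite nth_take.
Qed.

End HeightExponent.

Section Inverse.
Variables (R : realType) (k : finFieldType) (V : lfield R k) (d : nat).
Local Notation of_ := (lof V).
Local Notation op := (lop V).

(** The height is that of g^-1 k[t]^d, so P and Q change sides and the exponents change sign. *)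
Lemma invmx_birkhoff (s : seq int) (c : lF V) (P : 'M[{poly k}]_d) (Q : 'M[fps k]_d) :
  c != 0 -> P \in unitmx -> Q \in unitmx ->
  invmx (c *: (map_mx op P *m sdiag V d s *m map_mx of_ Q)) =
  c^-1 *: (map_mx of_ (invmx Q) *m tdiag V (fun i : 'I_d => - nth 0 s i) *m
           map_mx op (invmx P)).
Proof.
move=> c0 Pu Qu; set M := map_mx op P *m _ *m _; set h := RHS.
have Mu : M \in unitmx by rewrite !unitmx_mul !rmorph_unitmx ?tdiag_unit.
have hM : h *m (c *: M) = 1%:M.
  rewrite /h -scalemxAl -scalemxAr scalerA mulVf // scale1r /M -!mulmxA map_invmxK //.
  rewrite (mulmxA (tdiag _ _) (sdiag _ _ _)).
  have -> : tdiag V (fun i : 'I_d => - nth 0 s i) *m sdiag V d s = 1%:M.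
    apply/matrixP => i j; rewrite mul_tdiag tdiagE mulrnAr -expfzDr ?lt_neq0 //.
    by rewrite addNr expr0z mxE.
  by rewrite mul1mx -map_mxM mulVmx // map_mx1.
have cMu : c *: M \in unitmx by rewrite unitmxZ // unitfE.
by rewrite -[LHS]mul1mx -hM mulmxK.
Qed.

End Inverse.

Section Classes.
Variables (R : realType) (k : finFieldType) (d : nat).
Hypothesis d0 : (0 < d)%N.
Local Notation V := (laurent_lfield R k).
Local Notation F := (lF V).
Local Notation of_ := (lof V).
Local Notation op := (lop V).
Local Notation t := (lt V).
Local Notation deg := (@ldeg _ _ V).
Local Notation q := (#|k|%:R : R).
Local Notation G := (PGL F d).
Local Notation Gam := (@PGL_poly k d).
Local Notation K := (@PGL_integers k d).

Let g1 : Gam 1%g := @PGL_image1 _ _ (lop V) d.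
Let gM : forall x y, Gam x -> Gam y -> Gam (x * y)%g := @PGL_imageM _ _ (lop V) d.
Let gV : forall x, Gam x -> Gam x^-1%g := @PGL_imageV _ _ (lop V) d.
Let i1 : K 1%g := @PGL_image1 _ _ (lof V) d.
Let iM : forall x y, K x -> K y -> K (x * y)%g := @PGL_imageM _ _ (lof V) d.
Let iV : forall x, K x -> K x^-1%g := @PGL_imageV _ _ (lof V) d.

Lemma dcoset_diagP (s : seq int) (g : GL F d) :
  dcoset Gam K (@diag_PGL R k V d s) (toPGL g) <->
  exists (P : 'M[{poly k}]_d) (Q : 'M[fps k]_d) (c : F),
    [/\ P \in unitmx, Q \in unitmx, c != 0 &
        GLmx g = c *: (map_mx op P *m sdiag V d s *m map_mx of_ Q)].
Proof.
split=> [[a [b [[ga [-> [P Pu gaE]]] [gb [-> [Q Qu gbE]]] E]]]|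
         [P [Q [c [Pu Qu c0 E]]]]].
  have /esym/toPGL_eqP[c c0 E'] :
      toPGL g = toPGL (GL_mul (GL_mul ga (diag_GL V d s)) gb).
    by rewrite E -!toPGL_M.
  exists P, Q, c; split=> //.
  by rewrite E' /= gaE gbE.
have pu := rmorph_unitmx op Pu; have qu := rmorph_unitmx of_ Qu.
exists (toPGL (MkGL pu)), (toPGL (MkGL qu)); split.
- by exists (MkGL pu); split=> //; exists P.
- by exists (MkGL qu); split=> //; exists Q.
apply/esym; rewrite [LHS](_ : _ = toPGL (GL_mul (GL_mul (MkGL pu) (diag_GL V d s)) (MkGL qu))).
  by apply/(@toPGL_eqP R k V); exists c.
by rewrite -!toPGL_M.
Qed.

Lemma diag_classP (s : seq int) (y : Yquot k d) :
  y = diag_class R k d s <->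
  exists (P : 'M[{poly k}]_d) (Q : 'M[fps k]_d) (c : F),
    [/\ P \in unitmx, Q \in unitmx, c != 0 &
        GLmx (generic_quotient.repr (dq_repr y)) = c *: (map_mx op P *m sdiag V d s *m map_mx of_ Q)].
Proof.
rewrite -dcoset_diagP reprPGL -(to_dquot_eq g1 gM gV i1 iM iV).
by rewrite (to_dquot_repr g1 gM gV i1 iM iV).
Qed.

Lemma sdiag_shift (s : seq int) (c : int) : size s = d ->
  sdiag V d [seq x + c | x <- s] = t ^ c *: sdiag V d s.
Proof.
move=> sd; apply/matrixP => i j; rewrite [RHS]mxE !tdiagE.
rewrite (nth_map 0) ?sd ?ltn_ord // expfzDr ?lt_neq0 // mulrnAr.
by rewrite mulrC.
Qed.

Lemma sum_shift (s : seq int) (c : int) :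
  \sum_(x <- [seq x + c | x <- s]) x = \sum_(x <- s) x + c * (size s)%:Z.
Proof. by rewrite big_map big_split /= big_const_seq count_predT iter_addr_0 -mulr_natr natz. Qed.

Lemma diag_class_surj (y : Yquot k d) : exists2 s, normal_type d s & y = diag_class R k d s.
Proof.
have [P [Q [s [Pu Qu sd ss E]]]] := @birkhoff_sorted R k V d _ (Defs.GL_unit (generic_quotient.repr (dq_repr y))).
(* Minus the floor of the mean: this shift brings the sum of the exponents into [0, d). *)
pose c := - ((\sum_(x <- s) x) %/ d%:Z)%Z.
have dz : d%:Z != 0 by rewrite eqz_nat -lt0n.
exists [seq x + c | x <- s].
  apply/and3P; split; first by rewrite size_map sd.
    rewrite sorted_map; apply: sub_sorted ss => x z /=.
    by rewrite /relpre /= lerD2r.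
  rewrite sum_shift sd /c mulNr {1 3}(divz_eq (\sum_(x <- s) x) d%:Z) addrAC subrr add0r.
  by rewrite modz_ge0 // ltz_pmod // ltz_nat.
apply/diag_classP; exists P, Q, (t ^ - c); split=> //.
  by rewrite ltz_neq0.
rewrite sdiag_shift // -scalemxAr -scalemxAl scalerA -expfzDr ?lt_neq0 //.
by rewrite addNr expr0z scale1r.
Qed.

Lemma diag_class_inj (s1 s2 : seq int) : normal_type d s1 -> normal_type d s2 ->
  diag_class R k d s1 = diag_class R k d s2 :> Yquot k d -> s1 = s2.
Proof.
move=> /and3P[/eqP sd1 ss1 /andP[s10 s1d]] /and3P[/eqP sd2 ss2 /andP[s20 s2d]].
move=> /esym/(to_dquot_eq g1 gM gV i1 iM iV)/dcoset_diagP[P [Q [c [Pu Qu c0 E]]]].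
have E' : map_mx op P *m sdiag V d s1 *m map_mx of_ Q = c^-1 *: sdiag V d s2.
  have -> : sdiag V d s2 = GLmx (diag_GL V d s2) by [].
  by rewrite E scalerA mulVf // scale1r.
have cV : c^-1 != 0 by rewrite invr_eq0.
have Es := birkhoff_unique Pu Qu cV sd1 sd2 ss1 ss2 E'.
(* The sums of the two types differ by d times the shift; both lie in [0, d), so the shift is 0. *)
suff e0 : deg c^-1 = 0 by rewrite Es e0 -[RHS]map_id; apply: eq_map => x; rewrite addr0.
have := congr1 (fun s : seq int => \sum_(x <- s) x) Es; rewrite sum_shift sd2.
move: s10 s1d s20 s2d; move: (\sum_(x <- s1) x) (\sum_(x <- s2) x) (deg _).
by move: d0; clear; nia.
Qed.

(** For each j the best vectors realize the least wedge norm; what remains is the maximum over j of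
    d S_j - j S_d, which is the height exponent. *)
Lemma alpha_diag_class (s : seq int) : normal_type d s ->
  alpha R (diag_class R k d s : Yquot k d) = q `^ ((height_exponent d s)%:~R / d%:R).
Proof.
move=> /[dup] ns /and3P[/eqP sd ss /andP[r0 rd]].
have [P [Q [c [Pu Qu c0 E]]]] := (diag_classP s _).1 erefl.
rewrite /alpha; set g := generic_quotient.repr _ in E *.
have Pu' : invmx P \in unitmx by rewrite unitmx_inv.
have Qu' : invmx Q \in unitmx by rewrite unitmx_inv.
have cV : c^-1 != 0 by rewrite invr_eq0.
pose e := deg c^-1.
have hE : GLmx g^-1%g = c^-1 *: (map_mx of_ (invmx Q) *m
    tdiag V (fun i : 'I_d => - nth 0 s i) *m map_mx op (invmx P)).
  by rewrite -(invmx_birkhoff (V := V) s c0 Pu Qu) -E.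
have q1 : 1 < q by rewrite ltr1n card_gt1.
have q0 : 0 <= q by rewrite ler0n.
pose S j := \sum_(i < j) nth 0 s i.
have Sd : S d = \sum_(x <- s) x by rewrite (big_nth 0) sd big_mkord.
have dR : d%:R != 0 :> R by rewrite pnatr_eq0 -lt0n.
(* The degree e of the scalar cancels between covolume and wedge norm, as homothety invariance
   demands. *)
have value j : covol R g^-1%g `^ (j%:R / d%:R) * (q ^ (e * j%:Z - S j))^-1 =
    q `^ ((d%:Z * S j - j%:Z * S d)%:~R / d%:R).
  rewrite /covol hE [absv _ _](@covol_diag R k V d s c^-1 (invmx Q) (invmx P) sd ss cV Qu' Pu') -/e -/(S d).
  rewrite -powR_intmul // -powRrM invr_expz -powR_intmul // -powRD; last first.
    by apply/implyP => _; rewrite gt_eqF // (lt_trans ltr01).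
  congr (_ `^ _); apply: (mulIf dR); rewrite mulrDl mulfVK // -mulrA mulfVK //.
  by clearbody e; rewrite !(rmorphB, rmorphM, rmorphN) /= -!pmulrn; ring.
have cast j (W : 'M[F]_(d, j)) : wedge_norm R W = wedge (V := V) W by [].
have ub : forall r, (exists j (M : 'M[F]_(d, j)),
    [/\ (1 <= j <= d)%N, forall b, lattice g^-1%g (col b M), row_free M^T &
        r = covol R g^-1%g `^ (j%:R / d%:R) * (wedge_norm R M)^-1]) ->
    r <= q `^ ((height_exponent d s)%:~R / d%:R).
  move=> _ [j [M [/andP[j0 jd] Mlat Mf ->]]].
  have /boolp.choice[f Hf] : forall i : 'I_j, exists w : 'cV[{poly k}]_d,
      col i M = GLmx g^-1%g *m map_mx op w by exact: Mlat.
  pose W : 'M[{poly k}]_(d, j) := \matrix_(a, b) f b a ord0.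
  have ME : M = GLmx g^-1%g *m map_mx op W.
    apply/matrixP => a b; have /matrixP/(_ a ord0) := Hf b; rewrite !mxE => ->.
    by apply: eq_bigr => l _; rewrite !mxE.
  have := @wedge_lattice_ge R k V d s c^-1 (invmx Q) (invmx P) sd ss cV Qu' j W.
  rewrite -hE -ME => /(_ Mf) wge.
  apply: (@le_trans _ _ (q `^ ((d%:Z * S j - j%:Z * S d)%:~R / d%:R))).
    rewrite -value ler_wpM2l ?powR_ge0 // cast lef_pV2 ?posrE //.
      by apply: lt_le_trans wge; rewrite exprz_gt0 // q_gt0.
    by rewrite exprz_gt0 // q_gt0.
  apply: ler_powR; first exact: ltW.
  rewrite ler_pM2r ?invr_gt0 ?ltr0n // ler_int.
  by rewrite Sd; exact: height_exponent_ge.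
have attained : exists j (M : 'M[F]_(d, j)),
    [/\ (1 <= j <= d)%N, forall b, lattice g^-1%g (col b M), row_free M^T &
        q `^ ((height_exponent d s)%:~R / d%:R) =
        covol R g^-1%g `^ (j%:R / d%:R) * (wedge_norm R M)^-1].
  have [j /andP[j0 jd] Ej] := height_exponent_max d0 ns.
  have [W [Wf Wm]] := @wedge_lattice_min R k V d s c^-1 (invmx Q) (invmx P) sd ss cV Qu' Pu' j jd.
  exists j, (GLmx g^-1%g *m map_mx op W); split; [by rewrite j0| | by rewrite hE|].
    by move=> i; exists (col i W); rewrite colE -mulmxA -colE -map_col.
  by rewrite -Ej -/(S j) -Sd -value cast hE Wm.
apply/le_anti/andP; split.
  by apply: ge_sup ub; eexists; exact: attained.
by apply: ub_le_sup attained; eexists; exact: ub.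
Qed.

End Classes.

(** * Summation of the zeta integral *)

Section HeightSeries.
Variable K : fieldType.
Implicit Types q u w b : K.

(* The sum over [M] of [w ^ M] times the product of the [1 - c * b ^ M], [c \in l]. *)
Fixpoint geo_prod b (l : seq K) w : K :=
  if l is c :: l' then geo_prod b l' w - c * geo_prod b l' (w * b) else (1 - w)^-1.

(** The constant denominators 1 - q^(-i) of [mass_poly]. *)
Definition qfactors q n : K := foldr (fun i x => (1 - (q ^+ i)^-1) * x) 1 (iota 1 n.-1).

(** The sum over N = m + M, M >= 0, of the contributions with total r and n positive terms. The
    least level m is r, but 1 if r = 0, since a positive term forces N > 0. The height gives u^(d N
    - r n), the masses its counterpart in q^-1, whence the ratio (u / q)^d; the two lists come from
    the products in the masses of the two pieces. *)
Definition series_term d q u (r n : nat) : K :=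
  let m := if r is 0 then 1%N else r in
  (u / q) ^+ (d * m - r * n) /
  (gl_poly q n * gl_poly q (d - n) * qfactors q n * qfactors q (d - n) * q ^+ (n * (d - n))) *
  geo_prod q^-1 ([seq q ^+ a / q ^+ m | a <- iota 1 n.-1] ++
                 [seq (q ^+ i * q ^+ (m - r))^-1 | i <- iota 1 (d - n).-1]) ((u / q) ^+ d).

(** The isolated term is the zero type, the only one with n = 0. Folding over [iota] lets
    simplification produce an explicit rational expression for concrete d. *)
Definition height_series d q u : K :=
  (q - 1) * ((gl_poly q d)^-1 +
    foldr (fun r x => foldr (fun n y => series_term d q u r n + y) 0 (iota 1 d.-1) + x) 0 (iota 0 d)).

Lemma foldr_prodr I (s : seq I) (F : I -> K) :
  foldr (fun i x => F i * x) 1 s = \prod_(i <- s) F i.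
Proof. by elim: s => [|i s IH] /=; rewrite ?big_nil // big_cons IH. Qed.

Lemma foldr_sumr I (s : seq I) (F : I -> K) :
  foldr (fun i x => F i + x) 0 s = \sum_(i <- s) F i.
Proof. by elim: s => [|i s IH] /=; rewrite ?big_nil // big_cons IH. Qed.

Lemma height_seriesE d q u : height_series d q u =
  (q - 1) * ((gl_poly q d)^-1 +
    \sum_(r <- iota 0 d) \sum_(n <- iota 1 d.-1) series_term d q u r n).
Proof.
congr (_ * (_ + _)); rewrite foldr_sumr; apply: eq_bigr => r _.
by rewrite foldr_sumr.
Qed.

Lemma mass_polyE q n Y : mass_poly q n Y =
  (gl_poly q n * qfactors q n)^-1 * \prod_(i <- iota 1 n.-1) (1 - (Y * q ^+ i)^-1).
Proof.
rewrite /mass_poly /qfactors foldr_prodr [(gl_poly q n * _)^-1]invfM -mulrA; congr (_ * _).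
have <- : index_iota 1 n = iota 1 n.-1 by rewrite /index_iota subn1.
by rewrite prodf_div mulrC.
Qed.

Lemma big_iota_rev n (F : nat -> K) :
  \prod_(i <- iota 1 n.-1) F (n - i)%N = \prod_(i <- iota 1 n.-1) F i.
Proof.
have E : iota 1 n.-1 = index_iota 1 n by rewrite /index_iota subn1.
by rewrite E [RHS]big_nat_rev /=; apply: eq_bigr => i _; rewrite add1n subSS.
Qed.

End HeightSeries.

Section Summation.
Variables (R : realType) (k : finFieldType).
Local Notation C := R[i].
Local Notation nrm := (@normc R).
Local Notation q := (#|k|%:R : C).
Variables (d : nat) (z : C).
Hypotheses (d0 : (0 < d <= 5)%N) (zq : nrm z < #|k|%:R).

Lemma csum_geometric (w : C) : nrm w < 1 -> csum (fun n => w ^+ n) (1 - w)^-1.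
Proof.
move=> w1.
have [l Hl] : exists l, csum (fun n => w ^+ n) l.
  apply: (@csum_dominated _ _ 1 (nrm w)); first by rewrite nrm_ge0.
  by move=> n; rewrite nrmX mul1r.
have H' := csumM w (csum_shift 1 Hl).
have H'' := csumD H' (csum_delta 1).
have E : l = w * l + 1.
  apply: (csum_unique Hl); apply: eq_csum H'' => -[|n] /=; first by rewrite mulr0 add0r.
  by rewrite subn1 exprS addr0.
have w1' : 1 - w != 0.
  rewrite subr_eq0; apply: contraTneq w1 => <-.
  by rewrite nrm1 ltxx.
suff -> : (1 - w)^-1 = l by [].
by apply: (mulfI w1'); rewrite mulfV // mulrBl mul1r {1}E addrAC subrr add0r.
Qed.

(** Expanding the first factor 1 - c b^M splits the sum into the sums for the shorter list at w and
    at w b. *)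
Lemma csum_geo_prod (b w : C) (l : seq C) : nrm b <= 1 -> nrm w < 1 ->
  csum (fun M => w ^+ M * \prod_(c <- l) (1 - c * b ^+ M)) (geo_prod b l w).
Proof.
move=> b1; elim: l w => [|c l IH] w w1 /=.
  by apply: eq_csum (csum_geometric w1) => n; rewrite big_nil mulr1.
have wb : nrm (w * b) < 1.
  by rewrite normcM (le_lt_trans _ w1) // ler_piMr // nrm_ge0.
have H := csumD (IH w w1) (csumM (- c) (IH _ wb)).
rewrite -mulNr; apply: eq_csum H => M; rewrite big_cons exprMn mulNr.
rewrite mulrBl mulrBr mul1r; congr (_ - _); ring.
Qed.

Lemma csum_bigsum I (s : seq I) (a : I -> nat -> C) (l : I -> C) :
  (forall i, csum (a i) (l i)) -> csum (fun N => \sum_(i <- s) a i N) (\sum_(i <- s) l i).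
Proof.
move=> H; elim: s => [|i s IH].
  rewrite big_nil; apply: eq_csum (csum_delta 0) => n.
  by rewrite big_nil; case: ifP.
by rewrite big_cons; apply: eq_csum (csumD (H i) IH) => n; rewrite big_cons.
Qed.

Let qC0 : q != 0 := qK_neq0 k C.

Lemma nrm_natr n : nrm (n%:R : C) = n%:R.
Proof. by rewrite -(rmorph_nat (real_complex R)) nrm_real normr_nat. Qed.

Let qR0 : 0 < #|k|%:R :> R := q_gt0 R k.

Lemma nrm_ratio : nrm (z / q) < 1.
Proof. by rewrite normcM normcV nrm_natr ltr_pdivrMr ?mul1r. Qed.

Lemma csum_level_term r n : (r < d)%N -> (0 < n < d)%N ->
  csum (fun N => level_mass k C d N r n * z ^+ (d * N - r * n)) (series_term d q z r n).
Proof.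
move=> rd /andP[n0 nd]; rewrite /series_term; set m := match r with 0 => _ | _ => _ end.
have d5 : (d <= 5)%N by case/andP: d0.
have rm : (r <= m)%N by rewrite /m; case: (r).
have m0 : (0 < m)%N by rewrite /m; case: (r).
have w1 : nrm ((z / q) ^+ d) < 1.
  by rewrite nrmX exprn_ilt1 ?nrm_ge0 ?nrm_ratio // -lt0n; case/andP: d0.
have b1 : nrm q^-1 <= 1 by rewrite normcV nrm_natr invf_le1 // ler1n (ltnW (card_gt1 k)).
set l := _ ++ _; set A := (X in X * geo_prod _ _ _).
have rn : (r * n <= d * m)%N by rewrite mulnC leq_mul // ltnW.
apply: eq_csum (csum_shift m (csumM A (@csum_geo_prod _ _ l b1 w1))) => N.
(* Below level m the mass is 0: for r = 0 this means N = 0, where no positive term fits, and for r >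
   0 it means N < r. *)
case: ltnP => [Nm|mN].
  rewrite /level_mass; have [r0|r0] := posnP r.
    have N0 : N = 0%N by move: Nm; rewrite /m r0 ltnS leqn0 => /eqP.
    by rewrite N0 leqNgt n0 /= !mul0r.
  have -> : (r <= N)%N = false.
    by apply/negbTE; rewrite -ltnNge; move: Nm; rewrite /m; case: (r) r0.
  by rewrite mulr0 !mul0r.
set M := (N - m)%N; have NE : N = (M + m)%N by rewrite subnK.
have N0 : (0 < N)%N by exact: leq_trans mN.
have rN : (r <= N)%N by exact: leq_trans mN.
rewrite /level_mass parts_mass_truncated ?n0 //; last by rewrite -ltnS (leq_trans nd).
have dn4 : (0 < d - n <= 4)%N by rewrite subn_gt0 nd /= leq_subLR; lia.
rewrite rN parts_massE // !mass_polyE /l big_cat !big_map /=.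
have -> : \prod_(i <- iota 1 n.-1) (1 - (q ^+ N / q ^+ n * q ^+ i)^-1) =
    \prod_(i <- iota 1 n.-1) (1 - q ^+ i / q ^+ m * q^-1 ^+ M).
  (* The list of [series_term] is indexed by a = n - i. *)
  rewrite -[RHS](big_iota_rev n) big_seq [RHS]big_seq; apply: eq_bigr => i.
  rewrite mem_iota => /andP[i1 i2]; congr (1 - _).
  have nE : n = (n - i + i)%N by rewrite subnK //; lia.
  rewrite NE exprD {1}nE exprD exprVn; field.
  by rewrite !expf_neq0.
have -> : \prod_(i <- iota 1 (d - n).-1) (1 - (q ^+ (N - r) * q ^+ i)^-1) =
    \prod_(i <- iota 1 (d - n).-1) (1 - (q ^+ i * q ^+ (m - r))^-1 * q^-1 ^+ M).
  apply: eq_bigr => i _; congr (1 - _).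
  rewrite NE -addnBA // exprD exprVn; field.
  by rewrite !expf_neq0.
have -> : ((d - n) * N + n * (N - r) + n * (d - n))%N = (d * N - r * n + n * (d - n))%N.
  rewrite mulnBl mulnBr [(r * n)%N]mulnC; congr addn.
  have h1 : (n * N <= d * N)%N by rewrite leq_mul2r ltnW ?orbT.
  have h2 : (n * r <= n * N)%N by rewrite leq_mul2l rN orbT.
  by lia.
have -> : (d * N - r * n)%N = (d * M + (d * m - r * n))%N by rewrite NE mulnDr addnBA.
rewrite /A !exprD !exprM.
set P1 := \prod_(i <- _) _; set P2 := \prod_(i <- _) _.
rewrite !invfM !expr_div_n -!exprM; set e := (d * m - r * n)%N; ring.
Qed.

Lemma csum_level : csum (fun N => (q - 1) *
    \sum_(r < d) \sum_(n < d.+1) level_mass k C d N r n * z ^+ (d * N - r * n))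
  (height_series d q z).
Proof.
have d1 : (0 < d)%N by case/andP: d0.
rewrite height_seriesE; apply: csumM.
pose S r := (if r == 0%N then (gl_poly q d)^-1 else 0) +
  \sum_(n <- iota 1 d.-1) series_term d q z r n.
have -> : (gl_poly q d)^-1 + \sum_(r <- iota 0 d) \sum_(n <- iota 1 d.-1) series_term d q z r n =
    \sum_(r <- iota 0 d) S r.
  rewrite big_split /=; congr (_ + _).
  by rewrite -[d]prednK //= big_cons /= big1_seq ?addr0 // => i; rewrite mem_iota; case: i.
have key r : csum (fun N => if (r < d)%N then
    \sum_(n < d.+1) level_mass k C d N r n * z ^+ (d * N - r * n) else 0)
    (if (r < d)%N then S r else 0).
  case: ltnP => rd; last by apply: eq_csum (csum_delta 0) => n; case: ifP.
  pose T n N := if (0 < n < d)%N then level_mass k C d N r n * z ^+ (d * N - r * n) else 0.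
  pose l n := if (0 < n < d)%N then series_term d q z r n else 0.
  have Tl n : csum (T n) (l n).
    rewrite /T /l; case: ifP => nd; first exact: csum_level_term.
    by apply: eq_csum (csum_delta 0) => N; case: ifP.
  (* Without positive terms the level is 0, which leaves only the zero type, of total r = 0. *)
  have H0 : csum (fun N => level_mass k C d N r 0 * z ^+ (d * N - r * 0))
      (if r == 0%N then (gl_poly q d)^-1 else 0).
    apply: eq_csum (csum_delta _) => -[|N] /=; rewrite /level_mass.
      case: (r) => [|r'] /=; last by rewrite mulr0 !mul0r.
      rewrite !subn0 !parts_mass_0r muln0 !muln0 !expr0 divr1 mulr1.
      by rewrite gl_poly_expand invr1 mul1r.
    by rewrite parts_mass_0l !mul0r.
  have := csumD H0 (@csum_bigsum _ (iota 1 d.-1) T l Tl).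
  have -> : \sum_(n <- iota 1 d.-1) l n = \sum_(n <- iota 1 d.-1) series_term d q z r n.
    rewrite big_seq [RHS]big_seq; apply: eq_bigr => n; rewrite mem_iota => /andP[n1 n2].
    by rewrite /l ifT //; lia.
  apply: eq_csum => N; rewrite -(big_mkord xpredT (fun n =>
    level_mass k C d N r n * z ^+ (d * N - r * n))) big_ltn // big_nat_recr //=.
  (* If all d terms are positive, then N >= d > r, and the empty remaining piece cannot have degree
     N - r > 0. *)
  have -> : level_mass k C d N r d = 0.
    rewrite /level_mass subnn; case: (leqP d N) => dN; last by rewrite !mul0r.
    case: (leqP r N) => rN; last by rewrite mulr0 mul0r.
    have -> : (N - r)%N = (N - r).-1.+1 by rewrite prednK // subn_gt0 (leq_trans rd).
    by rewrite parts_mass_0l mulr0 mul0r.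
  rewrite mul0r addr0; congr (_ + _).
  have <- : index_iota 1 d = iota 1 d.-1 by rewrite /index_iota subn1.
  by rewrite big_nat [RHS]big_nat; apply: eq_bigr => n nd; rewrite /T nd.
have := @csum_bigsum _ (iota 0 d) _ _ key.
have -> : \sum_(r <- iota 0 d) (if (r < d)%N then S r else 0) = \sum_(r <- iota 0 d) S r.
  by rewrite big_seq [RHS]big_seq; apply: eq_bigr => r; rewrite mem_iota /= => ->.
apply: eq_csum => N; rewrite -(big_mkord xpredT (fun r =>
  \sum_(n < d.+1) level_mass k C d N r n * z ^+ (d * N - r * n))) /index_iota subn0.
by rewrite big_seq [RHS]big_seq; apply: eq_bigr => r; rewrite mem_iota /= => ->.
Qed.

End Summation.

Section ClosedForms.
Variables (R : realType) (k : finFieldType).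
Local Notation C := R[i].
Local Notation nrm := (@normc R).
Local Notation q := (#|k|%:R : C).
Variables (z : C).
Hypothesis zq : nrm z < #|k|%:R.

(** Comparison of moduli: |z|^b < q^b <= q^a. *)
Lemma expr_neq_of_lt a b : (0 < b <= a)%N -> q ^+ a != z ^+ b /\ q ^+ a != - z ^+ b.
Proof.
move=> /andP[b0 ba].
have lt : nrm (z ^+ b) < nrm (q ^+ a).
  rewrite !nrmX nrm_natr; apply: (@lt_le_trans _ _ (#|k|%:R ^+ b)).
    by rewrite ltrXn2r ?nrm_ge0 // -lt0n.
  by rewrite ler_weXn2l // ler1n (ltnW (card_gt1 k)).
split; apply: contraTneq lt => ->; rewrite ?normcN ltxx //.
Qed.

Lemma sub_expr_neq0 a b : (0 < b <= a)%N -> q ^+ a - z ^+ b != 0.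
Proof. by rewrite subr_eq0 => /expr_neq_of_lt[]. Qed.

Lemma add_expr_neq0 a b : (0 < b <= a)%N -> q ^+ a + z ^+ b != 0.
Proof. by rewrite addr_eq0 => /expr_neq_of_lt[]. Qed.

Let q0 : 0 < q. Proof. by rewrite ltr0n (ltnW (card_gt1 k)). Qed.
Let qn0 : q != 0 := qK_neq0 k C.
Let q1 : q - 1 != 0. Proof. by rewrite -{1}[q]expr1 qKX_neq1. Qed.
Let q2 : q + 1 != 0. Proof. by rewrite gt_eqF // !(addr_gt0, exprn_gt0, ltr01). Qed.
Let q3 : q ^+ 2 + 1 != 0. Proof. by rewrite gt_eqF // !(addr_gt0, exprn_gt0, ltr01). Qed.
Let q4 : q ^+ 2 + q + 1 != 0. Proof. by rewrite gt_eqF // !(addr_gt0, exprn_gt0, ltr01). Qed.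
Let q5 : q ^+ 4 + q ^+ 3 + q ^+ 2 + q + 1 != 0.
Proof. by rewrite gt_eqF // !(addr_gt0, exprn_gt0, ltr01). Qed.
Let d1 : q - z != 0. Proof. by rewrite -[q]expr1 -[z]expr1 sub_expr_neq0. Qed.
Let d1' : q + z != 0. Proof. by rewrite -[q]expr1 -[z]expr1 add_expr_neq0. Qed.

Lemma D3_neq0 : D3 q z != 0.
Proof. by rewrite /D3 !mulf_neq0 ?expf_neq0 // sub_expr_neq0. Qed.

Lemma D4_neq0 : D4 q z != 0.
Proof. by rewrite /D4 !mulf_neq0 ?expf_neq0 // ?sub_expr_neq0 ?add_expr_neq0. Qed.

Lemma D5_neq0 : D5 q z != 0.
Proof. by rewrite /D5 !mulf_neq0 ?expf_neq0 // sub_expr_neq0. Qed.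

Lemma height_series3 : height_series 3 q z = P3 q z / D3 q z.
Proof.
rewrite /height_series /series_term /qfactors /=.
cbv [muln subn Nat.mul Nat.sub Nat.add].
rewrite !gl_poly_expand /P3 /D3; field.
by rewrite ?sub_expr_neq0 ?qKX_neq1 // qn0 q1 q2 q4 d1.
Qed.

Lemma height_series4 : height_series 4 q z = P4 q z / D4 q z.
Proof.
rewrite /height_series /series_term /qfactors /=.
cbv [muln subn Nat.mul Nat.sub Nat.add].
rewrite !gl_poly_expand /P4 /D4; field.
rewrite -!exprSr ?sub_expr_neq0 ?add_expr_neq0 ?qKX_neq1 //.
by rewrite qn0 q1 q2 q3 q4 d1 d1'.
Qed.

Lemma height_series5 : height_series 5 q z = P5 q z / D5 q z.
Proof.
rewrite /height_series /series_term /qfactors /=.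
cbv [muln subn Nat.mul Nat.sub Nat.add].
rewrite !gl_poly_expand /P5 /D5; field.
rewrite ?sub_expr_neq0 ?add_expr_neq0 ?qKX_neq1 //.
by rewrite qn0 q1 q2 q3 q4 q5 d1.
Qed.

End ClosedForms.

Section ComplexCoordinates.
Variable R : realType.
Local Notation C := R[i].
Local Notation nrm := (@normc R).

Lemma csum_Re (a : nat -> C) l : csum a l ->
  series (fun n => complex.Re (a n)) @ \oo --> complex.Re l.
Proof.
move=> /cvg_cplxP H; apply/cvgrPdist_lt => e e0; have [N HN] := H e e0.
exists N => // n /= /HN; apply: le_lt_trans.
have -> : series (fun n => complex.Re (a n)) n = complex.Re (\sum_(i < n) a i).
  rewrite /series /= big_mkord; elim/big_rec2: _ => // i x y _ ->.
  by case: (a i) => ? ?; case: y.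
apply: le_trans (nrm_Re _); case: (l) => ? ?; by case: (\sum_(i < n) a i).
Qed.

Lemma Re_sum I (s : seq I) (F : I -> C) (m : I -> R) :
  complex.Re (\sum_(i <- s) F i * (m i)%:C%C) = \sum_(i <- s) complex.Re (F i) * m i.
Proof.
elim/big_rec2: _ => // i x y _ <-; case: (F i) => a b; case: y => c e.
by rewrite /= mulr0 subr0.
Qed.

Lemma Im_sum I (s : seq I) (F : I -> C) (m : I -> R) :
  complex.Im (\sum_(i <- s) F i * (m i)%:C%C) = \sum_(i <- s) complex.Im (F i) * m i.
Proof.
elim/big_rec2: _ => // i x y _ <-; case: (F i) => a b; case: y => c e.
by rewrite /= mulr0 add0r.
Qed.

End ComplexCoordinates.

Section HeightIntegral.
Variables (R : realType) (k : finFieldType) (d : nat).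
Hypothesis d0 : (0 < d <= 5)%N.
Variables (mu : {measure set borelG R k d -> \bar R})
  (lam : {measure set borel_bigquot R k d -> \bar R}).
Hypotheses (haar : normalized_haar mu) (quot : quotient_measure mu lam).
Local Notation C := R[i].
Local Notation nrm := (@normc R).
Local Notation q := (#|k|%:R : R).

Let d_gt0 : (0 < d)%N. Proof. by case/andP: d0. Qed.

Let mass (s : seq int) : R := (#|k|.-1)%:R / (aut_card k s)%:R.

Let mass_ge0 s : 0 <= mass s. Proof. by rewrite divr_ge0. Qed.

Let nu : {measure set discreteY k d -> \bar R} :=
  measure_function_pushforward__canonical__measure_function_Measure
    lam (@measurable_fun_class R k d).

Lemma integral_types (g : discreteY k d -> R) :
  cvgn (series (fun n => \sum_(s <- level_types d n) `|g (diag_class R k d s)| * mass s)) ->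
  (nuY lam).-integrable setT (EFin \o g) /\
  series (fun n => \sum_(s <- level_types d n) g (diag_class R k d s) * mass s) @ \oo -->
    fine (\int[nuY lam]_x (g x)%:E)%E.
Proof.
apply: (@countable_integral _ (discreteY k d) R nu (seq int) (level_types d)
  (fun s => diag_class R k d s : discreteY k d) mass).
- exact: measurable_discreteY.
- by move=> n; exact: uniq_level_types.
- move=> n n' s s'; rewrite !mem_level_types => /andP[ns /eqP <-] /andP[ns' /eqP <-].
  by move=> /(diag_class_inj d_gt0 ns ns') ->.
- move=> y; have [s ns ->] := diag_class_surj R d_gt0 y.
  by exists (level s), s; rewrite mem_level_types ns eqxx.
- exact: mass_ge0.
move=> n s; rewrite mem_level_types => /andP[/and3P[/eqP sd _ _] _].
exact: (diag_class_mass d_gt0 haar quot sd).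
Qed.

Lemma level_weight (z : C) N :
  \sum_(s <- level_types d N)
    z ^+ (d * N - `|(\sum_(x <- s) x)%R|%N * num_pos s) * (mass s)%:C%C =
  (#|k|%:R - 1) *
    \sum_(r < d) \sum_(n < d.+1) level_mass k C d N r n * z ^+ (d * N - r * n).
Proof.
rewrite -(@sum_level_types k C d N (fun r n => z ^+ (d * N - r * n))) // mulr_sumr.
apply: eq_bigr => s _; rewrite /mass /type_weight.
have -> : ((#|k|.-1)%:R / (aut_card k s)%:R : R)%:C%C =
    ((#|k|%:R - 1) / (aut_card k s)%:R : C).
  rewrite rmorphM fmorphV !rmorph_nat -subn1 natrB //.
  exact: ltnW (card_gt1 k).
ring.
Qed.

Variable s : C.
Hypothesis sd : complex.Re s < d%:R.
Let u : C := cpow q (s / d%:R).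

Lemma cpow_height (t : seq int) : normal_type d t ->
  cpow (alpha R (diag_class R k d t)) s =
  u ^+ (d * level t - `|(\sum_(x <- t) x)%R|%N * num_pos t).
Proof.
move=> nt; rewrite alpha_diag_class // /u /cpow ln_powR -cexp_mulrn; congr cexp.
(* The case j = 0 of the bound: the exponent is nonnegative, so a natural power of u appears and the
   truncated subtraction is exact. *)
have e0 : 0 <= height_exponent d t.
  by have := height_exponent_ge d_gt0 nt (leq0n d); rewrite big_ord0 mulr0 mul0r subr0.
have eE : height_exponent d t =
    (d * level t - `|(\sum_(x <- t) x)%R|%N * num_pos t)%N%:Z.
  have r0 : 0 <= \sum_(x <- t) x by case/and3P: nt => _ _ /andP[].
  move: e0; rewrite /height_exponent -[in X in X -> _](gez0_abs r0) -[in LHS](gez0_abs r0).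
  by rewrite -!PoszM subr_ge0 lez_nat => le; rewrite subzn.
rewrite eE -pmulrn; set e := (d * _ - _)%N.
have dC : d%:R != 0 :> C by rewrite pnatr_eq0 -lt0n.
rewrite -mulr_natr !rmorphM /= fmorphV !rmorph_nat; field.
exact: dC.
Qed.

Lemma nrm_u : nrm u < q.
Proof.
have q1 : 1 < q by rewrite ltr1n card_gt1.
have q0 : 0 < q by exact: lt_trans q1.
rewrite /u /cpow nrm_cexp -[X in _ < X](lnK q0) ltr_expR.
have -> : complex.Re (s / d%:R * (ln q)%:C%C) = complex.Re s / d%:R * ln q.
  have -> : (d%:R : C)^-1 = (d%:R^-1 : R)%:C%C by rewrite fmorphV rmorph_nat.
  by case: (s) => a b /=; rewrite !mulr0 !subr0.
by rewrite gtr_pMl ?ln_gt0 // ltr_pdivrMr ?mul1r // ltr0n.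
Qed.

Lemma height_integral :
  let f := fun y : discreteY k d => cpow (alpha R y) s in
  abs_integrable (nuY lam) f /\ cintegral (nuY lam) f = height_series d #|k|%:R u.
Proof.
move=> f; pose a N : C := \sum_(t <- level_types d N) f (diag_class R k d t) * (mass t)%:C%C.
have aE N : a N = \sum_(t <- level_types d N)
    u ^+ (d * N - `|(\sum_(x <- t) x)%R|%N * num_pos t) * (mass t)%:C%C.
  rewrite /a big_seq [RHS]big_seq; apply: eq_bigr => t.
  by rewrite mem_level_types => /andP[nt /eqP <-]; rewrite /f cpow_height.
have asum : csum a (height_series d #|k|%:R u).
  apply: eq_csum (csum_level d0 nrm_u) => N.
  by rewrite aE level_weight.
pose b N : R := \sum_(t <- level_types d N) nrm (f (diag_class R k d t)) * mass t.
have bcvg : cvgn (series b).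
  (* The masses are nonnegative, so the sum of the absolute values is the same series at the real
     point |u|, which lies in the disc of radius q too. *)
  pose v : C := (nrm u)%:C%C.
  have vq : nrm v < q by rewrite nrm_real ger0_norm ?nrm_ge0 // nrm_u.
  have := csum_Re (csum_level d0 vq) => H; apply/cvg_ex; eexists.
  suff -> : b = (fun n => complex.Re ((#|k|%:R - 1) *
    \sum_(r < d) \sum_(m < d.+1) level_mass k C d n r m * v ^+ (d * n - r * m))) by exact: H.
  apply/funext => N; rewrite -level_weight Re_sum /b big_seq [RHS]big_seq.
  apply: eq_bigr => t; rewrite mem_level_types => /andP[nt /eqP <-].
  by rewrite /f cpow_height // nrmX /v -rmorphXn.
have part (g : C -> R) : (forall z, `|g z| <= nrm z) ->
    cvgn (series (fun n => \sum_(t <- level_types d n)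
       `|g (f (diag_class R k d t))| * mass t)).
  move=> gle; apply: (series_le_cvg _ _ _ bcvg) => n.
  - by apply: sumr_ge0 => t _; rewrite mulr_ge0.
  - by apply: sumr_ge0 => t _; rewrite mulr_ge0 ?nrm_ge0.
  by apply: ler_sum => t _; rewrite ler_wpM2r.
have [intRe cvRe] := @integral_types (fun y => complex.Re (f y)) (part _ (@nrm_Re R)).
have [intIm cvIm] := @integral_types (fun y => complex.Im (f y)) (part _ (@nrm_Im R)).
split; first by split.
apply/esym/(csum_unique asum); apply: csum_ReIm.
  have -> : (fun n => complex.Re (a n)) = (fun n => \sum_(t <- level_types d n)
      complex.Re (f (diag_class R k d t)) * mass t).
    by apply/funext => n; rewrite Re_sum.
  exact: cvRe.
have -> : (fun n => complex.Im (a n)) = (fun n => \sum_(t <- level_types d n)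
    complex.Im (f (diag_class R k d t)) * mass t).
  by apply/funext => n; rewrite Im_sum.
exact: cvIm.
Qed.

End HeightIntegral.

(** * Meromorphic continuation and the three closed formulas *)

Section Continuation.
Variable R : realType.
Local Notation C := R[i].
Local Notation nrm := (@normc R).

Lemma expansion_nat n (z : C) : expansion n%:R (fun=> n%:R : C) z.
Proof. by rewrite -(rmorph_nat (@fpsC C)); exact: expansion_const. Qed.

Lemma expansion_laurent phi (f : C -> C) z : expansion phi f z -> laurent_at f z.
Proof.
move=> [H _]; exists 0%N, phi; suff -> : (fun w => w ^+ 0 * f (z + w)) = (fun w => f (z + w)) by [].
by apply/funext => w; rewrite expr0 mul1r.
Qed.

(* If an expansion of [f] vanished, then so would [f] near [0]. *)
Lemma expansion_neq0 (f : C -> C) (phi : C -> fps C) (e : R) : 0 < e ->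
  (forall z, expansion (phi z) f z) -> (forall z, nrm z < e -> f z != 0) ->
  forall z, phi z != 0.
Proof.
move=> e0 Hphi f0 z; apply/eqP => z0.
have [germz _] := Hphi z; rewrite z0 in germz.
have := identity_theorem (fun w => expansion_laurent (Hphi w)) 0 (germ_zero germz).
by move=> /(near0_ex e0)[w [_ we]]; rewrite add0r => E; have /eqP := f0 w we.
Qed.

(** [phiP] and [phiD] stand for P and D evaluated in the ring of formal power series, which turns an
    expansion of u into expansions of numerator and denominator. *)
Lemma height_zeta_of_series (k : finFieldType) (d : nat) (P D : C -> C -> C)
    (phiP phiD : fps C -> fps C) : (0 < d <= 5)%N ->
  (forall z : C, nrm z < #|k|%:R -> D #|k|%:R z != 0) ->
  (forall z : C, nrm z < #|k|%:R ->
     height_series d #|k|%:R z = P #|k|%:R z / D #|k|%:R z) ->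
  (forall phi f z, expansion phi f z ->
     expansion (phiP phi) (fun w => P #|k|%:R (f w)) z) ->
  (forall phi f z, expansion phi f z ->
     expansion (phiD phi) (fun w => D #|k|%:R (f w)) z) ->
  height_zeta_eq k d P D.
Proof.
move=> d0 D0 HS HP HD mu lam haar quot.
have d1 : (0 < d)%N by case/andP: d0.
pose u s : C := cpow (#|k|%:R : R) (s / d%:R).
pose lambda : R := ln #|k|%:R / d%:R.
pose phiu z := FPS (fun n => cexp (z * lambda%:C%C) * (lambda%:C%C ^+ n / n`!%:R)).
have Hu z : expansion (phiu z) u z.
  have -> : u = fun w => cexp (w * lambda%:C%C).
    apply/funext => w; rewrite /u /cpow /lambda; congr cexp.
    by rewrite rmorphM fmorphV rmorph_nat mulrAC mulrA.
  exact: expansion_cexp.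
have small (s : C) : nrm s < 1 -> complex.Re s < d%:R.
  move=> s1; apply: le_lt_trans (ler_norm _) _; apply: le_lt_trans (nrm_Re _) _.
  by apply: lt_le_trans s1 _; rewrite ler1n.
have Du (s : C) : complex.Re s < d%:R -> D #|k|%:R (u s) != 0.
  by move=> /(nrm_u k d0) /D0.
have anaN z : exists phi, expansion phi (fun s => P #|k|%:R (u s)) z.
  by exists (phiP (phiu z)); exact: HP.
have anaD z : exists2 phi, expansion phi (fun s => D #|k|%:R (u s)) z & phi != 0.
  exists (phiD (phiu z)); first exact: HD.
  apply: (@expansion_neq0 (fun s => D #|k|%:R (u s)) (fun z => phiD (phiu z)) 1) => //.
    by move=> w; exact: HD.
  by move=> w /small /Du.
have integral s : complex.Re s < d%:R ->
    let f := fun y : discreteY k d => cpow (alpha R y) s in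
    abs_integrable (nuY lam) f /\
    P #|k|%:R (u s) / D #|k|%:R (u s) = cintegral (nuY lam) f.
  move=> sd f; have [H1 H2] := height_integral d0 haar quot sd.
  split; first exact: H1.
  rewrite [RHS]H2 -/(u s) HS //; exact: nrm_u.
split.
  have [Z merZ ZE] := quotient_continuation anaN anaD.
  exists Z; split=> // s sd f; have [H1 H2] := integral s sd.
  split; first exact: H1.
  by rewrite ZE ?Du.
move=> Z [merZ ZI] s q v Dv.
apply: (quotient_unique anaN anaD (Z := Z) (a := 0) merZ _ Dv).
(* The unit disc about 0 lies in the half plane of convergence because d >= 1. There Z and the
   quotient are both the integral, which starts the identity theorem. *)
exists 1 => // w _ w1; rewrite add0r.
have sd := small w w1; have [_ H2] := integral w sd.
have [_ ->] := ZI w sd; by rewrite H2.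
Qed.

End Continuation.

Ltac expand := match goal with
  | |- expansion (_ + _) _ _ => apply: expansionD; expand
  | |- expansion (_ * _) _ _ => apply: expansionM; expand
  | |- expansion (- _) _ _ => apply: expansionN; expand
  | |- expansion (_ ^+ _) _ _ => apply: expansionX; expand
  | |- expansion (fpsC _) _ _ => exact: expansion_const
  | |- expansion 1 _ _ => exact: (expansion_nat 1)
  | |- expansion _%:R _ _ => exact: expansion_nat
  | _ => assumption
  end.

Theorem proposition5p5 (R : realType) (k : finFieldType) :
  height_zeta_eq k 3 (@P3 R[i]%C) (@D3 R[i]%C) /\
  height_zeta_eq k 4 (@P4 R[i]%C) (@D4 R[i]%C) /\
  height_zeta_eq k 5 (@P5 R[i]%C) (@D5 R[i]%C).
Proof.

split; last split.
- apply: (@height_zeta_of_series _ _ _ _ _ (P3 (fpsC #|k|%:R)) (D3 (fpsC #|k|%:R))) => //.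
  + exact: D3_neq0.
  + exact: height_series3.
  + by move=> phi f z H; rewrite /P3; expand.
  + by move=> phi f z H; rewrite /D3; expand.
- apply: (@height_zeta_of_series _ _ _ _ _ (P4 (fpsC #|k|%:R)) (D4 (fpsC #|k|%:R))) => //.
  + exact: D4_neq0.
  + exact: height_series4.
  + by move=> phi f z H; rewrite /P4; expand.
  + by move=> phi f z H; rewrite /D4; expand.
- apply: (@height_zeta_of_series _ _ _ _ _ (P5 (fpsC #|k|%:R)) (D5 (fpsC #|k|%:R))) => //.
  + exact: D5_neq0.
  + exact: height_series5.
  + by move=> phi f z H; rewrite /P5; expand.
  + by move=> phi f z H; rewrite /D5; expand.
Qed.
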